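(* Let $m\in\mathbb Z_{>0}$. (1) The action of $\mathcal T^{-1}\otimes\mathrm{id}^{m-1}$ on $\mathbb V^{\otimes m}$ coincides with the action of $H_0\in\mathcal H_{B_m}$ on $\mathbb V^{\otimes m}$. (2) ($(\mathbf U^\imath,\mathcal H_{B_m})$-duality) The actions of $\mathbf U^\imath$ and $\mathcal H_{B_m}$ on $\mathbb V^{\otimes m}$ commute with each other, and they form double centralizers (i.e. the image of each algebra in $\mathrm{End}_{\mathbb Q(q)}(\mathbb V^{\otimes m})$ is the full centralizer of the image of the other).
   Context: Let $q$ be an indeterminate and fix $r\in\mathbb N=\{0,1,\dots\}$. Put $\mathbb I=\{-r,\dots,r\}$, $\mathbb I^\imath=\{1,\dots,r\}$, $I=\{-r-\frac12,-r+\frac12,\dots,r+\frac12\}$. $\Lambda=\bigoplus_{a\in I}\mathbb Z\varepsilon_a$ with $(\varepsilon_a,\varepsilon_b)=\delta_{ab}$; $\alpha_i=\varepsilon_{i-\frac12}-\varepsilon_{i+\frac12}$ ($i\in\mathbb I$). $\mathbf U=\mathbf U_q(\mathfrak{sl}_{2r+2})$ is the $\mathbb Q(q)$-algebra generated by $E_{\alpha_i},F_{\alpha_i},K_{\alpha_i}^{\pm1}$ ($i\in\mathbb I$) with commuting $K$'s, $K_{\alpha_i}E_{\alpha_j}K_{\alpha_i}^{-1}=q^{(\alpha_i,\alpha_j)}E_{\alpha_j}$, $K_{\alpha_i}F_{\alpha_j}K_{\alpha_i}^{-1}=q^{-(\alpha_i,\alpha_j)}F_{\alpha_j}$, $[E_{\alpha_i},F_{\alpha_j}]=\delta_{ij}\frac{K_{\alpha_i}-K_{\alpha_i}^{-1}}{q-q^{-1}}$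 and the quantum Serre relations. Coproduct: $\Delta(E_{\alpha_i})=1\otimes E_{\alpha_i}+E_{\alpha_i}\otimes K_{\alpha_i}^{-1}$, $\Delta(F_{\alpha_i})=F_{\alpha_i}\otimes1+K_{\alpha_i}\otimes F_{\alpha_i}$, $\Delta(K_{\alpha_i})=K_{\alpha_i}\otimes K_{\alpha_i}$. $\psi$ is the anti-linear ($q\mapsto q^{-1}$) bar involution of $\mathbf U$ fixing $E_{\alpha_i},F_{\alpha_i}$ and inverting $K_{\alpha_i}$. $\mathbf U^\imath$ is the $\mathbb Q(q)$-subalgebra of $\mathbf U$ generated, for $i\in\mathbb I^\imath$, by $k_{\alpha_i}^{\pm1}=(K_{\alpha_i}K_{\alpha_{-i}}^{-1})^{\pm1}$, $e_{\alpha_i}=E_{\alpha_i}+K_{\alpha_i}^{-1}F_{\alpha_{-i}}$, $f_{\alpha_i}=F_{\alpha_i}K_{\alpha_{-i}}^{-1}+E_{\alpha_{-i}}$, and by $t=E_{\alpha_0}+qF_{\alpha_0}K_{\alpha_0}^{-1}+K_{\alpha_0}^{-1}$. (The paper presents $\mathbf U^\imath$ by generators and relations and embeds it in $\mathbf U$ this way.) It has an anti-linear bar involution $\psi_\imath$ fixing $e_{\alpha_i},f_{\alpha_i},t$ and inverting $k_{\alpha_i}$. The natural representation $\mathbb V=\bigoplus_{a\in I}\mathbb Q(q)v_a$ of $\mathbf U$: $E_{\alpha_i}v_a=\delta_{i+\frac12,a}v_{a-1}$, $F_{\alpha_i}v_a=\delta_{i-\frac12,a}v_{a+1}$, $K_{\alpha_i}v_a=q^{(\alpha_i,\varepsilon_a)}v_a$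 (so $v_a$ has weight $\varepsilon_a$). $\mathbb V^{\otimes m}$ is a $\mathbf U$-module via iterated $\Delta$, hence a $\mathbf U^\imath$-module by restriction. It has basis $M_f=v_{f(1)}\otimes\cdots\otimes v_{f(m)}$, $f\in I^m$. $\mathcal H_{B_m}$ is the Hecke algebra of type $B_m$ over $\mathbb Q(q)$ with generators $H_0,\dots,H_{m-1}$ and relations $(H_i-q^{-1})(H_i+q)=0$ ($i\ge0$), $H_iH_{i+1}H_i=H_{i+1}H_iH_{i+1}$ ($i>0$), $H_iH_j=H_jH_i$ ($|i-j|>1$), $H_0H_1H_0H_1=H_1H_0H_1H_0$. Let $f\cdot s_j$ ($j>0$) swap $f(j),f(j+1)$ and $f\cdot s_0$ negate $f(1)$. $\mathcal H_{B_m}$ acts on $\mathbb V^{\otimes m}$ on the right by $M_fH_a=q^{-1}M_f$ if $a>0$, $f(a)=f(a+1)$; $M_{f\cdot s_a}$ if $a>0$, $f(a)<f(a+1)$; $M_{f\cdot s_a}+(q^{-1}-q)M_f$ if $a>0$, $f(a)>f(a+1)$; $M_{f\cdot s_0}$ if $a=0$, $f(1)>0$; $M_{f\cdot s_0}+(q^{-1}-q)M_f$ if $a=0$, $f(1)<0$. The operator $\mathcal T=\Upsilon\circ\widetilde\zeta\circ T_{w_0}:\mathbb V\to\mathbb V$: (a) $\Upsilon=\sum_\mu\Upsilon_\mu$ with $\Upsilon_\mu\in\mathbf U^-_{-\mu}$ ($\mu\in\sum\mathbb N\alpha_i$), $\Upsilon_0=1$, is the unique such formal sum with $\psi_\imath(u)\Upsilon=\Upsilon\psi(u)$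 for all $u\in\mathbf U^\imath$ (it acts on finite-dimensional modules). (b) $\widetilde\zeta$ multiplies a vector of weight $\mu$ by $\zeta(\mu)$, where $\zeta$ is a function on $\Lambda$ with $\zeta(\mu+\alpha_0)=-q\zeta(\mu)$ and $\zeta(\mu+\alpha_i)=-q^{(\alpha_i,\mu+\alpha_i)-(\alpha_{-i},\mu)}\zeta(\mu)$ for $0\ne i\in\mathbb I$, normalized by $\zeta(\varepsilon_{-r-\frac12})=1$, so that $\zeta(\varepsilon_{r+\frac12-i})=(-q)^{i-2r-1}$ for $0\le i\le 2r+1$. (c) $T_{w_0}$ is the braid group operator attached to the longest element $w_0$ of $\mathfrak S_{2r+2}$, i.e. the product along a reduced word of the operators $T_{\alpha_i}(m)=\sum_{a,b,c\ge0,\,-a+b-c=(\lambda,\alpha_i)}(-1)^bq^{b-ac}E_{\alpha_i}^{(a)}F_{\alpha_i}^{(b)}E_{\alpha_i}^{(c)}m$ for $m$ of weight $\lambda$, with $x^{(a)}=x^a/[a]!$. *)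

(* Defs.v *)
From HB Require Import structures.
From mathcomp Require Import all_boot all_order all_algebra fingroup perm.
From mathcomp Require Import boolp classical_sets fsbigop generic_quotient.

Set Implicit Arguments.
Unset Strict Implicit.
Unset Printing Implicit Defensive.

Import GRing.Theory.
Local Open Scope ring_scope.
Local Open Scope quotient_scope.

Inductive expr (K : fieldType) (G : Type) : Type :=
| Cst of K
| Gen of G
| Add of expr K G & expr K G
| Mul of expr K G & expr K G.
Arguments Cst {K G}.
Arguments Gen {K G}.

Declare Scope expr_scope.
Delimit Scope expr_scope with X.
Bind Scope expr_scope with expr.
Notation "x + y" := (Add x y) : expr_scope.
Notation "x * y" := (Mul x y) : expr_scope.
Notation "x - y" := (Add x (Mul (Cst (-1)) y)) : expr_scope.

(* The least congruence that contains [rel] and makes the quotient an         *)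
(* associative unital K-algebra, in which Cst c is the scalar c.              *)
Inductive cong (K : fieldType) (G : Type) (rel : expr K G -> expr K G -> Prop) :
    expr K G -> expr K G -> Prop :=
| cong_rel x y : rel x y -> cong rel x y
| cong_refl x : cong rel x x
| cong_sym x y : cong rel x y -> cong rel y x
| cong_trans x y z : cong rel x y -> cong rel y z -> cong rel x z
| cong_add x x' y y' :
    cong rel x x' -> cong rel y y' -> cong rel (x + y)%X (x' + y')%X
| cong_mul x x' y y' :
    cong rel x x' -> cong rel y y' -> cong rel (x * y)%X (x' * y')%X
| cong_addA x y z : cong rel (x + (y + z))%X (x + y + z)%X
| cong_addC x y : cong rel (x + y)%X (y + x)%X
| cong_add0 x : cong rel (Cst 0 + x)%X x
| cong_mulA x y z : cong rel (x * (y * z))%X (x * y * z)%X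
| cong_mul1 x : cong rel (Cst 1 * x)%X x
| cong_mul0 x : cong rel (Cst 0 * x)%X (Cst 0)
| cong_mulDl x y z : cong rel ((x + y) * z)%X (x * z + y * z)%X
| cong_mulDr x y z : cong rel (x * (y + z))%X (x * y + x * z)%X
| cong_cstD a b : cong rel (Cst a + Cst b)%X (Cst (a + b))
| cong_cstM a b : cong rel (Cst a * Cst b)%X (Cst (a * b))
| cong_cstC a x : cong rel (Cst a * x)%X (x * Cst a)%X.

Section Presented.
Variables (K : fieldType) (G : Type) (rel : expr K G -> expr K G -> Prop).

Definition congb (x y : {classic expr K G}) : bool := `[< cong rel x y >].

Lemma congb_refl : reflexive congb.
Proof. by move=> x; apply/asboolP/cong_refl. Qed.
Lemma congb_sym : symmetric congb.
Proof. by move=> x y; apply/asboolP/asboolP => /cong_sym. Qed.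
Lemma congb_trans : transitive congb.
Proof.
by move=> y x z /asboolP xy /asboolP yz; apply/asboolP/(cong_trans xy yz).
Qed.
Canonical congb_equiv := EquivRel congb congb_refl congb_sym congb_trans.

Definition presented : Type := {eq_quot congb}.
HB.instance Definition _ : EqQuotient _ congb presented :=
  EqQuotient.on presented.
HB.instance Definition _ := Choice.on presented.

Definition cls (x : expr K G) : presented := \pi_presented (x : {classic _}).
Definition rep (u : presented) : expr K G := repr u.

Lemma cls_rep u : cls (rep u) = u.
Proof. exact: reprK. Qed.
Lemma clsP x y : cls x = cls y <-> cong rel x y.
Proof.
split=> [/eqmodP/asboolP//|xy]; exact/eqmodP/asboolP.
Qed.
Lemma rep_cls x : cong rel (rep (cls x)) x.
Proof. by apply/clsP; rewrite cls_rep. Qed.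

Definition padd u v := cls (rep u + rep v).
Definition pmul u v := cls (rep u * rep v).
Definition pscale (a : K) u := cls (Cst a * rep u).
Definition popp u := pscale (-1) u.

Lemma paddE x y : padd (cls x) (cls y) = cls (x + y).
Proof. by apply/clsP; apply: cong_add; apply: rep_cls. Qed.
Lemma pmulE x y : pmul (cls x) (cls y) = cls (x * y).
Proof. by apply/clsP; apply: cong_mul; apply: rep_cls. Qed.
Lemma pscaleE a x : pscale a (cls x) = cls (Cst a * x).
Proof. by apply/clsP; apply: cong_mul; [apply: cong_refl|apply: rep_cls]. Qed.

Lemma clsW (P : presented -> Prop) : (forall x, P (cls x)) -> forall u, P u.
Proof. by move=> H u; rewrite -(cls_rep u). Qed.

Lemma paddA : associative padd.
Proof.
elim/clsW=> x; elim/clsW=> y; elim/clsW=> z.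
by rewrite !paddE; apply/clsP/cong_addA.
Qed.
Lemma paddC : commutative padd.
Proof.
by elim/clsW=> x; elim/clsW=> y; rewrite !paddE; apply/clsP/cong_addC.
Qed.
Lemma padd0 : left_id (cls (Cst 0)) padd.
Proof. by elim/clsW=> x; rewrite paddE; apply/clsP/cong_add0. Qed.
Lemma paddN : left_inverse (cls (Cst 0)) popp padd.
Proof.
elim/clsW=> x; rewrite /popp pscaleE paddE; apply/clsP.
apply: cong_trans (cong_mul0 rel x).
apply: (@cong_trans _ _ _ _ (Cst (-1) * x + Cst 1 * x)%X).
  by apply: cong_add; [apply: cong_refl|apply: cong_sym; apply: cong_mul1].
apply: cong_trans (cong_sym (cong_mulDl _ _ _ _)) _.
apply: cong_mul; last exact: cong_refl.
by have := cong_cstD rel (-1) 1; rewrite addNr.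
Qed.
HB.instance Definition _ :=
  GRing.isZmodule.Build presented paddA paddC padd0 paddN.

Lemma pmulA : associative pmul.
Proof.
elim/clsW=> x; elim/clsW=> y; elim/clsW=> z.
by rewrite !pmulE; apply/clsP/cong_mulA.
Qed.
Lemma pmul1 : left_id (cls (Cst 1)) pmul.
Proof. by elim/clsW=> x; rewrite pmulE; apply/clsP/cong_mul1. Qed.
Lemma pmulr1 : right_id (cls (Cst 1)) pmul.
Proof.
elim/clsW=> x; rewrite pmulE; apply/clsP.
exact: cong_trans (cong_sym (cong_cstC _ _ _)) (cong_mul1 _ _).
Qed.
Lemma pmulDl : left_distributive pmul +%R.
Proof.
elim/clsW=> x; elim/clsW=> y; elim/clsW=> z.
by rewrite /GRing.add /= !(pmulE, paddE); apply/clsP/cong_mulDl.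
Qed.
Lemma pmulDr : right_distributive pmul +%R.
Proof.
elim/clsW=> x; elim/clsW=> y; elim/clsW=> z.
by rewrite /GRing.add /= !(pmulE, paddE); apply/clsP/cong_mulDr.
Qed.
HB.instance Definition _ :=
  GRing.Zmodule_isPzRing.Build presented pmulA pmul1 pmulr1 pmulDl pmulDr.

Lemma pscaleA a b u : pscale a (pscale b u) = pscale (a * b) u.
Proof.
elim/clsW: u => x; rewrite !pscaleE; apply/clsP.
apply: cong_trans (cong_mulA _ _ _ _) _.
by apply: cong_mul; [apply: cong_cstM|apply: cong_refl].
Qed.
Lemma pscale1 : left_id 1 pscale.
Proof. by elim/clsW=> x; rewrite pscaleE; apply/clsP/cong_mul1. Qed.
Lemma pscaleDr : right_distributive pscale +%R.
Proof.
move=> a; elim/clsW=> x; elim/clsW=> y.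
by rewrite /GRing.add /= !(pscaleE, paddE); apply/clsP/cong_mulDr.
Qed.
Lemma pscaleDl u : {morph pscale^~ u : a b / a + b}.
Proof.
move=> a b; elim/clsW: u => x; rewrite [RHS]/GRing.add /= !(pscaleE, paddE).
apply/clsP; apply: cong_trans (cong_mulDl _ _ _ _).
by apply: cong_mul; [apply/cong_sym/cong_cstD|apply: cong_refl].
Qed.
HB.instance Definition _ :=
  GRing.Zmodule_isLmodule.Build K presented pscaleA pscale1 pscaleDr pscaleDl.

Lemma pscalerAl (a : K) (u v : presented) : a *: (u * v) = (a *: u) * v.
Proof.
elim/clsW: u => x; elim/clsW: v => y.
rewrite /GRing.scale /GRing.mul /= !(pscaleE, pmulE).
exact/clsP/cong_mulA.
Qed.
Lemma pscalerAr (a : K) (u v : presented) : a *: (u * v) = u * (a *: v).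
Proof.
elim/clsW: u => x; elim/clsW: v => y.
rewrite /GRing.scale /GRing.mul /= !(pscaleE, pmulE); apply/clsP.
apply: cong_trans (cong_mulA _ _ _ _) _.
apply: cong_trans (cong_sym (cong_mulA _ _ _ _)).
by apply: cong_mul; [apply: cong_cstC|apply: cong_refl].
Qed.

End Presented.

(* The left (resp. right) action in which a generator g acts by op g. It      *)
(* descends to [presented rel] as soon as the operators satisfy [rel] (lemmas *)
(* [lact_cong] and [ract_cong]): the operators [Vgen], [Vtgen] and [Hgen]     *)
(* below satisfy the defining relations, so that [Vact], [Vtact] and [Hact]   *)
(* do not depend on the representative [rep u].                               *)
Section Actions.
Variables (K : fieldType) (G : Type) (W : lmodType K) (op : G -> W -> W).

Fixpoint lact (x : expr K G) (w : W) : W :=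
  match x with
  | Cst c => c *: w
  | Gen g => op g w
  | Add y z => lact y w + lact z w
  | Mul y z => lact y (lact z w)
  end.

Fixpoint ract (x : expr K G) (w : W) : W :=
  match x with
  | Cst c => c *: w
  | Gen g => op g w
  | Add y z => ract y w + ract z w
  | Mul y z => ract z (ract y w)
  end.

End Actions.

Section ActionsCong.
Variables (K : fieldType) (G : Type) (W : lmodType K) (op : G -> W -> W).
Variable rel : expr K G -> expr K G -> Prop.
Hypothesis op_linear : forall g, linear (op g).

Lemma lact_linear x : linear (lact op x).
Proof.
elim: x => [c|g|x IHx y IHy|x IHx y IHy] a u v; rewrite /= ?op_linear //.
- by rewrite scalerDr !scalerA mulrC.
- by rewrite IHx IHy scalerDr addrACA.
- by rewrite IHy IHx.
Qed.

Lemma ract_linear x : linear (ract op x).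
Proof.
elim: x => [c|g|x IHx y IHy|x IHx y IHy] a u v; rewrite /= ?op_linear //.
- by rewrite scalerDr !scalerA mulrC.
- by rewrite IHx IHy scalerDr addrACA.
- by rewrite IHx IHy.
Qed.

Lemma linear_scale (f : W -> W) : linear f -> forall a u, f (a *: u) = a *: f u.
Proof.
move=> fl a u; have f0 : f 0 = 0.
  by have /esym/(canRL (addrK _)) := fl 1 0 0; rewrite !scale1r !addr0 subrr => ->.
by rewrite -[a *: u]addr0 fl f0 addr0.
Qed.

Lemma linear_add (f : W -> W) : linear f -> forall u v, f (u + v) = f u + f v.
Proof. by move=> fl u v; have := fl 1 u v; rewrite !scale1r. Qed.

Lemma lact_cong : (forall x y, rel x y -> lact op x =1 lact op y) ->
  forall x y, cong rel x y -> lact op x =1 lact op y.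
Proof.
move=> Hrel x y; elim=> {x y} /=.
- by move=> x y /Hrel.
- by [].
- by move=> x y _ IH w; rewrite IH.
- by move=> x y z _ IH1 _ IH2 w; rewrite IH1.
- by move=> x x' y y' _ IH1 _ IH2 w /=; rewrite IH1 IH2.
- by move=> x x' y y' _ IH1 _ IH2 w /=; rewrite IH2 IH1.
- by move=> x y z w; rewrite addrA.
- by move=> x y w; rewrite addrC.
- by move=> x w; rewrite scale0r add0r.
- by [].
- by move=> x w; rewrite scale1r.
- by move=> x w; rewrite !scale0r.
- by [].
- by move=> x y z w; rewrite linear_add//; apply: lact_linear.
- by move=> a b w; rewrite scalerDl.
- by move=> a b w; rewrite scalerA.
- by move=> a x w; rewrite linear_scale//; apply: lact_linear.
Qed.

Lemma ract_cong : (forall x y, rel x y -> ract op x =1 ract op y) ->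
  forall x y, cong rel x y -> ract op x =1 ract op y.
Proof.
move=> Hrel x y; elim=> {x y} /=.
- by move=> x y /Hrel.
- by [].
- by move=> x y _ IH w; rewrite IH.
- by move=> x y z _ IH1 _ IH2 w; rewrite IH1.
- by move=> x x' y y' _ IH1 _ IH2 w /=; rewrite IH1 IH2.
- by move=> x x' y y' _ IH1 _ IH2 w /=; rewrite IH1 IH2.
- by move=> x y z w; rewrite addrA.
- by move=> x y w; rewrite addrC.
- by move=> x w; rewrite scale0r add0r.
- by [].
- by move=> x w; rewrite scale1r.
- move=> x w; rewrite linear_scale; last exact: ract_linear.
  by rewrite !scale0r.
- by move=> x y z w; rewrite linear_add//; apply: ract_linear.
- by [].
- by move=> a b w; rewrite scalerDl.
- by move=> a b w; rewrite scalerA mulrC.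
- by move=> a x w; rewrite linear_scale//; apply: ract_linear.
Qed.

End ActionsCong.

Notation Qq := {fraction {poly rat}}.
Local Notation "x %:F" := (@FracField.tofrac _ x).

Definition q : Qq := ('X : {poly rat})%:F.

Definition at_qinv (p : {poly rat}) : Qq :=
  (map_poly (fun c : rat => (c%:P)%:F) p).[q^-1].

(* n(q) / d(q) |-> n(q^-1) / d(q^-1); d(q^-1) is nonzero when d is.           *)
Definition barq (x : Qq) : Qq :=
  let nd := repr x in at_qinv \n_nd / at_qinv \d_nd.

(* The half-integers -r-1/2, ..., r+1/2 are encoded by k |-> k - (r+1/2) and  *)
(* the integers -r, ..., r by k |-> k - r; negation is [rev_ord] on both.     *)
Definition Ihalf (r : nat) := 'I_(r.*2.+2).
Definition Iint (r : nat) := 'I_(r.*2.+1).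

Section Weights.
Variable r : nat.

(* i - 1/2 and i + 1/2.                                                       *)
Definition dn (i : Iint r) : Ihalf r := widen_ord (leqnSn _) i.
Definition up (i : Iint r) : Ihalf r := lift ord0 i.

Definition i0 : Iint r := inord r.
(* i : 'I_r stands for the integer i + 1 in {1, ..., r}.                      *)
Definition ipos (i : 'I_r) : Iint r := inord (r + i.+1).
Definition ineg (i : 'I_r) : Iint r := rev_ord (ipos i).

Definition Lambda := {ffun Ihalf r -> int}.
Definition eps (a : Ihalf r) : Lambda := [ffun b => (b == a)%:Z].
Definition form (x y : Lambda) : int := \sum_a x a * y a.
Definition alpha (i : Iint r) : Lambda := eps (dn i) - eps (up i).

End Weights.

Inductive subalg_gen (A : algType Qq) (S : A -> Prop) : A -> Prop :=
| subalg_in x : S x -> subalg_gen S x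
| subalg_scalar c : subalg_gen S c%:A
| subalg_add x y : subalg_gen S x -> subalg_gen S y -> subalg_gen S (x + y)
| subalg_mul x y : subalg_gen S x -> subalg_gen S y -> subalg_gen S (x * y).

Inductive lin_span (A : lmodType Qq) (S : A -> Prop) : A -> Prop :=
| span_0 : lin_span S 0
| span_add c x y : S x -> lin_span S y -> lin_span S (c *: x + y).

Inductive Ugen (r : nat) : Type :=
| gE of Iint r | gF of Iint r | gK of Iint r | gKinv of Iint r.

Section QuantumGroup.
Variable r : nat.
Implicit Types i j : Iint r.

Notation Uexpr := (expr Qq (Ugen r)).
Local Notation E i := (Gen (gE i) : Uexpr).
Local Notation F i := (Gen (gF i) : Uexpr).
Local Notation Kp i := (Gen (gK i) : Uexpr).
Local Notation Km i := (Gen (gKinv i) : Uexpr).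

Inductive Urel : Uexpr -> Uexpr -> Prop :=
| Urel_KV i : Urel (Kp i * Km i) (Cst 1)
| Urel_VK i : Urel (Km i * Kp i) (Cst 1)
| Urel_KK i j : Urel (Kp i * Kp j) (Kp j * Kp i)
| Urel_KE i j :
    Urel (Kp i * E j * Km i) (Cst (q ^ form (alpha i) (alpha j)) * E j)
| Urel_KF i j :
    Urel (Kp i * F j * Km i) (Cst (q ^ (- form (alpha i) (alpha j))) * F j)
| Urel_EF i j :
    Urel (E i * F j - F j * E i)
         (Cst (if i == j then (q - q^-1)^-1 else 0) * (Kp i - Km i))
| Urel_EE i j : form (alpha i) (alpha j) = 0 -> Urel (E i * E j) (E j * E i)
| Urel_FF i j : form (alpha i) (alpha j) = 0 -> Urel (F i * F j) (F j * F i)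
| Urel_serreE i j : form (alpha i) (alpha j) = -1 ->
    Urel (E i * E i * E j + E j * E i * E i)
         (Cst (q + q^-1) * (E i * E j * E i))
| Urel_serreF i j : form (alpha i) (alpha j) = -1 ->
    Urel (F i * F i * F j + F j * F i * F i)
         (Cst (q + q^-1) * (F i * F j * F i)).

Definition U : Type := presented Urel.
HB.instance Definition _ := GRing.PzRing.on U.
HB.instance Definition _ := GRing.Lmodule.on U.

Definition counit_gen (g : Ugen r) : Qq :=
  match g with gE _ | gF _ => 0 | gK _ | gKinv _ => 1 end.

Lemma U_nontrivial : (1 : U) != 0.
Proof.
pose op (g : Ugen r) (x : Qq^o) := counit_gen g *: x.
have opl g : linear (op g) by move=> a u v; rewrite /op scalerDr !scalerA mulrC.
have resp x y : Urel x y -> lact op x =1 lact op y.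
  by case=> * ?; rewrite /= /op /= ?(scale0r, scaler0, scale1r, scaleN1r, addr0, subrr).
apply/eqP => /clsP /(lact_cong opl resp) /(_ 1) /eqP.
by rewrite /= scale1r scale0r (negbTE (oner_neq0 _)).
Qed.
HB.instance Definition _ := GRing.PzSemiRing_isNonZero.Build U U_nontrivial.
HB.instance Definition _ :=
  GRing.Lmodule_isLalgebra.Build Qq U (@pscalerAl _ _ Urel).
HB.instance Definition _ :=
  GRing.Lalgebra_isAlgebra.Build Qq U (@pscalerAr _ _ Urel).

Definition UE i : U := cls Urel (E i).
Definition UF i : U := cls Urel (F i).
Definition UK i : U := cls Urel (Kp i).
Definition UKinv i : U := cls Urel (Km i).

Fixpoint psi_expr (x : Uexpr) : Uexpr :=
  match x with
  | Cst c => Cst (barq c)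
  | Gen (gE i) => E i
  | Gen (gF i) => F i
  | Gen (gK i) => Km i
  | Gen (gKinv i) => Kp i
  | Add y z => psi_expr y + psi_expr z
  | Mul y z => psi_expr y * psi_expr z
  end%X.

(* [psi_expr] preserves the defining relations.                              *)
Definition psi (u : U) : U := cls Urel (psi_expr (rep u)).

Definition Uplus : U -> Prop := subalg_gen (fun x => exists i, x = UE i).
Definition Uzero : U -> Prop :=
  subalg_gen (fun x => exists i, x = UK i \/ x = UKinv i).
(* mu stands for the weight \sum_i (mu i) alpha_i.                            *)
Definition Uminus (mu : {ffun Iint r -> nat}) : U -> Prop :=
  lin_span (fun x => exists2 s : seq (Iint r),
    forall i, count_mem i s = mu i & x = \prod_(i <- s) UF i).

Definition ie (i : 'I_r) : U :=
  UE (ipos i) + UKinv (ipos i) * UF (ineg i).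
Definition if_ (i : 'I_r) : U :=
  UF (ipos i) * UKinv (ineg i) + UE (ineg i).
Definition ik (i : 'I_r) : U := UK (ipos i) * UKinv (ineg i).
Definition ikinv (i : 'I_r) : U := UKinv (ipos i) * UK (ineg i).
Definition it : U := UE (i0 r) + q *: (UF (i0 r) * UKinv (i0 r)) + UKinv (i0 r).

Definition Uiota : U -> Prop :=
  subalg_gen (fun x => x = it \/ exists i : 'I_r,
    [\/ x = ie i, x = if_ i, x = ik i | x = ikinv i]).

(* Only the values on [Uiota] are constrained.                                *)
Record is_psi_iota (psi_i : U -> U) : Prop := {
  psi_iota_stable u : Uiota u -> Uiota (psi_i u);
  psi_iota_add u v : Uiota u -> Uiota v -> psi_i (u + v) = psi_i u + psi_i v;
  psi_iota_scale c u : Uiota u -> psi_i (c *: u) = barq c *: psi_i u;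
  psi_iota_one : psi_i 1 = 1;
  psi_iota_mul u v : Uiota u -> Uiota v -> psi_i (u * v) = psi_i u * psi_i v;
  psi_iota_invol u : Uiota u -> psi_i (psi_i u) = u;
  psi_iota_e (i : 'I_r) : psi_i (ie i) = ie i;
  psi_iota_f (i : 'I_r) : psi_i (if_ i) = if_ i;
  psi_iota_t : psi_i it = it;
  psi_iota_k (i : 'I_r) : psi_i (ik i) = ikinv i;
  psi_iota_kinv (i : 'I_r) : psi_i (ikinv i) = ik i
}.

Definition ht (mu : {ffun Iint r -> nat}) : nat := (\sum_i mu i)%N.

(* U^+ U^0 (\sum_{ht mu >= N} U^-_{-mu}): formal sums \sum_mu u_mu with u_mu  *)
(* in U^+ U^0 U^-_{-mu} live in the completion of U for this filtration.      *)
Definition Ufil (N : nat) : U -> Prop :=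
  lin_span (fun x => exists a b c mu,
    [/\ Uplus a, Uzero b, Uminus mu c, (N <= ht mu)%N & x = a * b * c]).

Definition partial_sum (Ups : {ffun Iint r -> nat} -> U) (M : nat) : U :=
  \sum_(mu \in [set mu | (ht mu < M)%N]%classic) Ups mu.

(* The identity psi_i(u) Ups = Ups psi(u) in the completion says that the     *)
(* differences of the partial sums converge to 0.                             *)
Record is_Upsilon (psi_i : U -> U) (Ups : {ffun Iint r -> nat} -> U) : Prop := {
  Upsilon_minus mu : Uminus mu (Ups mu);
  Upsilon_0 : Ups [ffun=> 0%N] = 1;
  Upsilon_intertwines u : Uiota u -> forall N, exists M0, forall M,
    (M0 <= M)%N ->
    Ufil N (psi_i u * partial_sum Ups M - partial_sum Ups M * psi u)
}.

Definition coprod (g : Ugen r) : seq (Uexpr * Uexpr) :=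
  match g with
  | gE i => [:: (Cst 1, E i); (E i, Km i)]
  | gF i => [:: (F i, Cst 1); (Kp i, F i)]
  | gK i => [:: (Kp i, Kp i)]
  | gKinv i => [:: (Km i, Km i)]
  end.

End QuantumGroup.

Notation space T := {ffun T -> Qq^o}.

Definition bvec (T : finType) (x : T) : space T := [ffun y => (y == x)%:R].

(* The linear map sending the basis vector [bvec x] to [g x].                 *)
Definition lin_ext (T : finType) (W : lmodType Qq) (g : T -> W)
    (w : space T) : W :=
  \sum_x (w x : Qq) *: g x.

Section Representations.
Variable r : nat.
Implicit Types (i : Iint r) (a b : Ihalf r).

Definition V := space (Ihalf r).
Definition v a : V := bvec a.

Definition Vgen (g : Ugen r) : V -> V :=
  lin_ext (fun a => match g with
    | gE i => (if a == up i then v (dn i) else 0) : V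
    | gF i => if a == dn i then v (up i) else 0
    | gK i => q ^ form (alpha i) (eps a) *: v a
    | gKinv i => q ^ (- form (alpha i) (eps a)) *: v a
    end).

Definition Vact (u : U r) : V -> V := lact Vgen (rep u).

Definition Im (m : nat) := {ffun 'I_m -> Ihalf r}.
Definition Vt (m : nat) := space (Im m).
Definition M m (f : Im m) : Vt m := bvec f.

Definition ftail m (f : Im m.+1) : Im m := [ffun k => f (lift ord0 k)].

(* v_{f(1)} (x) (v_{f(2)} (x) ... (x) v_{f(m+1)}) is identified with M_f.     *)
Definition pure_tensor m (x : V) (w : Vt m) : Vt m.+1 :=
  [ffun f : Im m.+1 => (x (f ord0) : Qq) * (w (ftail f) : Qq)].

Definition tensor_map m (A : V -> V) (B : Vt m -> Vt m) : Vt m.+1 -> Vt m.+1 :=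
  lin_ext (fun f : Im m.+1 => pure_tensor (A (v (f ord0))) (B (M (ftail f)))).

(* V^{(x) m+1} = V (x) V^{(x) m} through [coprod]; V^{(x) 0} is the trivial   *)
(* module, on which U acts by the counit.                                     *)
Fixpoint Vtgen (m : nat) : Ugen r -> Vt m -> Vt m :=
  match m return Ugen r -> Vt m -> Vt m with
  | 0 => fun g w => counit_gen g *: w
  | m'.+1 => fun g w => \sum_(xy <- coprod g)
      tensor_map (lact Vgen xy.1) (lact (Vtgen (m := m')) xy.2) w
  end.

Definition Vtact m (u : U r) : Vt m -> Vt m := lact (@Vtgen m) (rep u).

End Representations.

Section Hecke.
Variable m : nat.
Notation Hexpr := (expr Qq 'I_m).
Local Notation Hg a := (Gen a : Hexpr).

Inductive Hrel : Hexpr -> Hexpr -> Prop :=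
| Hrel_quad a : Hrel ((Hg a - Cst q^-1) * (Hg a + Cst q)) (Cst 0)
| Hrel_braid (a b : 'I_m) : (0 < a)%N -> b = a.+1 :> nat ->
    Hrel (Hg a * Hg b * Hg a) (Hg b * Hg a * Hg b)
| Hrel_comm (a b : 'I_m) : (a.+1 < b)%N -> Hrel (Hg a * Hg b) (Hg b * Hg a)
| Hrel_B (a b : 'I_m) : a = 0 :> nat -> b = 1 :> nat ->
    Hrel (Hg a * Hg b * Hg a * Hg b) (Hg b * Hg a * Hg b * Hg a).

Definition HeckeB : Type := presented Hrel.
HB.instance Definition _ := GRing.PzRing.on HeckeB.
HB.instance Definition _ := GRing.Lmodule.on HeckeB.

Lemma HeckeB_nontrivial : (1 : HeckeB) != 0.
Proof.
pose op (a : 'I_m) (x : Qq^o) := q^-1 *: x.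
have opl g : linear (op g) by move=> a u w; rewrite /op scalerDr !scalerA mulrC.
have resp x y : Hrel x y -> lact op x =1 lact op y.
  by case=> * ?; rewrite /= /op /= ?(scaleN1r, scaleNr, scale1r, subrr, scale0r).
apply/eqP => /clsP /(lact_cong opl resp) /(_ 1) /eqP.
by rewrite /= scale1r scale0r (negbTE (oner_neq0 _)).
Qed.
HB.instance Definition _ := GRing.PzSemiRing_isNonZero.Build HeckeB HeckeB_nontrivial.
HB.instance Definition _ :=
  GRing.Lmodule_isLalgebra.Build Qq HeckeB (@pscalerAl _ _ Hrel).
HB.instance Definition _ :=
  GRing.Lalgebra_isAlgebra.Build Qq HeckeB (@pscalerAr _ _ Hrel).

Definition H (a : 'I_m) : HeckeB := cls Hrel (Hg a).

Variable r : nat.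
Implicit Type f : Im r m.

(* f(k) is [f] at the ordinal k - 1: s_a swaps the ordinals a - 1 and a.      *)
Definition act_s f (a : 'I_m) : Im r m :=
  if a == 0 :> nat then [ffun k => if k == a then rev_ord (f a) else f k]
  else [ffun k => f (tperm (ord_pred a) a k)].

Definition Hgen (a : 'I_m) : Vt r m -> Vt r m :=
  lin_ext (fun f =>
    if a == 0 :> nat then
      if (r < f a)%N then M (act_s f a)
      else M (act_s f a) + (q^-1 - q) *: M f
    else if f (ord_pred a) == f a then q^-1 *: M f
    else if (f (ord_pred a) < f a)%N then M (act_s f a)
    else M (act_s f a) + (q^-1 - q) *: M f).

Definition Hact (w : Vt r m) (h : HeckeB) : Vt r m := ract Hgen (rep h) w.

End Hecke.

Section OperatorT.
Variable r : nat.
Implicit Types i : Iint r.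

(* A monomial of height >= 2r+2 in the F's kills V: the support is finite.    *)
Definition Upsilon_act (Ups : {ffun Iint r -> nat} -> U r) (x : V r) : V r :=
  \sum_(mu \in [set: {ffun Iint r -> nat}]%classic) Vact (Ups mu) x.

Record is_zeta (zeta : Lambda r -> Qq) : Prop := {
  zeta_alpha0 mu : zeta (mu + alpha (i0 r)) = - q * zeta mu;
  zeta_alpha i mu : i != i0 r -> zeta (mu + alpha i) =
    - q ^ (form (alpha i) (mu + alpha i) - form (alpha (rev_ord i)) mu) *
      zeta mu;
  zeta_norm : zeta (eps ord0) = 1
}.

Definition zeta_act (zeta : Lambda r -> Qq) : V r -> V r :=
  lin_ext (fun a => zeta (eps a) *: v a).

Definition qint (n : nat) : Qq := (q ^+ n - q ^- n) / (q - q^-1).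
Definition qfact (n : nat) : Qq := \prod_(1 <= k < n.+1) qint k.
Definition divpow (x : U r) (n : nat) : U r := (qfact n)^-1 *: x ^+ n.

(* E and F square to 0 on V, so that the sum has finite support.              *)
Definition Talpha i : V r -> V r :=
  lin_ext (fun d => \sum_(abc \in [set abc : nat * nat * nat |
      - (abc.1.1 : int) + (abc.1.2 : int) - (abc.2 : int)
      = form (eps d) (alpha i)]%classic)
    ((-1) ^+ abc.1.2 * q ^ ((abc.1.2 : int) - (abc.1.1 : int) * (abc.2 : int)))
    *: Vact (divpow (UE i) abc.1.1 * divpow (UF i) abc.1.2
             * divpow (UE i) abc.2) (v d)).

Definition word_perm (s : seq (Iint r)) : {perm Ihalf r} :=
  (\prod_(i <- s) tperm (dn i) (up i))%g.
Definition w0 : {perm Ihalf r} := perm (@rev_ord_inj _).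
Definition reduced_word (w : {perm Ihalf r}) (s : seq (Iint r)) : Prop :=
  word_perm s = w /\
  forall s', word_perm s' = w -> (size s <= size s')%N.

Definition Tword (s : seq (Iint r)) : V r -> V r :=
  foldr (fun i T => Talpha i \o T) id s.

Definition calT (Ups : {ffun Iint r -> nat} -> U r) (zeta : Lambda r -> Qq)
    (s : seq (Iint r)) : V r -> V r :=
  Upsilon_act Ups \o zeta_act zeta \o Tword s.

End OperatorT.

(* Main.v *)
Require Import Defs.
From HB Require Import structures.
From mathcomp Require Import all_boot all_order all_algebra fingroup perm.
From mathcomp Require Import boolp classical_sets fsbigop generic_quotient.
From mathcomp Require cardinality.
From mathcomp Require Import ring lra zify.
Require Import Defs.

Set Implicit Arguments.
Unset Strict Implicit.
Unset Printing Implicit Defensive.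

Import GRing.Theory.
Local Open Scope ring_scope.

(* Double centralizers, by specialization at q = 1.  The centralizer of       *)
(* finitely many operators is the kernel of a matrix of commutators; its      *)
(* entries are regular at q = 1, where the rank can only drop.  Hence it      *)
(* suffices to find, in the image of either algebra, operators that           *)
(* specialize to a basis of the centralizer at q = 1.  There, t, e_i and f_i  *)
(* become (up to scalars) derivations given by e_ab + e_(-a)(-b) with a, b    *)
(* adjacent.  Commutators of these yield all A in gl(V) commuting with the    *)
(* sign flip, and products of derivations yield all symmetrizations of tensor *)
(* products of such A, which span the commutant of the Weyl group of type     *)
(* B_m.  The Hecke algebra specializes to that finite group, whose double     *)
(* commutant is given by Maschke averaging.                                   *)
(*                                                                            *)
(* The operator T.  The matrix of Upsilon on V is lower unitriangular.  As    *)
(* psi and psi_i agree on e_i and f_i acting on basis vectors, Upsilon        *)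
(* commutes with them there; together with its intertwining relation for t,   *)
(* this forces Upsilon v_a = v_a and                                          *)
(* Upsilon v_(-a) = v_(-a) + (q - q^-1) v_a for a > 0.  In a reduced word of  *)
(* w_0 the strand of v_k goes up once for every strand above it, so that      *)
(* T_(w_0) v_k is v_(-k) times a power of -q, which zeta cancels.             *)

(** * Representations of U on tensor powers *)

(** Everything special to type B is carried by one operator on [V], namely [theta], the action of
    H_0 on a single factor. On a tensor power H_0 is [theta] on the first factor ([Hgen_head_flip]),
    so part (1) amounts to [calT] and [theta] being inverse to each other. Both are explicit on each
    plane spanned by [v a] and [v (rev_ord a)]: [Tw0_v] and [zeta_eps] reduce [calT] to Upsilon
    applied to the reversed basis vector, and [Upsilon_pos] and [Upsilon_neg] evaluate that.

    Commutation: for a > 0 the generator H_a commutes with the whole of U ([Hgen_Vtgen]), a check on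
    two adjacent factors. For H_0, the coproducts of the generators of U^iota have their first legs
    in U^iota ([Vtact_ie_pure] and its companions), so it suffices that [theta] commutes with U^iota
    on [V].

    Double centralizers: commutation puts each image inside the centralizer of the other. By
    [centralizer_deform] the two agree as soon as every operator at q = 1 commuting with the limits
    of the generators is itself a limit of elements of the image. For U^iota this is [S_U_limit],
    which rests on [classical_generation]: the operators commuting with signed permutations are
    generated by derivations. For the Hecke algebra it is [S_H_limit]: an operator commuting with
    those derivations then commutes with the whole commutant of the signed permutations, and
    [double_commutant] puts it in their span. *)

Section LinearCombinators.
Variable K : fieldType.
Implicit Types W : lmodType K.
Lemma lin_comp W W' W'' (f : W' -> W'') (g : W -> W') :
  linear f -> linear g -> linear (fun w => f (g w)).
Proof. by move=> fl gl a u w; rewrite gl fl. Qed.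
Lemma lin_add W W' (f g : W -> W') :
  linear f -> linear g -> linear (fun w => f w + g w).
Proof. by move=> fl gl a u w; rewrite gl fl scalerDr addrACA. Qed.
Lemma lin_scale W W' b (f : W -> W') :
  linear f -> linear (fun w => b *: f w).
Proof. by move=> fl a u w; rewrite fl scalerDr !scalerA mulrC. Qed.
Lemma lin_opp W W' (f : W -> W') : linear f -> linear (fun w => - f w).
Proof. by move=> fl a u w; rewrite fl opprD scalerN. Qed.
Lemma lin_id W : linear (fun w : W => w).
Proof. by []. Qed.
Lemma lin0 W W' (f : W -> W') : linear f -> f 0 = 0.
Proof.
move=> fl; have /esym/(canRL (addrK _)) := fl 1 0 0.
by rewrite !scale1r !addr0 subrr.
Qed.
End LinearCombinators.

Section Coordinates.
Variables (K : fieldType) (T : finType).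
Implicit Types (u w : {ffun T -> K^o}) (y : T).
(** The result type moves coordinates from the regular module [K^o] to the field [K], so that [ring]
    and [field] close vector identities coordinate by coordinate. *)
Definition coord_at w y : K := w y.
Lemma coord_atZ a w y : coord_at (a *: w) y = a * coord_at w y.
Proof. by rewrite /coord_at ffunE. Qed.
Lemma coord_atD u w y : coord_at (u + w) y = coord_at u y + coord_at w y.
Proof. by rewrite /coord_at ffunE. Qed.
Lemma coord_atN w y : coord_at (- w) y = - coord_at w y.
Proof. by rewrite /coord_at ffunE. Qed.
Lemma coord_at0 y : coord_at 0 y = 0.
Proof. by rewrite /coord_at ffunE. Qed.
Lemma coord_atP u w : (forall y, coord_at u y = coord_at w y) -> u = w.
Proof. by move=> H; apply/ffunP. Qed.
Definition coord_atE := (coord_atZ, coord_atD, coord_atN, coord_at0).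
End Coordinates.

Section TensorRelations.
Variables (K : fieldType) (q : K).
Hypotheses (q0 : q != 0).
Variables (W1 W2 : lmodType K) (T : finType).
Notation W3 := {ffun T -> K^o}.
Variable p : W1 -> W2 -> W3.
Hypothesis pDl : forall x x' y, p (x + x') y = p x y + p x' y.
Hypothesis pDr : forall x y y', p x (y + y') = p x y + p x y'.
Hypothesis pZl : forall a x y, p (a *: x) y = a *: p x y.
Hypothesis pZr : forall a x y, p x (a *: y) = a *: p x y.

Lemma pNl x y : p (- x) y = - p x y.
Proof. by rewrite -scaleN1r pZl scaleN1r. Qed.
Lemma pNr x y : p x (- y) = - p x y.
Proof. by rewrite -scaleN1r pZr scaleN1r. Qed.

Let pE := (pDl, pDr, pZl, pZr, pNl, pNr).

Section Serre.
Variables (A1 B1 : W1 -> W1) (A2 B2 G2 C2 : W2 -> W2) (A3 B3 : W3 -> W3).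
Hypothesis A3D : {morph A3 : u w / u + w}.
Hypothesis B3D : {morph B3 : u w / u + w}.
Hypothesis A3Z : forall a u, A3 (a *: u) = a *: A3 u.
Hypothesis B3Z : forall a u, B3 (a *: u) = a *: B3 u.
Hypothesis A2Z : forall a u, A2 (a *: u) = a *: A2 u.
Hypothesis B2Z : forall a u, B2 (a *: u) = a *: B2 u.
Hypothesis G2Z : forall a u, G2 (a *: u) = a *: G2 u.
Hypothesis C2Z : forall a u, C2 (a *: u) = a *: C2 u.
Hypothesis A3E : forall x y, A3 (p x y) = p x (A2 y) + p (A1 x) (G2 y).
Hypothesis B3E : forall x y, B3 (p x y) = p x (B2 y) + p (B1 x) (C2 y).
Hypothesis G2C2 : forall y, C2 (G2 y) = G2 (C2 y).

(** The coproduct has the shape 1 (x) A + A (x) G, where G and C move past A and B at the cost of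
    powers of q given by the Cartan integers 2 and -1. After expansion the pure terms satisfy the
    relation inside one factor, and the mixed terms cancel by scalar identities in q. *)
Lemma serre_tensor_left :
  (forall y, G2 (A2 y) = q ^- 2 *: A2 (G2 y)) ->
  (forall y, G2 (B2 y) = q *: B2 (G2 y)) ->
  (forall y, C2 (A2 y) = q *: A2 (C2 y)) ->
  (forall x, A1 (A1 (B1 x)) + B1 (A1 (A1 x)) = (q + q^-1) *: A1 (B1 (A1 x))) ->
  (forall y, A2 (A2 (B2 y)) + B2 (A2 (A2 y)) = (q + q^-1) *: A2 (B2 (A2 y))) ->
  forall x y, A3 (A3 (B3 (p x y))) + B3 (A3 (A3 (p x y))) =
    (q + q^-1) *: A3 (B3 (A3 (p x y))).
Proof.
move=> GA GB CA S1 S2 x y.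
(* The Serre relations are oriented so as to eliminate the words A A B; both sides are then written
   in the same words and only coefficients remain to be compared. *)
have {}S1 z : A1 (A1 (B1 z)) = (q + q^-1) *: A1 (B1 (A1 z)) - B1 (A1 (A1 z)).
  by rewrite -S1 addrK.
have {}S2 z : A2 (A2 (B2 z)) = (q + q^-1) *: A2 (B2 (A2 z)) - B2 (A2 (A2 z)).
  by rewrite -S2 addrK.
do ![rewrite !(A3E, B3E, A3D, B3D, A3Z, B3Z)|
     rewrite !(GA, GB, CA, G2C2, A2Z, B2Z, G2Z, C2Z, pE)].
rewrite ?(S1, S2) ?pE.
apply: coord_atP => t; rewrite !coord_atE.
by field.
Qed.
End Serre.
End TensorRelations.

Lemma form_sym r (x y : Lambda r) : form x y = form y x.
Proof. by rewrite /form; apply: eq_bigr => a _; rewrite mulrC. Qed.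

(** The defining relations of U as identities between operators, with conjugation by K turned into
    q-commutation. The abstract field and parameter keep scalar computations away from the fraction
    field. *)
Record Urep (K : fieldType) (q : K) (r : nat) (W : lmodType K)
    (op : Ugen r -> W -> W) : Prop := {
  Ulin g : linear (op g);
  U_KV i w : op (gK i) (op (gKinv i) w) = w;
  U_VK i w : op (gKinv i) (op (gK i) w) = w;
  U_KK i j w : op (gK i) (op (gK j) w) = op (gK j) (op (gK i) w);
  U_KE i j w : op (gK i) (op (gE j) w) =
    q ^ form (alpha i) (alpha j) *: op (gE j) (op (gK i) w);
  U_KF i j w : op (gK i) (op (gF j) w) =
    q ^ (- form (alpha i) (alpha j)) *: op (gF j) (op (gK i) w);
  U_EF i j w : op (gE i) (op (gF j) w) - op (gF j) (op (gE i) w) =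
    (if i == j then (q - q^-1)^-1 else 0) *: (op (gK i) w - op (gKinv i) w);
  U_EE i j w : form (alpha i) (alpha j) = 0 ->
    op (gE i) (op (gE j) w) = op (gE j) (op (gE i) w);
  U_FF i j w : form (alpha i) (alpha j) = 0 ->
    op (gF i) (op (gF j) w) = op (gF j) (op (gF i) w);
  U_serreE i j w : form (alpha i) (alpha j) = -1 ->
    op (gE i) (op (gE i) (op (gE j) w)) + op (gE j) (op (gE i) (op (gE i) w)) =
    (q + q^-1) *: op (gE i) (op (gE j) (op (gE i) w));
  U_serreF i j w : form (alpha i) (alpha j) = -1 ->
    op (gF i) (op (gF i) (op (gF j) w)) + op (gF j) (op (gF i) (op (gF i) w)) =
    (q + q^-1) *: op (gF i) (op (gF j) (op (gF i) w))
}.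

Section UrepTheory.
Variables (K : fieldType) (q : K) (r : nat) (W : lmodType K).
Variable op : Ugen r -> W -> W.
Hypothesis (q0 : q != 0) (Hop : Urep q op).

Lemma UD g u w : op g (u + w) = op g u + op g w.
Proof. exact: (linear_add (Ulin Hop g)). Qed.
Lemma UZ g a u : op g (a *: u) = a *: op g u.
Proof. exact: (linear_scale (Ulin Hop g)). Qed.
Lemma U_VE i j w : op (gKinv i) (op (gE j) w) =
  q ^ (- form (alpha i) (alpha j)) *: op (gE j) (op (gKinv i) w).
Proof.
rewrite -{1}(U_KV Hop i w).
have := U_KE Hop i j (op (gKinv i) w).
move=> /(congr1 (op (gKinv i))); rewrite (U_VK Hop) UZ => ->.
by rewrite scalerA -expfzDr // addNr expr0z scale1r.
Qed.
Lemma U_VF i j w : op (gKinv i) (op (gF j) w) =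
  q ^ form (alpha i) (alpha j) *: op (gF j) (op (gKinv i) w).
Proof.
rewrite -{1}(U_KV Hop i w).
have := U_KF Hop i j (op (gKinv i) w).
move=> /(congr1 (op (gKinv i))); rewrite (U_VK Hop) UZ => ->.
by rewrite scalerA -expfzDr // addrN expr0z scale1r.
Qed.
Lemma U_VV i j w : op (gKinv i) (op (gKinv j) w) = op (gKinv j) (op (gKinv i) w).
Proof.
rewrite -[LHS](U_VK Hop j) -[op (gK j) _](U_VK Hop i) (U_KK Hop i j).
by rewrite (U_KV Hop i) (U_KV Hop j).
Qed.
Lemma U_VK' i j w : op (gKinv i) (op (gK j) w) = op (gK j) (op (gKinv i) w).
Proof.
by rewrite -[RHS](U_VK Hop i) (U_KK Hop i j) (U_KV Hop i).
Qed.
End UrepTheory.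

Section UrepTensor.
Variables (K : fieldType) (q : K) (r : nat).
Hypotheses (q0 : q != 0).
Variables (W1 W2 : lmodType K) (T : finType).
Notation W3 := {ffun T -> K^o}.
Variable p : W1 -> W2 -> W3.
Hypothesis pDl : forall x x' y, p (x + x') y = p x y + p x' y.
Hypothesis pDr : forall x y y', p x (y + y') = p x y + p x y'.
Hypothesis pZl : forall a x y, p (a *: x) y = a *: p x y.
Hypothesis pZr : forall a x y, p x (a *: y) = a *: p x y.
Hypothesis p_ext : forall f g : W3 -> W3, linear f -> linear g ->
  (forall x y, f (p x y) = g (p x y)) -> f =1 g.
Variables (op1 : Ugen r -> W1 -> W1) (op2 : Ugen r -> W2 -> W2).
Variable (op3 : Ugen r -> W3 -> W3).
Hypotheses (H1 : Urep q op1) (H2 : Urep q op2).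
Hypothesis op3_linear : forall g, linear (op3 g).
Hypothesis op3E : forall i x y, op3 (gE i) (p x y) =
  p x (op2 (gE i) y) + p (op1 (gE i) x) (op2 (gKinv i) y).
Hypothesis op3F : forall i x y, op3 (gF i) (p x y) =
  p (op1 (gF i) x) y + p (op1 (gK i) x) (op2 (gF i) y).
Hypothesis op3K : forall i x y, op3 (gK i) (p x y) =
  p (op1 (gK i) x) (op2 (gK i) y).
Hypothesis op3V : forall i x y, op3 (gKinv i) (p x y) =
  p (op1 (gKinv i) x) (op2 (gKinv i) y).

Let p_Nl x y : p (- x) y = - p x y.
Proof. by rewrite -scaleN1r pZl scaleN1r. Qed.
Let p_Nr x y : p x (- y) = - p x y.
Proof. by rewrite -scaleN1r pZr scaleN1r. Qed.
Let p0l y : p 0 y = 0.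
Proof. by rewrite -(scale0r 0) pZl scale0r. Qed.
Let p0r x : p x 0 = 0.
Proof. by rewrite -(scale0r 0) pZr scale0r. Qed.
Let pE := (pDl, pDr, pZl, pZr, p_Nl, p_Nr, p0l, p0r).
Let op3D g : {morph op3 g : u w / u + w}.
Proof. exact: linear_add (op3_linear g). Qed.
Let op3_ := (op3E, op3F, op3K, op3V).

Ltac lin := lazymatch goal with
  | |- linear (fun w => w) => exact: lin_id
  | |- linear (fun w => @?f w + @?g w) => apply: (@lin_add _ _ _ f g); lin
  | |- linear (fun w => - @?f w) => apply: (@lin_opp _ _ _ f); lin
  | |- linear (fun w => ?c *: @?f w) => apply: (@lin_scale _ _ _ c f); lin
  | |- linear (fun w => op3 ?g w) => exact: (op3_linear g)
  | |- linear (fun w => op3 ?g (@?h w)) =>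
      apply: (@lin_comp _ _ _ _ (op3 g) h); lin
  | |- linear (op3 ?g) => exact: (op3_linear g)
  end.

Lemma form_alphaii (i : Iint r) : form (alpha i) (alpha i) = 2.
Proof.
have E (a b : Ihalf r) : form (eps a) (eps b) = (a == b)%:R.
  rewrite /form (bigD1 b) //= big1 => [|c /negbTE cb]; last first.
    by rewrite !ffunE cb mulr0.
  by rewrite !ffunE eqxx mulr1 addr0 eq_sym; case: eqP.
have B (x y z : Lambda r) : form (x - y) z = form x z - form y z.
  rewrite /form -sumrB; apply: eq_bigr => c _.
  by rewrite !ffunE mulrBl.
have dnup : (dn i == up i) = false.
  by apply/eqP => /(congr1 val) /=; rewrite /bump /=; lia.
rewrite {1}/alpha B form_sym /alpha B E eqxx E (eq_sym (up i)) dnup.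
by rewrite form_sym B !E dnup eqxx.
Qed.

(** For [E, F] the cross terms E K (x) K^-1 F and K E (x) F K^-1 agree, since K past E and K^-1 past
    F produce the same power of q. What is left, [E, F] (x) K^-1 + K (x) [E, F], telescopes to K (x)
    K - K^-1 (x) K^-1. *)
Lemma Urep_tensor : Urep q op3.
Proof.
have h1D := UD H1; have h1Z := UZ H1; have h2D := UD H2; have h2Z := UZ H2.
split=> //.
- by move=> i; apply: p_ext; [lin|lin|move=> x y]; rewrite !op3_ (U_KV H1) (U_KV H2).
- by move=> i; apply: p_ext; [lin|lin|move=> x y]; rewrite !op3_ (U_VK H1) (U_VK H2).
- move=> i j; apply: p_ext; [lin|lin|move=> x y]; rewrite !op3_.
  by rewrite (U_KK H1) (U_KK H2).
- move=> i j; apply: p_ext; [lin|lin|move=> x y].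
  rewrite !(op3_, op3D) (U_KE H1) (U_KE H2) (U_VK' H2) !pE.
  by rewrite scalerDr.
- move=> i j; apply: p_ext; [lin|lin|move=> x y].
  rewrite !(op3_, op3D) (U_KF H1) (U_KF H2) (U_KK H1) !pE.
  by rewrite scalerDr.
- move=> i j; apply: p_ext; [lin|lin|move=> x y].
  rewrite !(op3_, op3D).
  have /eqP := U_EF H1 i j x; rewrite subr_eq => /eqP ->.
  have /eqP := U_EF H2 i j y; rewrite subr_eq => /eqP ->.
  rewrite (U_KE H1) (U_VF q0 H2) form_sym !pE.
  rewrite !opprD -!addrA.
  have aux (a b d e f g : W3) :
      a + (f + (b + (g + (d + (e + (- a + (- d + (- b - e)))))))) = f + g.
    by apply: coord_atP => t; rewrite !coord_atE; ring.
  rewrite aux; case: eqP => [<-|_]; last by rewrite !scale0r addr0.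
  by rewrite addrC -scalerDr addrA subrK.
- move=> i j w ij; move: w; apply: p_ext; [lin|lin|move=> x y].
  rewrite !(op3_, op3D) (U_EE H1 _ ij) (U_EE H2 _ ij) (U_VV H2 i j).
  rewrite !(U_VE q0 H2) (form_sym (alpha j)) ij !pE oppr0 expr0z !scale1r.
  rewrite -!addrA; congr (_ + _); rewrite addrCA; congr (_ + (_ + _)).
- move=> i j w ij; move: w; apply: p_ext; [lin|lin|move=> x y].
  rewrite !(op3_, op3D) (U_FF H1 _ ij) (U_FF H2 _ ij) (U_KK H1 i j).
  rewrite !(U_KF H1) (form_sym (alpha j)) ij !pE oppr0 expr0z !scale1r.
  rewrite -!addrA; congr (_ + _); rewrite addrCA; congr (_ + (_ + _)).
- move=> i j w ij; move: w; apply: p_ext; [lin|lin|].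
  apply: (@serre_tensor_left K q q0 W1 W2 T p pDl pDr pZl pZr
     (op1 (gE i)) (op1 (gE j)) (op2 (gE i)) (op2 (gE j))
     (op2 (gKinv i)) (op2 (gKinv j)) (op3 (gE i)) (op3 (gE j))) => //.
  + by move=> y; rewrite (U_VV H2).
  + by move=> y; rewrite (U_VE q0 H2) form_alphaii.
  + by move=> y; rewrite (U_VE q0 H2) ij.
  + by move=> y; rewrite (U_VE q0 H2) form_sym ij.
  + by move=> x; rewrite (U_serreE H1).
  + by move=> x; rewrite (U_serreE H2).
- move=> i j w ij; move: w; apply: p_ext; [lin|lin|].
  (* In the coproduct of F the group-like element stands on the left, so the Serre lemma is applied
     with the two tensor factors exchanged. *)
  move=> x y; move: y x.
  apply: (@serre_tensor_left K q q0 W2 W1 T (fun y x => p x y) _ _ _ _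
     (op2 (gF i)) (op2 (gF j)) (op1 (gF i)) (op1 (gF j))
     (op1 (gK i)) (op1 (gK j)) (op3 (gF i)) (op3 (gF j))) => //.
  + by move=> y; rewrite (U_KK H1).
  + by move=> y; rewrite (U_KF H1) form_alphaii.
  + by move=> y; rewrite (U_KF H1) ij.
  + by move=> y; rewrite (U_KF H1) form_sym ij.
  + by move=> x; rewrite (U_serreF H2).
  + by move=> x; rewrite (U_serreF H1).
Qed.
End UrepTensor.

Lemma q_neq0 : q != 0.
Proof. by rewrite tofrac_eq0 polyX_eq0. Qed.

Lemma q2_neq1 : q - q^-1 != 0.
Proof.
rewrite subr_eq0; apply/eqP => /(congr1 (fun x => q * x)).
rewrite mulfV ?q_neq0 // -[q]/(tofrac 'X) -tofracM -tofrac1 => /eqP.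
rewrite tofrac_eq -expr2 => /eqP/(congr1 (fun p : {poly rat} => size p)).
by rewrite size_polyXn size_poly1.
Qed.

Section LinExt.
Variables (T : finType) (W : lmodType Qq).
Notation S := {ffun T -> Qq^o}.

Lemma lin_ext_linear (g : T -> W) : linear (lin_ext g).
Proof.
move=> a u w; rewrite /lin_ext scaler_sumr -big_split /=.
by apply: eq_bigr => x _; rewrite !ffunE scalerDl scalerA.
Qed.

Lemma lin_ext_bvec (g : T -> W) x : lin_ext g (bvec x) = g x.
Proof.
rewrite /lin_ext (bigD1 x) //= big1 => [|y /negbTE yx]; rewrite ffunE ?yx.
  by rewrite eqxx scale1r addr0.
by rewrite scale0r.
Qed.

Lemma bvec_sum (w : S) : w = \sum_x (w x : Qq) *: bvec x.
Proof.
apply/ffunP => y; rewrite sum_ffunE (bigD1 y) //= big1 => [|x /negbTE yx].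
  by rewrite !ffunE eqxx addr0 /GRing.scale /= mulr1.
by rewrite !ffunE eq_sym yx /GRing.scale /= mulr0.
Qed.

Lemma linear_sum_bvec (f : S -> W) : linear f ->
  forall w, f w = \sum_x (w x : Qq) *: f (bvec x).
Proof.
move=> fl w; have f0 := lin0 fl.
rewrite {1}(bvec_sum w).
elim: (index_enum T) => [|x s IHs]; first by rewrite !big_nil.
by rewrite !big_cons fl IHs.
Qed.

Lemma eq_on_bvec (f g : S -> W) : linear f -> linear g ->
  (forall x, f (bvec x) = g (bvec x)) -> f =1 g.
Proof.
move=> fl gl fg w; rewrite (linear_sum_bvec fl) (linear_sum_bvec gl).
by apply: eq_bigr => x _; rewrite fg.
Qed.
End LinExt.

Section VRep.
Variable r : nat.
Implicit Types (i j : Iint r) (a b : Ihalf r).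
Notation V := (V r).

Lemma Vgen_linear g : linear (@Vgen r g).
Proof. exact: lin_ext_linear. Qed.

Lemma form_eps a b : form (eps a) (eps b) = (a == b)%:R.
Proof.
rewrite /form (bigD1 b) //= big1 => [|c /negbTE cb]; last first.
  by rewrite !ffunE cb mulr0.
by rewrite !ffunE eqxx mulr1 addr0 eq_sym; case: eqP.
Qed.

Lemma formBl (x y z : Lambda r) : form (x - y) z = form x z - form y z.
Proof.
rewrite /form -sumrB; apply: eq_bigr => c _.
by rewrite !ffunE mulrBl.
Qed.

Lemma form_alpha_eps i a : form (alpha i) (eps a) = (a == dn i)%:R - (a == up i)%:R.
Proof. by rewrite formBl !form_eps !(eq_sym a). Qed.

Lemma form_alpha i j : form (alpha i) (alpha j) =
  form (alpha i) (eps (dn j)) - form (alpha i) (eps (up j)).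
Proof. by rewrite form_sym formBl !(form_sym (alpha i)). Qed.

Lemma upE i : up i = i.+1 :> nat. Proof. by rewrite /= /bump /=. Qed.
Lemma dnE i : dn i = i :> nat. Proof. by []. Qed.
Lemma dn_eq i j : (dn i == dn j) = (i == j). Proof. by []. Qed.
Lemma up_eq i j : (up i == up j) = (i == j).
Proof. by rewrite -val_eqE /= -[in RHS]val_eqE. Qed.
Lemma dn_up i : (dn i == up i) = false.
Proof. by rewrite -val_eqE /= /bump /= add1n; apply/eqP/n_Sn. Qed.

Lemma VgenE i a : Vgen (gE i) (v a) = if a == up i then v (dn i) else 0.
Proof. exact: lin_ext_bvec. Qed.
Lemma VgenF i a : Vgen (gF i) (v a) = if a == dn i then v (up i) else 0.
Proof. exact: lin_ext_bvec. Qed.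
Lemma VgenK i a : Vgen (gK i) (v a) = q ^ form (alpha i) (eps a) *: v a.
Proof. exact: lin_ext_bvec. Qed.
Lemma VgenV i a : Vgen (gKinv i) (v a) = q ^ (- form (alpha i) (eps a)) *: v a.
Proof. exact: lin_ext_bvec. Qed.

Lemma form_alpha_nat i j : form (alpha i) (alpha j) =
  (i == j)%:R *+ 2 - (i.+1 == j)%:R - (j.+1 == i)%:R.
Proof.
rewrite form_alpha !form_alpha_eps -!val_eqE /= /bump /=.
by do ![case: eqP => ?]; rewrite // ?subr0 ?sub0r; exfalso; lia.
Qed.

End VRep.

Section NaturalRelations.
Variables (K : fieldType) (q : K) (r : nat) (W : lmodType K).
Variables (v : Ihalf r -> W) (op : Ugen r -> W -> W).
Hypotheses (q0 : q != 0) (q2 : q - q^-1 != 0).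
Hypothesis op_linear : forall g, linear (op g).
Hypothesis v_ext : forall f g : W -> W, linear f -> linear g ->
  (forall a, f (v a) = g (v a)) -> f =1 g.
Hypothesis opE : forall i a, op (gE i) (v a) = if a == up i then v (dn i) else 0.
Hypothesis opF : forall i a, op (gF i) (v a) = if a == dn i then v (up i) else 0.
Hypothesis opK : forall i a, op (gK i) (v a) = q ^ form (alpha i) (eps a) *: v a.
Hypothesis opV : forall i a,
  op (gKinv i) (v a) = q ^ (- form (alpha i) (eps a)) *: v a.

Let opZ g c (w : W) : op g (c *: w) = c *: op g w.
Proof. exact: (linear_scale (op_linear g) c w). Qed.
Let op0 g : op g (0 : W) = 0.
Proof. exact: (lin0 (op_linear g)). Qed.

Ltac lin := lazymatch goal with
  | |- linear (fun w => w) => exact: lin_id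
  | |- linear (fun w => @?f w + @?g w) => apply: (@lin_add _ _ _ f g); lin
  | |- linear (fun w => - @?f w) => apply: (@lin_opp _ _ _ f); lin
  | |- linear (fun w => ?c *: @?f w) => apply: (@lin_scale _ _ _ c f); lin
  | |- linear (fun w => op ?g w) => exact: (op_linear g)
  | |- linear (fun w => op ?g (@?h w)) =>
      apply: (@lin_comp _ _ _ _ (op g) h); lin
  | |- linear (op ?g) => exact: (op_linear g)
  end.

Lemma Urep_natural : Urep q op.
Proof.
have op_ := (opE, opF, opK, opV, opZ).
split; first exact: op_linear.
- move=> i; apply: v_ext; [lin|lin|move=> a].
  by rewrite !op_ scalerA -expfzDr // addNr expr0z scale1r.
- move=> i; apply: v_ext; [lin|lin|move=> a].
  by rewrite !op_ scalerA -expfzDr // addrN expr0z scale1r.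
- move=> i j; apply: v_ext; [lin|lin|move=> a].
  by rewrite !op_ !scalerA mulrC.
- move=> i j; apply: v_ext; [lin|lin|move=> a]; rewrite !op_.
  case: eqP => [->|_]; rewrite ?op0 ?scaler0 // op_ scalerA -expfzDr //.
  by rewrite form_alpha subrK.
- move=> i j; apply: v_ext; [lin|lin|move=> a]; rewrite !op_.
  case: eqP => [->|_]; rewrite ?op0 ?scaler0 // op_ scalerA -expfzDr //.
  by rewrite form_alpha opprB subrK.
- move=> i j; apply: v_ext; [lin|lin|move=> a].
  rewrite !op_ form_alpha_eps 2!(fun_if (op _)) !op_ !op0 up_eq dn_eq.
  rewrite (eq_sym j) -scalerBl scalerA.
  case: (eqVneq i j) => [<-|_]; last by rewrite mul0r scale0r !if_same subrr.
  case: eqP => [->|]; rewrite ?dn_up ?(eq_sym (up i)) ?dn_up /=.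
    by rewrite subr0 subr0 expr1z exprN1 mulVf ?scale1r.
  case: eqP => [->|] _; rewrite /=.
    by rewrite !sub0r opprK expr1z exprN1 -(opprB q) mulrN mulVf ?scaleN1r.
  by rewrite subrr oppr0 subrr mulr0 scale0r.
- move=> i j w; rewrite form_alpha_nat => ij.
  move: w; apply: v_ext; [lin|lin|move=> a].
  rewrite !op_ !(fun_if (op _)) !op_ !op0 -!val_eqE /= /bump /= ?add1n.
  by do ![case: eqP => ?] => //; exfalso; lia.
- move=> i j w; rewrite form_alpha_nat => ij.
  move: w; apply: v_ext; [lin|lin|move=> a].
  rewrite !op_ !(fun_if (op _)) !op_ !op0 -!val_eqE /= /bump /= ?add1n.
  by do ![case: eqP => ?] => //; exfalso; lia.
- move=> i j w ij; move: w; apply: v_ext; [lin|lin|move=> a].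
  do ![rewrite !op_|rewrite !(fun_if (op _))|rewrite !op0].
  rewrite -!val_eqE /= /bump /= ?add1n.
  by do ![case: eqP => ?]; rewrite ?addr0 ?scaler0 //; exfalso; lia.
- move=> i j w ij; move: w; apply: v_ext; [lin|lin|move=> a].
  do ![rewrite !op_|rewrite !(fun_if (op _))|rewrite !op0].
  rewrite -!val_eqE /= /bump /= ?add1n.
  by do ![case: eqP => ?]; rewrite ?addr0 ?scaler0 //; exfalso; lia.
Qed.
End NaturalRelations.

Lemma Urep_Vgen r : Urep q (@Vgen r).
Proof.
apply: (@Urep_natural Qq q r (V r) (@v r)).
- exact: q_neq0.
- exact: q2_neq1.
- exact: Vgen_linear.
- exact: eq_on_bvec.
- exact: VgenE.
- exact: VgenF.
- exact: VgenK.
- exact: VgenV.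
Qed.

Section TensorMaps.
Variable r m : nat.
Implicit Types (x : V r) (w : Vt r m).

Lemma pure_tensorDl x x' w :
  pure_tensor (x + x') w = pure_tensor x w + pure_tensor x' w.
Proof. by apply/ffunP => f; rewrite !ffunE mulrDl. Qed.
Lemma pure_tensorDr x w w' :
  pure_tensor x (w + w') = pure_tensor x w + pure_tensor x w'.
Proof. by apply/ffunP => f; rewrite !ffunE mulrDr. Qed.
Lemma pure_tensorZl a x w : pure_tensor (a *: x) w = a *: pure_tensor x w.
Proof. by apply/ffunP => f; rewrite !ffunE -mulrA. Qed.
Lemma pure_tensorZr a x w : pure_tensor x (a *: w) = a *: pure_tensor x w.
Proof. by apply/ffunP => f; rewrite !ffunE mulrCA. Qed.
Lemma pure_tensor0l w : pure_tensor 0 w = 0.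
Proof. by apply/ffunP => f; rewrite !ffunE mul0r. Qed.
Lemma pure_tensor0r x : pure_tensor x (0 : Vt r m) = 0.
Proof. by apply/ffunP => f; rewrite !ffunE mulr0. Qed.

Definition fcons (a : Ihalf r) (f : Im r m) : Im r m.+1 :=
  [ffun k => if unlift ord0 k is Some j then f j else a].

Lemma fcons_head a (f : Im r m) : fcons a f ord0 = a.
Proof. by rewrite ffunE unlift_none. Qed.
Lemma fcons_tail a (f : Im r m) : ftail (fcons a f) = f.
Proof. by apply/ffunP => k; rewrite !ffunE liftK. Qed.
Lemma fcons_eta (f : Im r m.+1) : fcons (f ord0) (ftail f) = f.
Proof.
by apply/ffunP => k; rewrite !ffunE; case: unliftP => [j|] ->; rewrite ?ffunE.
Qed.

Lemma M_fcons a (f : Im r m) : M (fcons a f) = pure_tensor (v a) (M f).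
Proof.
apply/ffunP => g; rewrite !ffunE -natrM mulnb; congr ((nat_of_bool _)%:R).
apply/eqP/andP => [->|[/eqP <- /eqP <-]]; last by rewrite fcons_eta.
by rewrite fcons_head fcons_tail.
Qed.

Lemma M_eta (f : Im r m.+1) : M f = pure_tensor (v (f ord0)) (M (ftail f)).
Proof. by rewrite -M_fcons fcons_eta. Qed.

Lemma pure_tensor_linearl w : linear (fun x => pure_tensor x w).
Proof. by move=> a x x'; rewrite pure_tensorDl pure_tensorZl. Qed.
Lemma pure_tensor_linearr x : linear (fun w : Vt r m => pure_tensor x w).
Proof. by move=> a w w'; rewrite pure_tensorDr pure_tensorZr. Qed.

Lemma eq_on_pure (W : lmodType Qq) (f g : Vt r m.+1 -> W) :
  linear f -> linear g ->
  (forall x w, f (pure_tensor x w) = g (pure_tensor x w)) -> f =1 g.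
Proof. by move=> fl gl fg; apply: eq_on_bvec => // h; rewrite -/(M h) M_eta. Qed.

Variables (A : V r -> V r) (B : Vt r m -> Vt r m).

Lemma tensor_map_linear : linear (tensor_map A B).
Proof. exact: lin_ext_linear. Qed.

Hypotheses (Al : linear A) (Bl : linear B).

Lemma tensor_map_pure x w :
  tensor_map A B (pure_tensor x w) = pure_tensor (A x) (B w).
Proof.
have tl := tensor_map_linear.
move: x; apply: eq_on_bvec => [c x x'|c x x'|a].
- by rewrite pure_tensor_linearl tl.
- by rewrite Al pure_tensor_linearl.
move: w; apply: eq_on_bvec => [c x x'|c x x'|f].
- by rewrite pure_tensor_linearr tl.
- by rewrite Bl pure_tensor_linearr.
rewrite -/(v a) -/(M f) -M_fcons [LHS]lin_ext_bvec.
by rewrite fcons_head fcons_tail.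
Qed.
End TensorMaps.

Section VtRep.
Variable r : nat.

Lemma Vtgen_linear m g : linear (Vtgen (r := r) (m := m) g).
Proof.
case: m => [|m] a u w /=; first by rewrite scalerDr !scalerA mulrC.
rewrite scaler_sumr -big_split; apply: eq_bigr => xy _.
by rewrite tensor_map_linear.
Qed.

Variable m : nat.
Implicit Types (x : V r) (w : Vt r m).

Lemma tensor_lact_pure (a b : expr Qq (Ugen r)) x w :
  tensor_map (lact (@Vgen r) a) (lact (@Vtgen r m) b) (pure_tensor x w) =
  pure_tensor (lact (@Vgen r) a x) (lact (@Vtgen r m) b w).
Proof.
apply: tensor_map_pure; apply: lact_linear => g.
  exact: Vgen_linear.
exact: Vtgen_linear.
Qed.

Lemma VtgenE i x w : Vtgen (gE i) (pure_tensor x w) =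
  pure_tensor x (Vtgen (gE i) w) + pure_tensor (Vgen (gE i) x) (Vtgen (gKinv i) w).
Proof.
by rewrite [LHS]/= !big_cons big_nil !tensor_lact_pure /= scale1r addr0.
Qed.
Lemma VtgenF i x w : Vtgen (gF i) (pure_tensor x w) =
  pure_tensor (Vgen (gF i) x) w + pure_tensor (Vgen (gK i) x) (Vtgen (gF i) w).
Proof.
by rewrite [LHS]/= !big_cons big_nil !tensor_lact_pure /= scale1r addr0.
Qed.
Lemma VtgenK i x w : Vtgen (gK i) (pure_tensor x w) =
  pure_tensor (Vgen (gK i) x) (Vtgen (gK i) w).
Proof. by rewrite [LHS]/= !big_cons big_nil !tensor_lact_pure /= addr0. Qed.
Lemma VtgenV i x w : Vtgen (gKinv i) (pure_tensor x w) =
  pure_tensor (Vgen (gKinv i) x) (Vtgen (gKinv i) w).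
Proof. by rewrite [LHS]/= !big_cons big_nil !tensor_lact_pure /= addr0. Qed.
End VtRep.

Lemma Urep_trivial (K : fieldType) (q : K) r (W : lmodType K)
    (op : Ugen r -> W -> W) :
  (forall g, linear (op g)) ->
  (forall i w, op (gE i) w = 0) -> (forall i w, op (gF i) w = 0) ->
  (forall i w, op (gK i) w = w) -> (forall i w, op (gKinv i) w = w) ->
  Urep q op.
Proof.
move=> op_linear opE opF opK opV.
split; first exact: op_linear.
all: move=> *; rewrite ?(opE, opF, opK, opV) ?(scaler0, addr0, subrr) //.
Qed.

Lemma Urep_Vtgen r m : Urep q (@Vtgen r m).
Proof.
elim: m => [|m IHm].
  apply: Urep_trivial.
  - exact: Vtgen_linear.
  - by move=> i w; apply: scale0r.
  - by move=> i w; apply: scale0r.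
  - by move=> i w; apply: scale1r.
  - by move=> i w; apply: scale1r.
apply: (@Urep_tensor Qq q r q_neq0 (V r) (Vt r m) _ (@pure_tensor r m)
  (@pure_tensorDl r m) (@pure_tensorDr r m) (@pure_tensorZl r m)
  (@pure_tensorZr r m) _ (@Vgen r) (@Vtgen r m) (@Vtgen r m.+1)).
- exact: eq_on_pure.
- exact: Urep_Vgen.
- exact: IHm.
- exact: Vtgen_linear.
- exact: VtgenE.
- exact: VtgenF.
- exact: VtgenK.
- exact: VtgenV.
Qed.

(** * Actions of algebras given by generators and relations *)

Section PresentedActions.
Variables (K : fieldType) (G : Type) (W : lmodType K) (op : G -> W -> W).
Variable rel : expr K G -> expr K G -> Prop.
Hypothesis op_linear : forall g, linear (op g).

Section Left.
Hypothesis op_rel : forall x y, rel x y -> lact op x =1 lact op y.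
Notation act u := (lact op (rep (u : presented rel))).

Lemma lact_rep_cls x : act (cls rel x) =1 lact op x.
Proof. exact: (lact_cong op_linear op_rel (rep_cls rel x)). Qed.
Lemma lact_rep_add u1 u2 w : act (u1 + u2) w = act u1 w + act u2 w.
Proof. exact: lact_rep_cls. Qed.
Lemma lact_rep_mul u1 u2 w : act (u1 * u2) w = act u1 (act u2 w).
Proof. exact: lact_rep_cls. Qed.
Lemma lact_rep_scale c u w : act (c *: u) w = c *: act u w.
Proof. exact: lact_rep_cls. Qed.
Lemma lact_rep_one w : act 1 w = w.
Proof. by rewrite lact_rep_cls /= scale1r. Qed.
Lemma lact_rep_zero w : act 0 w = 0.
Proof. by rewrite lact_rep_cls /= scale0r. Qed.
Lemma lact_rep_opp u w : act (- u) w = - act u w.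
Proof. by rewrite -scaleN1r lact_rep_scale scaleN1r. Qed.
Lemma lact_rep_linear u : linear (act u).
Proof. exact: lact_linear. Qed.
End Left.

Section Right.
Hypothesis op_rel : forall x y, rel x y -> ract op x =1 ract op y.
Notation act u := (ract op (rep (u : presented rel))).

Lemma ract_rep_cls x : act (cls rel x) =1 ract op x.
Proof. exact: (ract_cong op_linear op_rel (rep_cls rel x)). Qed.
Lemma ract_rep_add u1 u2 w : act (u1 + u2) w = act u1 w + act u2 w.
Proof. exact: ract_rep_cls. Qed.
Lemma ract_rep_mul u1 u2 w : act (u1 * u2) w = act u2 (act u1 w).
Proof. exact: ract_rep_cls. Qed.
Lemma ract_rep_scale c u w : act (c *: u) w = c *: act u w.
Proof.
by rewrite ract_rep_cls /= linear_scale //; apply: ract_linear.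
Qed.
Lemma ract_rep_one w : act 1 w = w.
Proof. by rewrite ract_rep_cls /= scale1r. Qed.
Lemma ract_rep_linear u : linear (act u).
Proof. exact: ract_linear. Qed.
End Right.
End PresentedActions.

Lemma Urep_Urel r (W : lmodType Qq) (op : Ugen r -> W -> W) : Urep q op ->
  forall x y, Urel x y -> lact op x =1 lact op y.
Proof.
move=> Hop x y; case=> [i|i|i j|i j|i j|i j|i j ij|i j ij|i j ij|i j ij] w.
- by rewrite [LHS](U_KV Hop) [RHS]scale1r.
- by rewrite [LHS](U_VK Hop) [RHS]scale1r.
- exact: (U_KK Hop).
- by rewrite [LHS](U_KE Hop) (U_KV Hop).
- by rewrite [LHS](U_KF Hop) (U_KV Hop).
- have E := U_EF Hop i j w; rewrite /= !scaleN1r; exact: E.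
- exact: (U_EE Hop).
- exact: (U_FF Hop).
- exact: (U_serreE Hop).
- exact: (U_serreF Hop).
Qed.

Section UActions.
Variables (r m : nat).
Notation act := (@Vtact r m).
Let opl := @Vtgen_linear r m.
Let opr := Urep_Urel (Urep_Vtgen r m).

Lemma Vtact_add (u1 u2 : U r) w : act (u1 + u2) w = act u1 w + act u2 w.
Proof. exact: (lact_rep_add opl opr). Qed.
Lemma Vtact_mul (u1 u2 : U r) w : act (u1 * u2) w = act u1 (act u2 w).
Proof. exact: (lact_rep_mul opl opr). Qed.
Lemma Vtact_scale c (u : U r) w : act (c *: u) w = c *: act u w.
Proof. exact: (lact_rep_scale opl opr). Qed.
Lemma Vtact_one w : act 1 w = w.
Proof. exact: (lact_rep_one opl opr). Qed.
Lemma Vtact_linear (u : U r) : linear (act u).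
Proof. exact: (lact_rep_linear opl). Qed.
Lemma Vtact_gen g w : act (cls (@Urel r) (Gen g)) w = Vtgen g w.
Proof. exact: (lact_rep_cls opl opr). Qed.
End UActions.

Section VActions.
Variables (r : nat).
Notation act := (@Vact r).
Let opl := @Vgen_linear r.
Let opr := Urep_Urel (Urep_Vgen r).

Lemma Vact_cls x w : act (cls (@Urel r) x) w = lact (@Vgen r) x w.
Proof. exact: (lact_rep_cls opl opr). Qed.
Lemma Vact_add (u1 u2 : U r) w : act (u1 + u2) w = act u1 w + act u2 w.
Proof. exact: (lact_rep_add opl opr). Qed.
Lemma Vact_opp (u : U r) w : act (- u) w = - act u w.
Proof. exact: (lact_rep_opp opl opr). Qed.
Lemma Vact_zero w : act 0 w = 0.
Proof. exact: (lact_rep_zero opl opr). Qed.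
Lemma Vact_mul (u1 u2 : U r) w : act (u1 * u2) w = act u1 (act u2 w).
Proof. exact: (lact_rep_mul opl opr). Qed.
Lemma Vact_scale c (u : U r) w : act (c *: u) w = c *: act u w.
Proof. exact: (lact_rep_scale opl opr). Qed.
Lemma Vact_one w : act 1 w = w.
Proof. exact: (lact_rep_one opl opr). Qed.
Lemma Vact_linear (u : U r) : linear (act u).
Proof. exact: (lact_rep_linear opl). Qed.
Lemma Vact_gen g w : act (cls (@Urel r) (Gen g)) w = Vgen g w.
Proof. exact: (lact_rep_cls opl opr). Qed.
End VActions.

(** * The Hecke algebra action *)

Section LocalHecke.
Variables (K : fieldType) (q : K) (n : nat) (T : finType).
Hypothesis q0 : q != 0.
Notation W := {ffun T -> K^o}.
Implicit Types (x y z a b c : 'I_n).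

(* The rule defining the action of H_a, a > 0, on the two entries x, y that   *)
(* it exchanges; u x y is the basis vector with these entries.                *)
Definition swap_rule (u : 'I_n -> 'I_n -> W) (S : W -> W) := forall x y : 'I_n,
  S (u x y) = if x == y then q^-1 *: u x y else
              if (x < y)%N then u y x else u y x + (q^-1 - q) *: u x y.

Definition flip_rule (u : 'I_n -> W) (S : W -> W) := forall x : 'I_n,
  S (u x) = if (rev_ord x < x)%N then u (rev_ord x)
            else u (rev_ord x) + (q^-1 - q) *: u x.

Section Rules.
Variables (u : 'I_n -> 'I_n -> W) (S : W -> W).
Hypothesis HS : swap_rule u S.
Lemma swap_lt x y : (x < y)%N -> S (u x y) = u y x.
Proof. by move=> xy; rewrite HS -val_eqE (ltn_eqF xy) xy. Qed.
Lemma swap_gt x y : (y < x)%N -> S (u x y) = u y x + (q^-1 - q) *: u x y.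
Proof. by move=> xy; rewrite HS -val_eqE (gtn_eqF xy) ltnNge ltnW. Qed.
Lemma swap_eq x : S (u x x) = q^-1 *: u x x.
Proof. by rewrite HS eqxx. Qed.
End Rules.

Section Rules0.
Variables (u : 'I_n -> W) (S : W -> W).
Hypothesis HS : flip_rule u S.
Lemma flip_pos x : (rev_ord x < x)%N -> S (u x) = u (rev_ord x).
Proof. by move=> x0; rewrite HS x0. Qed.
Lemma flip_neg x : (x <= rev_ord x)%N ->
  S (u x) = u (rev_ord x) + (q^-1 - q) *: u x.
Proof. by move=> x0; rewrite HS ltnNge x0. Qed.
End Rules0.

Lemma swap_quad u S : linear S -> swap_rule u S ->
  forall x y, S (S (u x y)) = (q^-1 - q) *: S (u x y) + u x y.
Proof.
move=> Sl HS x y; have SD := linear_add Sl; have SZ := linear_scale Sl.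
case: (ltngtP x y) => xy; last first.
- have -> : y = x by apply/val_inj.
  rewrite !(swap_eq HS, SZ); apply: coord_atP => t; rewrite !coord_atE.
  by field.
- rewrite (swap_gt HS xy) SD SZ (swap_lt HS xy) (swap_gt HS xy).
  by apply: coord_atP => t; rewrite !coord_atE; field.
- by rewrite (swap_lt HS xy) (swap_gt HS xy) addrC.
Qed.

(** Only the relative order of the three entries matters. For each order every step of both sides is
    a known rule, and the outcome is an identity between explicit combinations of basis vectors. *)
Lemma swap_braid (u : 'I_n -> 'I_n -> 'I_n -> W) S1 S2 :
  linear S1 -> linear S2 ->
  (forall z, swap_rule (fun x y => u x y z) S1) ->
  (forall x, swap_rule (fun y z => u x y z) S2) ->
  forall x y z, S1 (S2 (S1 (u x y z))) = S2 (S1 (S2 (u x y z))).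
Proof.
move=> l1 l2 H1 H2 x y z.
have D1 := linear_add l1; have Z1 := linear_scale l1.
have D2 := linear_add l2; have Z2 := linear_scale l2.
have lt1 a b c : (a < b)%N -> S1 (u a b c) = u b a c by exact: (swap_lt (H1 c)).
have gt1 a b c : (b < a)%N -> S1 (u a b c) = u b a c + (q^-1 - q) *: u a b c.
  exact: (swap_gt (H1 c)).
have eq1 a c : S1 (u a a c) = q^-1 *: u a a c by exact: (swap_eq (H1 c)).
have lt2 a b c : (b < c)%N -> S2 (u a b c) = u a c b by exact: (swap_lt (H2 a)).
have gt2 a b c : (c < b)%N -> S2 (u a b c) = u a c b + (q^-1 - q) *: u a b c.
  exact: (swap_gt (H2 a)).
have eq2 a b : S2 (u a b b) = q^-1 *: u a b b by exact: (swap_eq (H2 a)).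
(* The rules for equal entries are restated under a numerical hypothesis, so that [lia] can decide
   which rule applies. *)
have {}eq1 a b c : a = b :> nat -> S1 (u a b c) = q^-1 *: u a b c.
  by move/val_inj => <-.
have {}eq2 a b c : b = c :> nat -> S2 (u a b c) = q^-1 *: u a b c.
  by move/val_inj => <-.
Ltac step lt1 gt1 eq1 lt2 gt2 eq2 D1 Z1 D2 Z2 S1 S2 u := match goal with
  | |- context [S1 (u ?a ?b ?c)] =>
      first [rewrite (lt1 a b c); last lia | rewrite (gt1 a b c); last lia
            |rewrite (eq1 a b c); last lia]
  | |- context [S2 (u ?a ?b ?c)] =>
      first [rewrite (lt2 a b c); last lia | rewrite (gt2 a b c); last lia
            |rewrite (eq2 a b c); last lia]
  | |- context [S1 (_ + _)] => rewrite D1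
  | |- context [S1 (_ *: _)] => rewrite Z1
  | |- context [S2 (_ + _)] => rewrite D2
  | |- context [S2 (_ *: _)] => rewrite Z2
  end.
have [xy|xy|xy] := ltngtP x y; have [yz|yz|yz] := ltngtP y z;
have [xz|xz|xz] := ltngtP x z; try (exfalso; clear -xy yz xz; lia).
all: try (move/val_inj: xy => ?; subst y).
all: try (move/val_inj: yz => ?; subst z).
all: try (move/val_inj: xz => ?; subst z).
all: repeat step lt1 gt1 eq1 lt2 gt2 eq2 D1 Z1 D2 Z2 S1 S2 u.
all: by apply: coord_atP => t; rewrite ?coord_atE; field.
Qed.

(** For even n no index is its own reverse, so the flip exchanges the two cases of the rule. *)
Lemma flip_quad u S : linear S -> flip_rule u S -> ~~ odd n ->
  forall x, S (S (u x)) = (q^-1 - q) *: S (u x) + u x.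
Proof.
move=> Sl HS n2 x; have SD := linear_add Sl; have SZ := linear_scale Sl.
have rK := rev_ordK x.
have [x0|x0] := ltnP (rev_ord x) x.
  rewrite (flip_pos HS x0) (flip_neg HS) rK; first exact: addrC.
  exact: ltnW.
have x1 : (rev_ord (rev_ord x) < rev_ord x)%N.
  rewrite rK ltn_neqAle x0 andbT; apply: contraNneq n2 => xx.
  have xn := ltn_ord x; have -> : n = (x + rev_ord x).+1.
    by rewrite /= -[in LHS](subnKC xn) addSn.
  by rewrite xx oddS addnn odd_double.
by rewrite (flip_neg HS x0) SD SZ (flip_pos HS x1) rK (flip_neg HS x0) [LHS]addrC.
Qed.

(** The computation depends only on the order of x and y, on the order of x and the reverse of y,
    and on the signs of x and y; each consistent combination is computed out. *)
Lemma flip_swap_braid (u : 'I_n -> 'I_n -> W) S0 S1 :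
  linear S0 -> linear S1 -> ~~ odd n ->
  (forall y, flip_rule (fun x => u x y) S0) -> swap_rule u S1 ->
  forall x y, S1 (S0 (S1 (S0 (u x y)))) = S0 (S1 (S0 (S1 (u x y)))).
Proof.
move=> l0 l1 n2 H0 H1 x y.
have D0 := linear_add l0; have Z0 := linear_scale l0.
have D1 := linear_add l1; have Z1 := linear_scale l1.
have lt1 := swap_lt H1; have gt1 := swap_gt H1.
have eq1 a b : a = b :> nat -> S1 (u a b) = q^-1 *: u a b.
  by move/val_inj => <-; exact: (swap_eq H1).
have pos a b : (rev_ord a < a)%N -> S0 (u a b) = u (rev_ord a) b.
  exact: (flip_pos (H0 b)).
have neg a b : (a <= rev_ord a)%N ->
    S0 (u a b) = u (rev_ord a) b + (q^-1 - q) *: u a b.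
  exact: (flip_neg (H0 b)).
have rK := @rev_ordK n.
have rx z : (rev_ord z = n - z.+1 :> nat)%N by [].
have [k nk] : exists k, n = (k + k)%N.
  by exists n./2; rewrite addnn -[LHS]odd_double_half (negbTE n2).
have xn := ltn_ord x; have yn := ltn_ord y.
have rrx := rx x; have rry := rx y.
Ltac step0 lt1 gt1 eq1 pos neg D0 Z0 D1 Z1 S0 S1 rK u := match goal with
  | |- context [rev_ord (rev_ord _)] => rewrite !rK
  | |- context [S1 (u ?a ?b)] =>
      first [rewrite (lt1 a b); last lia | rewrite (gt1 a b); last lia
            |rewrite (eq1 a b); last lia]
  | |- context [S0 (u ?a ?b)] =>
      first [rewrite (pos a b); last (rewrite ?rK; lia)
            | rewrite (neg a b); last (rewrite ?rK; lia)]
  | |- context [S1 (_ + _)] => rewrite D1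
  | |- context [S1 (_ *: _)] => rewrite Z1
  | |- context [S0 (_ + _)] => rewrite D0
  | |- context [S0 (_ *: _)] => rewrite Z0
  end.
have [xy|xy|xy] := ltngtP x y; have [x'y|x'y|x'y] := ltngtP x (rev_ord y);
have [x0|x0] := ltnP (rev_ord x) x; have [y0|y0] := ltnP (rev_ord y) y;
  try (exfalso; lia).
all: try (move/val_inj: (xy) => ?; subst y).
all: try (move/val_inj: (x'y) => ?; subst x).
all: repeat step0 lt1 gt1 eq1 pos neg D0 Z0 D1 Z1 S0 S1 rK u.
all: by apply: coord_atP => t; rewrite ?coord_atE; field.
Qed.

End LocalHecke.

Section LocalCommutation.
Variables (K : fieldType) (T : finType) (I J : Type).
Notation W := {ffun T -> K^o}.

(** Each operator changes one of the two indices, with coefficients depending on that index alone,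
    so the coefficients multiply in either order. *)
Lemma local_comm (u : I -> J -> W) (S1 S2 : W -> W) s1 s2 A1 B1 A2 B2 :
  linear S1 -> linear S2 ->
  (forall i j, S1 (u i j) = A1 i *: u (s1 i) j + B1 i *: u i j) ->
  (forall i j, S2 (u i j) = A2 j *: u i (s2 j) + B2 j *: u i j) ->
  forall i j, S1 (S2 (u i j)) = S2 (S1 (u i j)).
Proof.
move=> l1 l2 H1 H2 i j.
rewrite H1 H2 (linear_add l1) (linear_add l2).
rewrite !(linear_scale l1, linear_scale l2) !(H1, H2).
by apply: coord_atP => t; rewrite !coord_atE; ring.
Qed.

(** The left side has the form to which [ract] unfolds (H - q^-1)(H + q), so this turns the
    quadratic relation into the defining one. *)
Lemma quad_factor (q : K) (S : W -> W) : q != 0 -> linear S ->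
  (forall w, S (S w) = (q^-1 - q) *: S w + w) -> forall w,
  S (S w + q^-1 *: (-1 *: w)) + q *: (S w + q^-1 *: (-1 *: w)) = 0 *: w.
Proof.
move=> q0 Sl Sq w; rewrite (linear_add Sl) !(linear_scale Sl) Sq.
by apply: coord_atP => t; rewrite !coord_atE; field.
Qed.

Variables (q : K) (n : nat).

Definition swap_off (xy : 'I_n * 'I_n) : K := (xy.1 != xy.2)%:R.
Definition swap_diag (xy : 'I_n * 'I_n) : K :=
  if xy.1 == xy.2 then q^-1 else if (xy.1 < xy.2)%N then 0 else q^-1 - q.

Lemma swap_ruleE (u : 'I_n -> 'I_n -> W) S : swap_rule q u S -> forall x y,
  S (u x y) = swap_off (x, y) *: u y x + swap_diag (x, y) *: u x y.
Proof.
move=> HS x y; rewrite HS /swap_off /swap_diag /=; case: eqP => _.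
  by rewrite scale0r add0r.
by rewrite scale1r; case: ifP; rewrite ?scale0r ?addr0.
Qed.

Lemma flip_ruleE (u : 'I_n -> W) S : flip_rule q u S -> forall x,
  S (u x) = 1 *: u (rev_ord x) +
    (if (rev_ord x < x)%N then 0 else q^-1 - q) *: u x.
Proof.
by move=> HS x; rewrite HS scale1r; case: ifP; rewrite ?scale0r ?addr0.
Qed.
End LocalCommutation.

Section HgenRelations.
Variables r m : nat.
Implicit Types (a b k : 'I_m) (f : Im r m) (x y z : Ihalf r) (w : Vt r m).
Notation S := (@Hgen m r).

Lemma Hgen_linear a : linear (S a).
Proof. exact: lin_ext_linear. Qed.

Lemma ord_predE a : (0 < a)%N -> ord_pred a = a.-1 :> nat.
Proof.
move=> a0 /=; rewrite -(prednK a0) addSn /= modnDr modn_small //.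
by rewrite (leq_trans _ (ltn_ord a)) // prednK.
Qed.

Lemma ord_pred_eq a k : (0 < a)%N -> (ord_pred a == k) = (a.-1 == k)%N.
Proof. by move=> a0; rewrite -(ord_predE a0). Qed.

(** The family [g] varies only the two entries that the generator exchanges, which reduces [Hgen] to
    the two-entry rule of the local computations. *)
Lemma Hgen_swap_rule a (g : Ihalf r -> Ihalf r -> Im r m) : (0 < a)%N ->
  (forall x y, g x y (ord_pred a) = x) -> (forall x y, g x y a = y) ->
  (forall x y x' y' k, k != ord_pred a -> k != a -> g x y k = g x' y' k) ->
  swap_rule q (fun x y => M (g x y)) (S a).
Proof.
move=> a0 g1 g2 g3 x y.
have pa : ord_pred a != a by rewrite ord_pred_eq //; lia.
have sE : act_s (g x y) a = g y x.
  rewrite /act_s (gtn_eqF a0); apply/ffunP => k; rewrite ffunE.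
  case: tpermP => [->|->|/eqP k1 /eqP k2]; rewrite ?g1 ?g2 //.
  exact: g3.
by rewrite [LHS]lin_ext_bvec (gtn_eqF a0) g1 g2 sE.
Qed.

Lemma Hgen_flip_rule a (g : Ihalf r -> Im r m) : a = 0 :> nat ->
  (forall x, g x a = x) ->
  (forall x x' k, k != a -> g x k = g x' k) ->
  flip_rule q (fun x => M (g x)) (S a).
Proof.
move=> a0 g1 g2 x.
have sE : act_s (g x) a = g (rev_ord x).
  rewrite /act_s a0 eqxx; apply/ffunP => k; rewrite ffunE.
  by case: eqVneq => [->|ka]; rewrite ?g1 //; apply: g2.
rewrite [LHS]lin_ext_bvec a0 eqxx g1 sE; congr (if _ then _ else _).
by have := ltn_ord x; rewrite /=; lia.
Qed.

(** Overrides [f] at the listed positions, the first pair winning. It exhibits [f] as a function of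
    the few entries that given generators touch. *)
Definition put f (s : seq ('I_m * Ihalf r)) : Im r m :=
  [ffun k => head (f k) [seq px.2 | px <- s & px.1 == k]].

Lemma put_id f (s : seq 'I_m) : put f [seq (k, f k) | k <- s] = f.
Proof.
apply/ffunP => k; rewrite ffunE; elim: s => [|p s IHs] //=.
by case: eqP => [->|].
Qed.

Lemma Hgen_quad a (w : Vt r m) : S a (S a w) = (q^-1 - q) *: S a w + w.
Proof.
have Sl := Hgen_linear a.
move: w; apply: eq_on_bvec; [exact: lin_comp
  |exact: (lin_add (lin_scale _ Sl) (@lin_id _ _))|].
move=> f; rewrite -/(M f); have [a0|a0] := posnP a.
  rewrite -(put_id f [:: a]) /=.
  apply: (@flip_quad _ q _ _ (fun x => M (put f [:: (a, x)]))) => //.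
  - apply: Hgen_flip_rule => // [x|x x' k ka];
      rewrite !ffunE /= ?eqxx //.
    by rewrite eq_sym (negbTE ka).
  - by rewrite /= odd_double.
rewrite -(put_id f [:: ord_pred a; a]) /=.
have pa : ord_pred a != a by rewrite ord_pred_eq //; lia.
apply: (@swap_quad _ q _ _ q_neq0
   (fun x y => M (put f [:: (ord_pred a, x); (a, y)]))) => //.
apply: Hgen_swap_rule => // [x y|x y|x y x' y' k k1 k2]; rewrite !ffunE /=.
- by rewrite eqxx.
- by rewrite (negbTE pa) eqxx.
- by rewrite ![_ == k]eq_sym (negbTE k1) (negbTE k2).
Qed.

Lemma Hgen_braid a b w : (0 < a)%N -> b = a.+1 :> nat ->
  S a (S b (S a w)) = S b (S a (S b w)).
Proof.
move=> a0 ba; have Sl := Hgen_linear.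
have b0 : (0 < b)%N by rewrite ba.
move: w; apply: eq_on_bvec; [by do 2?apply: lin_comp|by do 2?apply: lin_comp|].
have pb : ord_pred b = a by apply/val_inj; rewrite [LHS]ord_predE // ba.
have pa : (ord_pred a == a) = false.
  by apply/negbTE; rewrite ord_pred_eq //; lia.
have pab : (ord_pred a == b) = false.
  by apply/negbTE; rewrite ord_pred_eq //; lia.
have ab : (a == b) = false by apply/negbTE; rewrite -(inj_eq val_inj) /=; lia.
move=> f; rewrite -/(M f) -(put_id f [:: ord_pred a; a; b]) /=.
apply: (@swap_braid _ q _ _ q_neq0
   (fun x y z => M (put f [:: (ord_pred a, x); (a, y); (b, z)]))); first exact: Sl.
- exact: Sl.
- move=> z; apply: (Hgen_swap_rule
    (g := fun x y => put f [:: (ord_pred a, x); (a, y); (b, z)])) => //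
    [x y|x y|x y x' y' k k1 k2];
    rewrite !ffunE /= ?eqxx ?pa ?eqxx //.
  by rewrite ![_ == k]eq_sym (negbTE k1) (negbTE k2).
- move=> z; apply: (Hgen_swap_rule
    (g := fun x y => put f [:: (ord_pred a, z); (a, x); (b, y)])) => //
    [x y|x y|x y x' y' k];
    rewrite ?pb !ffunE /= ?(pa, pab, ab, eqxx) //.
  by move=> k1 k2; rewrite ![_ == k]eq_sym (negbTE k1) (negbTE k2).
Qed.

Lemma Hgen_braidB a b w : a = 0 :> nat -> b = 1 :> nat ->
  S b (S a (S b (S a w))) = S a (S b (S a (S b w))).
Proof.
move=> a0 b1; have Sl := Hgen_linear.
have b0 : (0 < b)%N by rewrite b1.
move: w; apply: eq_on_bvec; [by do 3?apply: lin_comp|by do 3?apply: lin_comp|].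
have pb : ord_pred b = a by apply/val_inj; rewrite [LHS]ord_predE // b1.
have ab : (a == b) = false by apply/negbTE; rewrite -(inj_eq val_inj) /=; lia.
move=> f; rewrite -/(M f) -(put_id f [:: a; b]) /=.
apply: (@flip_swap_braid _ q _ _ q_neq0
   (fun x y => M (put f [:: (a, x); (b, y)]))); [exact: Sl|exact: Sl| | |].
- by rewrite /= odd_double.
- move=> y; apply: (Hgen_flip_rule
    (g := fun x => put f [:: (a, x); (b, y)])) => //
    [x|x x' k ka];
      rewrite !ffunE /= ?eqxx //.
  by rewrite ![_ == k]eq_sym (negbTE ka).
- apply: (Hgen_swap_rule
    (g := fun x y => put f [:: (a, x); (b, y)])) => //
    [x y|x y|x y x' y' k];
    rewrite ?pb !ffunE /= ?(ab, eqxx) //.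
  by move=> k1 k2; rewrite ![_ == k]eq_sym (negbTE k1) (negbTE k2).
Qed.

Lemma Hgen_comm a b w : (a.+1 < b)%N -> S b (S a w) = S a (S b w).
Proof.
move=> ab; have Sl := Hgen_linear.
have b0 : (0 < b)%N by lia.
have pbE := ord_predE b0.
have pb : (ord_pred b == b) = false.
  by apply/negbTE; rewrite ord_pred_eq //; lia.
have apb : (a == ord_pred b) = false.
  by apply/negbTE; rewrite eq_sym ord_pred_eq //; lia.
have ab' : (a == b) = false by apply/negbTE; rewrite -(inj_eq val_inj) /=; lia.
move: w; apply: eq_on_bvec; [exact: lin_comp|exact: lin_comp|].
move=> f; rewrite -/(M f); symmetry; have [a0|a0] := posnP a.
  rewrite -(put_id f [:: a; ord_pred b; b]) /=.
  pose u x (z : Ihalf r * Ihalf r) :=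
    M (put f [:: (a, x); (ord_pred b, z.1); (b, z.2)]).
  refine (@local_comm Qq _ _ _ u (S a) (S b) (@rev_ord _)
    (fun p => (p.2, p.1)) _ _ _ _ _ _ _ _ (f a) (f (ord_pred b), f b));
    [exact: Sl|exact: Sl| |].
  - move=> x z0; apply: (flip_ruleE (u := fun x => u x z0)) => {x}.
    apply: (Hgen_flip_rule
        (g := fun x => put f [:: (a, x); (ord_pred b, z0.1); (b, z0.2)])) => //
        [x|x x' k ka];
      rewrite !ffunE /= ?eqxx //.
    by rewrite ![_ == k]eq_sym (negbTE ka).
  - move=> y0 [z z']; apply: (swap_ruleE (u := fun z z' => u y0 (z, z'))) => {z z'}.
    apply: (Hgen_swap_rule
        (g := fun y z => put f [:: (a, y0); (ord_pred b, y); (b, z)])) => //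
        [y z|y z|y z y' z' k k1 k2];
      rewrite !ffunE /= ?(pb, apb, ab', eqxx) //.
    by rewrite ![_ == k]eq_sym (negbTE k1) (negbTE k2).
have paE := ord_predE a0.
have pa : (ord_pred a == a) = false.
  by apply/negbTE; rewrite ord_pred_eq //; lia.
have pab : (ord_pred a == b) = false.
  by apply/negbTE; rewrite ord_pred_eq //; lia.
have papb : (ord_pred a == ord_pred b) = false.
  by apply/negbTE; rewrite ord_pred_eq // ord_predE //; lia.
rewrite -(put_id f [:: ord_pred a; a; ord_pred b; b]) /=.
pose u (x z : Ihalf r * Ihalf r) :=
  M (put f [:: (ord_pred a, x.1); (a, x.2); (ord_pred b, z.1); (b, z.2)]).
refine (@local_comm Qq _ _ _ u (S a) (S b) (fun p => (p.2, p.1))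
  (fun p => (p.2, p.1)) _ _ _ _ _ _ _ _ (f (ord_pred a), f a)
  (f (ord_pred b), f b));
  [exact: Sl|exact: Sl| |].
- move=> [x x'] z0; apply: (swap_ruleE (u := fun x x' => u (x, x') z0)) => {x x'}.
  apply: (Hgen_swap_rule
      (g := fun y y' => put f [:: (ord_pred a, y); (a, y'); (ord_pred b, z0.1); (b, z0.2)])) => //
      [y y'|y y'|y z' y' z'' k k1 k2];
    rewrite !ffunE /= ?(pa, eqxx) //.
  by rewrite ![_ == k]eq_sym (negbTE k1) (negbTE k2).
- move=> y0 [z z']; apply: (swap_ruleE (u := fun z z' => u y0 (z, z'))) => {z z'}.
  apply: (Hgen_swap_rule
      (g := fun y z => put f [:: (ord_pred a, y0.1); (a, y0.2); (ord_pred b, y); (b, z)])) => //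
      [y z|y z|y z y' z' k k1 k2];
    rewrite !ffunE /= ?(pb, apb, pab, papb, ab', eqxx) //.
  by rewrite ![_ == k]eq_sym (negbTE k1) (negbTE k2).
Qed.

Lemma Hgen_rel e1 e2 : @Hrel m e1 e2 -> ract S e1 =1 ract S e2.
Proof.
case=> [a|a b a0 ba|a b ab|a b a0 b1] w.
- exact: (quad_factor q_neq0 (Hgen_linear a) (Hgen_quad a)).
- exact: Hgen_braid.
- exact: Hgen_comm.
- exact: Hgen_braidB.
Qed.

Lemma Hact_add w (h1 h2 : HeckeB m) : Hact w (h1 + h2) = Hact w h1 + Hact w h2.
Proof. exact: (ract_rep_add Hgen_linear Hgen_rel). Qed.
Lemma Hact_mul w (h1 h2 : HeckeB m) : Hact w (h1 * h2) = Hact (Hact w h1) h2.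
Proof. exact: (ract_rep_mul Hgen_linear Hgen_rel). Qed.
Lemma Hact_scale c w (h : HeckeB m) : Hact w (c *: h) = c *: Hact w h.
Proof. exact: (ract_rep_scale Hgen_linear Hgen_rel). Qed.
Lemma Hact_one (w : Vt r m) : Hact w (1 : HeckeB m) = w.
Proof. exact: (ract_rep_one Hgen_linear Hgen_rel). Qed.
Lemma Hact_linear (h : HeckeB m) : linear (fun w : Vt r m => Hact w h).
Proof. exact: (ract_rep_linear Hgen_linear). Qed.
Lemma Hact_gen (w : Vt r m) a : Hact w (Defs.H a) = S a w.
Proof. exact: (ract_rep_cls Hgen_linear Hgen_rel). Qed.
End HgenRelations.

(** * Commutation of the two actions *)

Section SwapCommutesU.
Variables (K : fieldType) (q : K) (n : nat) (W1 W2 : lmodType K) (T : finType).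
Notation W3 := {ffun T -> K^o}.
Variables (v : 'I_n -> W1) (t : W1 -> W1 -> W2 -> W3) (S : W3 -> W3).
Hypothesis q0 : q != 0.
Hypothesis t0l : forall y w, t 0 y w = 0.
Hypothesis t0r : forall x w, t x 0 w = 0.
Hypothesis tZl : forall a x y w, t (a *: x) y w = a *: t x y w.
Hypothesis tZr : forall a x y w, t x (a *: y) w = a *: t x y w.
Hypothesis Sl : linear S.
Hypothesis HS : forall w, swap_rule q (fun x y => t (v x) (v y) w) S.
Variables (d e : 'I_n) (A3 : W3 -> W3) (A1 G1 : W1 -> W1) (A2 G2 : W2 -> W2).
Hypothesis A3l : linear A3.

Let SD := linear_add Sl.
Let SZ := linear_scale Sl.
Let S0 := lin0 Sl.
Let A3D := linear_add A3l.
Let A3Z := linear_scale A3l.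
Let lt1 w (x y : 'I_n) : (x < y)%N -> S (t (v x) (v y) w) = t (v y) (v x) w.
Proof. exact: (swap_lt (HS w)). Qed.
Let gt1 w (x y : 'I_n) : (y < x)%N ->
  S (t (v x) (v y) w) = t (v y) (v x) w + (q^-1 - q) *: t (v x) (v y) w.
Proof. exact: (swap_gt (HS w)). Qed.
Let eq1 w (x y : 'I_n) : x = y :> nat ->
  S (t (v x) (v y) w) = q^-1 *: t (v x) (v y) w.
Proof. by move/val_inj => <-; exact: (swap_eq (HS w)). Qed.

Ltac swap_step Ae Ao Ge Gd Go A3E := match goal with
  | |- context [A3 (t _ _ _)] => rewrite !A3E
  | |- context [A3 (_ + _)] => rewrite A3D
  | |- context [A3 (_ *: _)] => rewrite A3Z
  | |- context [A1 (v ?y)] =>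
      first [rewrite (Ae y); last lia | rewrite (Ao y); last lia]
  | |- context [G1 (v ?y)] =>
      first [rewrite (Ge y); last lia | rewrite (Gd y); last lia
            |rewrite (Go y); last lia]
  | |- context [t 0 _ _] => rewrite t0l
  | |- context [t _ 0 _] => rewrite t0r
  | |- context [t (_ *: _) _ _] => rewrite tZl
  | |- context [t _ (_ *: _) _] => rewrite tZr
  | |- context [S (t (v ?a) (v ?b) ?w)] =>
      first [rewrite (@lt1 w a b); last lia | rewrite (@gt1 w a b); last lia
            |rewrite (@eq1 w a b); last lia]
  | |- context [S (_ + _)] => rewrite SD
  | |- context [S (_ *: _)] => rewrite SZ
  | |- context [S 0] => rewrite S0
  | |- context [_ + 0] => rewrite addr0
  | |- context [0 + _] => rewrite add0r
  end.

(** Here A is E_i, G is K_i^-1, and d, e are the two indices joined by alpha_i. As these are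
    adjacent, an entry matters only through being d, being e, lying below d or lying above e, which
    leaves finitely many cases. *)
Lemma swap_comm_E : e = d.+1 :> nat ->
  A1 (v e) = v d -> (forall y, y != e -> A1 (v y) = 0) ->
  G1 (v d) = q^-1 *: v d -> G1 (v e) = q *: v e ->
  (forall y, y != d -> y != e -> G1 (v y) = v y) ->
  (forall x y w, A3 (t x y w) =
     t x y (A2 w) + t x (A1 y) (G2 w) + t (A1 x) (G1 y) (G2 w)) ->
  forall x y w, S (A3 (t (v x) (v y) w)) = A3 (S (t (v x) (v y) w)).
Proof.
move=> ed Ae' Ao' Gd' Ge' Go' A3E x y w.
have Ae (z : 'I_n) : z = e :> nat -> A1 (v z) = v d by move/val_inj => ->.
have Ao (z : 'I_n) : z <> e :> nat -> A1 (v z) = 0.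
  by move=> H; apply: Ao'; apply/eqP => /(congr1 val).
have Ge (z : 'I_n) : z = e :> nat -> G1 (v z) = q *: v z by move/val_inj => ->.
have Gd (z : 'I_n) : z = d :> nat -> G1 (v z) = q^-1 *: v z by move/val_inj => ->.
have Go (z : 'I_n) : z <> d :> nat /\ z <> e :> nat -> G1 (v z) = v z.
  by move=> [H1 H2]; apply: Go'; apply/eqP => /(congr1 val).
have cases (z : 'I_n) : [\/ z = e :> nat, z = d :> nat, (z < d)%N | (e < z)%N].
  by have [?|?|?] := ltngtP z e; have [?|?|?] := ltngtP z d;
    first [exfalso; lia | constructor 1; lia | constructor 2; lia
          |constructor 3; lia | constructor 4; lia].
clear Ae' Ao' Gd' Ge' Go'.
case: (cases x) => hx; case: (cases y) => hy;
  have [xy|xy|xy] := ltngtP x y; try (exfalso; lia).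
all: try (move/val_inj: (hx) => ?; subst x).
all: try (move/val_inj: (hy) => ?; subst y).
all: try (move/val_inj: (xy) => ?; subst y).
all: repeat swap_step Ae Ao Ge Gd Go A3E.
all: by apply: coord_atP => ?; rewrite ?coord_atE; field.
Qed.

Lemma swap_comm_F : e = d.+1 :> nat ->
  A1 (v d) = v e -> (forall y, y != d -> A1 (v y) = 0) ->
  G1 (v d) = q *: v d -> G1 (v e) = q^-1 *: v e ->
  (forall y, y != d -> y != e -> G1 (v y) = v y) ->
  (forall x y w, A3 (t x y w) =
     t (A1 x) y w + (t (G1 x) (A1 y) w + t (G1 x) (G1 y) (A2 w))) ->
  forall x y w, S (A3 (t (v x) (v y) w)) = A3 (S (t (v x) (v y) w)).
Proof.
move=> ed Ae' Ao' Gd' Ge' Go' A3E x y w.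
have Ae (z : 'I_n) : z = d :> nat -> A1 (v z) = v e by move/val_inj => ->.
have Ao (z : 'I_n) : z <> d :> nat -> A1 (v z) = 0.
  by move=> H; apply: Ao'; apply/eqP => /(congr1 val).
have Ge (z : 'I_n) : z = e :> nat -> G1 (v z) = q^-1 *: v z by move/val_inj => ->.
have Gd (z : 'I_n) : z = d :> nat -> G1 (v z) = q *: v z by move/val_inj => ->.
have Go (z : 'I_n) : z <> d :> nat /\ z <> e :> nat -> G1 (v z) = v z.
  by move=> [H1 H2]; apply: Go'; apply/eqP => /(congr1 val).
have cases (z : 'I_n) : [\/ z = e :> nat, z = d :> nat, (z < d)%N | (e < z)%N].
  by have [?|?|?] := ltngtP z e; have [?|?|?] := ltngtP z d;
    first [exfalso; lia | constructor 1; lia | constructor 2; lia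
          |constructor 3; lia | constructor 4; lia].
clear Ae' Ao' Gd' Ge' Go'.
case: (cases x) => hx; case: (cases y) => hy;
  have [xy|xy|xy] := ltngtP x y; try (exfalso; lia).
all: try (move/val_inj: (hx) => ?; subst x).
all: try (move/val_inj: (hy) => ?; subst y).
all: try (move/val_inj: (xy) => ?; subst y).
all: repeat swap_step Ae Ao Ge Gd Go A3E.
all: by apply: coord_atP => ?; rewrite ?coord_atE; field.
Qed.

(** A diagonal group-like operator multiplies v_x (x) v_y and v_y (x) v_x by the same scalar. *)
Lemma swap_comm_K (c : 'I_n -> K) : (forall y, G1 (v y) = c y *: v y) ->
  (forall x y w, A3 (t x y w) = t (G1 x) (G1 y) (A2 w)) ->
  forall x y w, S (A3 (t (v x) (v y) w)) = A3 (S (t (v x) (v y) w)).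
Proof.
move=> Gc A3E x y w.
have A3v a b z : A3 (t (v a) (v b) z) = (c a * c b) *: t (v a) (v b) (A2 z).
  by rewrite A3E !Gc tZl tZr scalerA.
rewrite A3v SZ !HS; case: ifP => _; first by rewrite A3Z A3v !scalerA mulrC.
case: ifP => _; first by rewrite A3v mulrC.
by rewrite A3D A3Z !A3v scalerDr !scalerA [c y * _]mulrC [_ * (c x * _)]mulrC.
Qed.
End SwapCommutesU.

Section HgenTensor.
Variables r m : nat.
Notation S := (@Hgen _ r).

Lemma Hgen_tail (b : 'I_m) x (w : Vt r m) : (0 < b)%N ->
  S (lift ord0 b) (pure_tensor x w) = pure_tensor x (S b w).
Proof.
move=> b0; have Sl k := @Hgen_linear r k.
move: x; apply: eq_on_bvec => [c x x'|c x x'|a].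
- by rewrite pure_tensor_linearl Sl.
- by rewrite pure_tensor_linearl.
move: w; apply: eq_on_bvec => [c w w'|c w w'|f].
- by rewrite pure_tensor_linearr Sl.
- by rewrite Sl pure_tensor_linearr.
rewrite -/(v a) -/(M f) -M_fcons [LHS]lin_ext_bvec [S b _]lin_ext_bvec.
have pE : ord_pred (lift ord0 b) = lift ord0 (ord_pred b).
  apply/val_inj; rewrite [LHS]ord_predE // -[RHS]/(bump 0 (ord_pred b)).
  by rewrite (ord_predE b0) /= /bump /= add1n prednK.
have fE k : fcons a f (lift ord0 k) = f k by rewrite ffunE liftK.
have sE : act_s (fcons a f) (lift ord0 b) = fcons a (act_s f b).
  rewrite /act_s (gtn_eqF b0); apply/ffunP => k; rewrite [LHS]ffunE pE.
  rewrite [RHS]ffunE; case: unliftP => [j|] ->.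
    by rewrite -(inj_tperm _ _ _ (@lift_inj _ ord0)) fE ffunE.
  by rewrite tpermD ?fcons_head // eq_sym neq_lift.
rewrite sE pE !fE (gtn_eqF b0) /=.
by do 2?case: ifP => _; rewrite ?M_fcons ?pure_tensorDr ?pure_tensorZr.
Qed.

Lemma Hgen_head_swap (w : Vt r m) :
  swap_rule q (fun x y => pure_tensor (v x) (pure_tensor (v y) w))
    (S (lift ord0 (ord0 : 'I_m.+1))).
Proof.
have Sl k := @Hgen_linear r m.+2 k.
have tl (x y : Ihalf r) :
    linear (fun w : Vt r m => pure_tensor (v x) (pure_tensor (v y) w)).
  by move=> c w1 w2; rewrite !pure_tensor_linearr.
move=> x y; move: w; apply: eq_on_bvec => [| |f].
- by move=> c w1 w2; rewrite !tl Sl.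
- case: (x == y); first exact: (lin_scale _ (tl _ _)).
  case: (x < y)%N; first exact: tl.
  exact: (lin_add (tl _ _) (lin_scale _ (tl _ _))).
rewrite -/(M f) -!M_fcons.
have HS := @Hgen_swap_rule r m.+2 (lift ord0 ord0) (fun x y => fcons x (fcons y f)).
apply: HS => // [{}x {}y|{}x {}y|{}x {}y x' y' k].
- rewrite (_ : ord_pred _ = ord0) ?fcons_head //.
  by apply/val_inj; rewrite [LHS]ord_predE.
- by rewrite ffunE liftK fcons_head.
rewrite (_ : ord_pred _ = ord0); last by apply/val_inj; rewrite [LHS]ord_predE.
rewrite ![in RHS]ffunE ![in LHS]ffunE.
case: unliftP => [j ->|->]; last by rewrite eqxx.
rewrite !ffunE => _; case: unliftP => [j' -> //|->].
by rewrite eqxx.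
Qed.

(** This is H_0 on a single factor. Its matrix on the plane of v_a and v_(-a) is the same for every
    positive a, which is what makes it commute with U^iota. *)
Definition theta : V r -> V r := lin_ext (fun a : Ihalf r =>
  if (r < a)%N then v (rev_ord a) else v (rev_ord a) + (q^-1 - q) *: v a).

Lemma theta_linear : linear theta.
Proof. exact: lin_ext_linear. Qed.

Lemma Hgen_head_flip x (w : Vt r m) :
  S ord0 (pure_tensor x w) = pure_tensor (theta x) w.
Proof.
have Sl := @Hgen_linear r m.+1 ord0.
move: x; apply: eq_on_bvec => [c x x'|c x x'|a].
- by rewrite pure_tensor_linearl Sl.
- by rewrite theta_linear pure_tensor_linearl.
move: w; apply: eq_on_bvec => [c w w'|c w w'|f].
- by rewrite pure_tensor_linearr Sl.
- by rewrite pure_tensor_linearr.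
rewrite -/(v a) -/(M f) -M_fcons [LHS]lin_ext_bvec [theta _]lin_ext_bvec.
have sE : act_s (fcons a f) ord0 = fcons (rev_ord a) f.
  rewrite /act_s /=; apply/ffunP => k; rewrite ffunE fcons_head.
  case: eqVneq => [->|k0]; first by rewrite fcons_head.
  by rewrite !ffunE; case: unliftP => // kk; rewrite kk eqxx in k0.
rewrite sE fcons_head /=.
by case: ifP => _; rewrite !M_fcons // pure_tensorDl pure_tensorZl.
Qed.

End HgenTensor.

Section HgenVtgen.
Variable r : nat.

Lemma form_alpha_dn (i : Iint r) : form (alpha i) (eps (dn i)) = 1.
Proof. by rewrite form_alpha_eps eqxx dn_up subr0. Qed.
Lemma form_alpha_up (i : Iint r) : form (alpha i) (eps (up i)) = -1.
Proof. by rewrite form_alpha_eps eqxx eq_sym dn_up sub0r. Qed.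
Lemma form_alpha_other (i : Iint r) a : a != dn i -> a != up i ->
  form (alpha i) (eps a) = 0.
Proof. by move=> /negbTE ad /negbTE au; rewrite form_alpha_eps ad au. Qed.

Lemma VgenV_dn (i : Iint r) : Vgen (gKinv i) (v (dn i)) = q^-1 *: v (dn i).
Proof. by rewrite VgenV form_alpha_dn. Qed.
Lemma VgenV_up (i : Iint r) : Vgen (gKinv i) (v (up i)) = q *: v (up i).
Proof. by rewrite VgenV form_alpha_up. Qed.
Lemma VgenV_other (i : Iint r) a : a != dn i -> a != up i ->
  Vgen (gKinv i) (v a) = v a.
Proof.
by move=> ad au; rewrite VgenV form_alpha_other // oppr0 expr0z scale1r.
Qed.
Lemma VgenK_dn (i : Iint r) : Vgen (gK i) (v (dn i)) = q *: v (dn i).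
Proof. by rewrite VgenK form_alpha_dn. Qed.
Lemma VgenK_up (i : Iint r) : Vgen (gK i) (v (up i)) = q^-1 *: v (up i).
Proof. by rewrite VgenK form_alpha_up. Qed.
Lemma VgenK_other (i : Iint r) a : a != dn i -> a != up i ->
  Vgen (gK i) (v a) = v a.
Proof. by move=> ad au; rewrite VgenK form_alpha_other // expr0z scale1r. Qed.

Lemma VgenE_up (i : Iint r) : Vgen (gE i) (v (up i)) = v (dn i).
Proof. by rewrite VgenE eqxx. Qed.
Lemma VgenE_other (i : Iint r) a : a != up i -> Vgen (gE i) (v a) = 0.
Proof. by move=> /negbTE au; rewrite VgenE au. Qed.
Lemma VgenF_dn (i : Iint r) : Vgen (gF i) (v (dn i)) = v (up i).
Proof. by rewrite VgenF eqxx. Qed.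
Lemma VgenF_other (i : Iint r) a : a != dn i -> Vgen (gF i) (v a) = 0.
Proof. by move=> /negbTE au; rewrite VgenF au. Qed.

Let t m (x y : V r) (w : Vt r m) := pure_tensor x (pure_tensor y w).
Let t0l m y (w : Vt r m) : t 0 y w = 0.
Proof. exact: pure_tensor0l. Qed.
Let t0r m x (w : Vt r m) : t x 0 w = 0.
Proof. by rewrite /t pure_tensor0l pure_tensor0r. Qed.
Let tZl m a x y (w : Vt r m) : t (a *: x) y w = a *: t x y w.
Proof. exact: pure_tensorZl. Qed.
Let tZr m a x y (w : Vt r m) : t x (a *: y) w = a *: t x y w.
Proof. by rewrite /t pure_tensorZl pure_tensorZr. Qed.

Lemma Hgen_head_Vtgen m g (w : Vt r m.+2) :
  Hgen (lift ord0 ord0) (Vtgen g w) = Vtgen g (Hgen (lift ord0 ord0) w).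
Proof.
have Sl := @Hgen_linear r m.+2 (lift ord0 ord0).
have Vl := @Vtgen_linear r m.+2 g.
move: w; apply: eq_on_bvec; [exact: lin_comp|exact: lin_comp|move=> f].
rewrite -/(M f) M_eta (M_eta (ftail f)).
move: (f ord0) (ftail f ord0) (M _) => x y w.
have HS := @Hgen_head_swap r m.
case: g Vl => i Vl; [pose g := gE i|pose g := gF i|pose g := gK i|pose g := gKinv i].
- refine (swap_comm_E q_neq0 (@t0l m) (@t0r m) (@tZr m) Sl HS Vl
    (d := dn i) (e := up i) (A1 := Vgen g) (G1 := Vgen (gKinv i))
    (A2 := Vtgen g) (G2 := Vtgen (gKinv i)) _ _ _ _ _ _ _ x y w).
  + exact: upE.
  + exact: VgenE_up.
  + exact: VgenE_other.
  + exact: VgenV_dn.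
  + exact: VgenV_up.
  + exact: VgenV_other.
  + by move=> x' y' w'; rewrite /t VtgenE VtgenE VtgenV pure_tensorDr.
- refine (swap_comm_F q_neq0 (@t0l m) (@t0r m) (@tZl m) (@tZr m) Sl HS Vl
    (d := dn i) (e := up i) (A1 := Vgen g) (G1 := Vgen (gK i))
    (A2 := Vtgen g) _ _ _ _ _ _ _ x y w).
  + exact: upE.
  + exact: VgenF_dn.
  + exact: VgenF_other.
  + exact: VgenK_dn.
  + exact: VgenK_up.
  + exact: VgenK_other.
  + by move=> x' y' w'; rewrite /t VtgenF VtgenF pure_tensorDr.
- refine (swap_comm_K (@tZl m) (@tZr m) Sl HS Vl (G1 := Vgen g) (A2 := Vtgen g) _ _ x y w).
  + exact: VgenK.
  + by move=> x' y' w'; rewrite /t VtgenK VtgenK.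
- refine (swap_comm_K (@tZl m) (@tZr m) Sl HS Vl (G1 := Vgen g) (A2 := Vtgen g) _ _ x y w).
  + exact: VgenV.
  + by move=> x' y' w'; rewrite /t VtgenV VtgenV.
Qed.

(** Peeling off the first factor with the coproduct moves the generator into the tail, until it acts
    on the first two factors, where [Hgen_head_Vtgen] applies. *)
Lemma Hgen_Vtgen m (a : 'I_m) g (w : Vt r m) : (0 < a)%N ->
  Hgen a (Vtgen g w) = Vtgen g (Hgen a w).
Proof.
elim: m a g w => [[]//|m IHm] a g w.
case: (unliftP ord0 a) => [b|] -> // _ {a}.
case: (posnP b) => [b0|b0].
  move: b w b0; case: m {IHm} => [[]//|m] b w b0.
  have -> : b = ord0 by apply/val_inj.
  exact: Hgen_head_Vtgen.
have Sl := @Hgen_linear r m.+1 (lift ord0 b).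
have Vl := @Vtgen_linear r m.+1 g.
move: w; apply: eq_on_pure; [exact: lin_comp|exact: lin_comp|move=> x w].
have IH (g' : Ugen r) (w' : Vt r m) :
  Hgen b (Vtgen g' w') = Vtgen g' (Hgen b w') by exact (IHm b g' w' b0).
rewrite (Hgen_tail _ _ b0); case: g Vl => i Vl.
- by rewrite !VtgenE (linear_add Sl) !Hgen_tail // !IH.
- by rewrite !VtgenF (linear_add Sl) !Hgen_tail // !IH.
- by rewrite !VtgenK !Hgen_tail // !IH.
- by rewrite !VtgenV !Hgen_tail // !IH.
Qed.
End HgenVtgen.

(** * The subalgebra U^iota on V, and its commutation with theta *)

Section Coideal.
Variable r : nat.
Implicit Types (i : 'I_r) (a b : Ihalf r).

Lemma iposE i : ipos i = (r + i.+1)%N :> nat.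
Proof. by rewrite inordK //; have := ltn_ord i; lia. Qed.
Lemma inegE i : ineg i = (r - i.+1)%N :> nat.
Proof. by rewrite /= iposE; lia. Qed.
Lemma i0E : i0 r = r :> nat.
Proof. by rewrite inordK //; lia. Qed.
Lemma revE a : rev_ord a = (r.*2.+1 - a)%N :> nat.
Proof. by rewrite /=; lia. Qed.
Lemma dn_ineg i : dn (ineg i) = rev_ord (up (ipos i)).
Proof.
apply/val_inj; rewrite -[LHS]/(nat_of_ord (ineg i)) inegE [RHS]revE upE iposE.
lia.
Qed.
Lemma up_ineg i : up (ineg i) = rev_ord (dn (ipos i)).
Proof.
apply/val_inj; rewrite [LHS]upE inegE [RHS]revE dnE iposE.
have := ltn_ord i; lia.
Qed.
Lemma dn_ipos_gt i : (r < dn (ipos i))%N.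
Proof. by rewrite dnE iposE; lia. Qed.
Lemma up_ipos_gt i : (r < up (ipos i))%N.
Proof. by rewrite upE iposE; lia. Qed.
Lemma rev_up_i0 : rev_ord (up (i0 r)) = dn (i0 r).
Proof. by apply/val_inj; rewrite [LHS]revE upE i0E [RHS]i0E; lia. Qed.
Lemma rev_dn_i0 : rev_ord (dn (i0 r)) = up (i0 r).
Proof. by rewrite -rev_up_i0 rev_ordK. Qed.

Lemma rev_gt a b : (r < a)%N -> (r < b)%N -> rev_ord a != b.
Proof.
move=> ra rb; apply/eqP => /(congr1 val); rewrite [LHS]revE /=; lia.
Qed.

Lemma theta_gt a : (r < a)%N -> theta (v a) = v (rev_ord a).
Proof. by move=> ra; rewrite [LHS]lin_ext_bvec ra. Qed.
Lemma theta_rev a : (r < a)%N ->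
  theta (v (rev_ord a)) = v a + (q^-1 - q) *: v (rev_ord a).
Proof.
move=> ra; rewrite [LHS]lin_ext_bvec rev_ordK ifF //.
by rewrite revE; lia.
Qed.

Variant half_spec a : Prop :=
| HalfPos of (r < a)%N
| HalfNeg b of (r < b)%N & a = rev_ord b.

Lemma halfP a : half_spec a.
Proof.
case: (ltnP r a) => ra; first exact: HalfPos.
by apply: (@HalfNeg _ (rev_ord a)); rewrite ?rev_ordK // revE; lia.
Qed.

Lemma v_ext (W : lmodType Qq) (f g : V r -> W) : linear f -> linear g ->
  (forall a, (r < a)%N -> f (v a) = g (v a)) ->
  (forall a, (r < a)%N -> f (v (rev_ord a)) = g (v (rev_ord a))) -> f =1 g.
Proof.
move=> fl gl H1 H2; apply: eq_on_bvec => // a.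
by case: (halfP a) => [/H1//|b /H2 E ->].
Qed.

(** X carries the plane of v_a and v_(-a) to that of v_b and v_(-b), matching signs, and kills the
    other planes; [theta] has the same matrix on all of them. *)
Lemma theta_comm_shift (X : V r -> V r) a b : linear X ->
  (r < a)%N -> (r < b)%N ->
  (forall c, X (v c) = if c == a then v b
     else if c == rev_ord a then v (rev_ord b) else 0) ->
  forall x, theta (X x) = X (theta x).
Proof.
move=> Xl ra rb XE; have tl := @theta_linear r.
have XZ c x : X (c *: x) = c *: X x by exact: (linear_scale Xl).
apply: v_ext; [exact: lin_comp|exact: lin_comp| |] => c rc.
  rewrite (theta_gt rc) !XE (inj_eq rev_ord_inj) (negbTE (rev_gt rc ra)).
  rewrite (eq_sym c (rev_ord a)) (negbTE (rev_gt ra rc)).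
  by case: eqP; rewrite ?theta_gt // (lin0 tl).
rewrite (theta_rev rc) (linear_add Xl) XZ !XE (negbTE (rev_gt rc ra)).
rewrite (inj_eq rev_ord_inj) (eq_sym c (rev_ord a)) (negbTE (rev_gt ra rc)).
by case: eqP; rewrite ?theta_rev // (lin0 tl) scaler0 addr0.
Qed.

(** X is a scalar on each plane of v_a and v_(-a), and [theta] preserves these planes. *)
Lemma theta_comm_diag (X : V r -> V r) (c : Ihalf r -> Qq) : linear X ->
  (forall a, X (v a) = c a *: v a) -> (forall a, c (rev_ord a) = c a) ->
  forall x, theta (X x) = X (theta x).
Proof.
move=> Xl XE cr; have tl := @theta_linear r.
have XZ d x : X (d *: x) = d *: X x by exact: (linear_scale Xl).
have tZ d (x : V r) : theta (d *: x) = d *: theta x by exact: (linear_scale tl d x).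
apply: v_ext; [exact: lin_comp|exact: lin_comp| |] => a ra.
  by rewrite XE tZ (theta_gt ra) XE cr.
rewrite XE tZ (theta_rev ra) (linear_add Xl) XZ !XE cr scalerDr !scalerA.
by rewrite [c a * _]mulrC.
Qed.

Lemma Vact_ie i x : Vact (ie i) x = Vgen (gE (ipos i)) x +
  Vgen (gKinv (ipos i)) (Vgen (gF (ineg i)) x).
Proof. by rewrite Vact_add Vact_mul !Vact_gen. Qed.
Lemma Vact_if i x : Vact (if_ i) x =
  Vgen (gF (ipos i)) (Vgen (gKinv (ineg i)) x) + Vgen (gE (ineg i)) x.
Proof. by rewrite Vact_add Vact_mul !Vact_gen. Qed.
Lemma Vact_ik i x : Vact (ik i) x = Vgen (gK (ipos i)) (Vgen (gKinv (ineg i)) x).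
Proof. by rewrite Vact_mul !Vact_gen. Qed.
Lemma Vact_ikinv i x : Vact (ikinv i) x =
  Vgen (gKinv (ipos i)) (Vgen (gK (ineg i)) x).
Proof. by rewrite Vact_mul !Vact_gen. Qed.
Lemma Vact_it x : Vact (it r) x = Vgen (gE (i0 r)) x +
  q *: Vgen (gF (i0 r)) (Vgen (gKinv (i0 r)) x) + Vgen (gKinv (i0 r)) x.
Proof. by rewrite !Vact_add Vact_scale Vact_mul !Vact_gen. Qed.

Lemma Vact_ie_v i a : Vact (ie i) (v a) =
  if a == up (ipos i) then v (dn (ipos i))
  else if a == rev_ord (up (ipos i)) then v (rev_ord (dn (ipos i))) else 0.
Proof.
have ru := up_ipos_gt i; have rd := dn_ipos_gt i.
rewrite Vact_ie VgenE VgenF dn_ineg; case: eqP => [->|_].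
  by rewrite eq_sym (negbTE (rev_gt ru ru)) (lin0 (Vgen_linear _)) addr0.
rewrite add0r; case: eqP => _; last exact: (lin0 (Vgen_linear _)).
by rewrite up_ineg VgenV_other // rev_gt.
Qed.

Lemma Vact_if_v i a : Vact (if_ i) (v a) =
  if a == dn (ipos i) then v (up (ipos i))
  else if a == rev_ord (dn (ipos i)) then v (rev_ord (up (ipos i))) else 0.
Proof.
have ru := up_ipos_gt i; have rd := dn_ipos_gt i.
rewrite Vact_if VgenV (linear_scale (Vgen_linear _)) VgenF VgenE up_ineg.
rewrite dn_ineg; case: eqP => [->|_].
  rewrite (eq_sym (dn _)) (negbTE (rev_gt rd rd)) addr0.
  rewrite form_alpha_other ?oppr0 ?expr0z ?scale1r //.
    by rewrite dn_ineg eq_sym rev_gt.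
  by rewrite up_ineg eq_sym rev_gt.
by rewrite scaler0 add0r.
Qed.

Lemma form_alpha_rev i a :
  form (alpha (ineg i)) (eps (rev_ord a)) = - form (alpha (ipos i)) (eps a).
Proof.
rewrite !form_alpha_eps dn_ineg up_ineg !(inj_eq rev_ord_inj).
by rewrite opprB.
Qed.

Lemma form_alpha_rev' i a :
  form (alpha (ipos i)) (eps (rev_ord a)) = - form (alpha (ineg i)) (eps a).
Proof. by rewrite -{2}(rev_ordK a) form_alpha_rev opprK. Qed.

Lemma Vact_ik_v i a : Vact (ik i) (v a) =
  q ^ (form (alpha (ipos i)) (eps a) - form (alpha (ineg i)) (eps a)) *: v a.
Proof.
rewrite Vact_ik VgenV (linear_scale (Vgen_linear _)) VgenK scalerA.
by rewrite -(expfzDr _ _ q_neq0) [X in q ^ X]addrC.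
Qed.
Lemma Vact_ikinv_v i a : Vact (ikinv i) (v a) =
  q ^ (form (alpha (ineg i)) (eps a) - form (alpha (ipos i)) (eps a)) *: v a.
Proof.
rewrite Vact_ikinv VgenK (linear_scale (Vgen_linear _)) VgenV scalerA.
by rewrite -(expfzDr _ _ q_neq0).
Qed.

Lemma Vact_it_dn : Vact (it r) (v (dn (i0 r))) = v (up (i0 r)) + q^-1 *: v (dn (i0 r)).
Proof.
rewrite Vact_it VgenE VgenV_dn (linear_scale (Vgen_linear _)) VgenF_dn dn_up.
by rewrite add0r scalerA mulfV ?q_neq0 // scale1r.
Qed.
Lemma Vact_it_up : Vact (it r) (v (up (i0 r))) = v (dn (i0 r)) + q *: v (up (i0 r)).
Proof.
rewrite Vact_it VgenE_up VgenV_up (linear_scale (Vgen_linear _)) VgenF.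
by rewrite eq_sym dn_up !scaler0 addr0.
Qed.
Lemma Vact_it_other a : a != dn (i0 r) -> a != up (i0 r) ->
  Vact (it r) (v a) = v a.
Proof.
move=> ad au; rewrite Vact_it VgenE_other // VgenV_other // VgenF_other //.
by rewrite scaler0 addr0 add0r.
Qed.

Lemma theta_ie i x : theta (Vact (ie i) x) = Vact (ie i) (theta x).
Proof.
apply: (theta_comm_shift _ (up_ipos_gt i) (dn_ipos_gt i)).
  exact: Vact_linear.
exact: Vact_ie_v.
Qed.
Lemma theta_if i x : theta (Vact (if_ i) x) = Vact (if_ i) (theta x).
Proof.
apply: (theta_comm_shift _ (dn_ipos_gt i) (up_ipos_gt i)).
  exact: Vact_linear.
exact: Vact_if_v.
Qed.
Lemma theta_ik i x : theta (Vact (ik i) x) = Vact (ik i) (theta x).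
Proof.
apply: theta_comm_diag; [exact: Vact_linear|exact: Vact_ik_v|move=> a].
by congr (q ^ _); rewrite form_alpha_rev form_alpha_rev' opprK addrC.
Qed.
Lemma theta_ikinv i x : theta (Vact (ikinv i) x) = Vact (ikinv i) (theta x).
Proof.
apply: theta_comm_diag; [exact: Vact_linear|exact: Vact_ikinv_v|move=> a].
by congr (q ^ _); rewrite form_alpha_rev form_alpha_rev' opprK addrC.
Qed.

Lemma theta_it_scalars (K : fieldType) (p : K) (T : finType)
    (x y : {ffun T -> K^o}) : p != 0 ->
  y + p^-1 *: (x + (p^-1 - p) *: y) = y + p *: x + (p^-1 - p) *: (x + p^-1 *: y).
Proof. by move=> p0; apply: coord_atP => t; rewrite !coord_atE; field. Qed.

(** On the plane of the two middle basis vectors t equals [theta] + q, and t fixes all other basis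
    vectors. *)
Lemma theta_it x : theta (Vact (it r) x) = Vact (it r) (theta x).
Proof.
move: x; have tl := @theta_linear r; have Xl := Vact_linear (it r).
have rup : (r < up (i0 r))%N by rewrite upE i0E.
have XZ c x : Vact (it r) (c *: x) = c *: Vact (it r) x.
  exact: (linear_scale Xl).
have tZ c (x : V r) : theta (c *: x) = c *: theta x.
  exact: (linear_scale tl c x).
apply: v_ext; [exact: lin_comp|exact: lin_comp| |] => a ra.
  have [->|au] := eqVneq a (up (i0 r)).
    rewrite Vact_it_up (linear_add tl) tZ -rev_up_i0 (theta_rev rup).
    rewrite (theta_gt rup) rev_up_i0 Vact_it_dn -addrA -scalerDl subrK.
    by [].
  have ad : a != dn (i0 r) by rewrite -rev_up_i0 eq_sym rev_gt.
  have rd : rev_ord a != dn (i0 r) by rewrite -rev_up_i0 (inj_eq rev_ord_inj).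
  rewrite (Vact_it_other ad au) (theta_gt ra).
  by rewrite (Vact_it_other rd (rev_gt ra rup)).
have [->|au] := eqVneq a (up (i0 r)).
  rewrite (theta_rev rup) (linear_add Xl) XZ rev_up_i0 Vact_it_dn Vact_it_up.
  rewrite (linear_add tl) tZ (theta_gt rup) -rev_up_i0 (theta_rev rup).
  exact: theta_it_scalars q_neq0.
have ad : a != dn (i0 r) by rewrite -rev_up_i0 eq_sym rev_gt.
have rd : rev_ord a != dn (i0 r) by rewrite -rev_up_i0 (inj_eq rev_ord_inj).
have ru := rev_gt ra rup.
rewrite (Vact_it_other rd ru) (theta_rev ra) (linear_add Xl) XZ.
by rewrite (Vact_it_other rd ru) (Vact_it_other ad au).
Qed.

End Coideal.

Lemma add_shuffle4 (A : zmodType) (a b c d : A) :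
  a + b + (c + d) = c + (a + d) + b.
Proof. by rewrite (AC (2*2) (3*(1*4)*2)). Qed.
Lemma add_shuffle5 (A : zmodType) (a b c d e : A) :
  c + d + (a + b) + e = c + b + (d + a + e).
Proof. by rewrite (AC (2*2*1) ((1*4)*(2*3*5))). Qed.

Section Commutation.
Variables (r m : nat).
Implicit Types (i : 'I_r) (x : V r) (w : Vt r m).
Notation act := (@Vtact r _).

Lemma Vtact_ie n i (w : Vt r n) : Vtact (ie i) w = Vtgen (gE (ipos i)) w +
  Vtgen (gKinv (ipos i)) (Vtgen (gF (ineg i)) w).
Proof. by rewrite Vtact_add Vtact_mul !Vtact_gen. Qed.
Lemma Vtact_if n i (w : Vt r n) : Vtact (if_ i) w =
  Vtgen (gF (ipos i)) (Vtgen (gKinv (ineg i)) w) + Vtgen (gE (ineg i)) w.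
Proof. by rewrite Vtact_add Vtact_mul !Vtact_gen. Qed.
Lemma Vtact_ik n i (w : Vt r n) :
  Vtact (ik i) w = Vtgen (gK (ipos i)) (Vtgen (gKinv (ineg i)) w).
Proof. by rewrite Vtact_mul !Vtact_gen. Qed.
Lemma Vtact_ikinv n i (w : Vt r n) : Vtact (ikinv i) w =
  Vtgen (gKinv (ipos i)) (Vtgen (gK (ineg i)) w).
Proof. by rewrite Vtact_mul !Vtact_gen. Qed.
Lemma Vtact_it n (w : Vt r n) : Vtact (it r) w = Vtgen (gE (i0 r)) w +
  q *: Vtgen (gF (i0 r)) (Vtgen (gKinv (i0 r)) w) + Vtgen (gKinv (i0 r)) w.
Proof. by rewrite !Vtact_add Vtact_scale Vtact_mul !Vtact_gen. Qed.

Let VtD g (u w : Vt r m.+1) : Vtgen g (u + w) = Vtgen g u + Vtgen g w.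
Proof. exact: (linear_add (Vtgen_linear g)). Qed.

(** The coideal property: the first legs 1, e_i and k_i^-1 all lie in U^iota, while the second legs
    are arbitrary elements of U. *)
Lemma Vtact_ie_pure i x w : Vtact (ie i) (pure_tensor x w) =
  pure_tensor x (Vtgen (gE (ipos i)) w) +
  pure_tensor (Vact (ie i) x) (Vtgen (gKinv (ipos i)) w) +
  pure_tensor (Vact (ikinv i) x) (Vtgen (gKinv (ipos i)) (Vtgen (gF (ineg i)) w)).
Proof.
rewrite Vtact_ie VtgenE VtgenF VtD !VtgenV Vact_ie Vact_ikinv pure_tensorDl.
by rewrite !addrA.
Qed.

Lemma Vtact_if_pure i x w : Vtact (if_ i) (pure_tensor x w) =
  pure_tensor x (Vtgen (gE (ineg i)) w) +
  pure_tensor (Vact (if_ i) x) (Vtgen (gKinv (ineg i)) w) +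
  pure_tensor (Vact (ik i) x) (Vtgen (gF (ipos i)) (Vtgen (gKinv (ineg i)) w)).
Proof.
rewrite Vtact_if VtgenE VtgenV VtgenF Vact_if Vact_ik pure_tensorDl.
exact: add_shuffle4.
Qed.

Lemma Vtact_ik_pure i x w : Vtact (ik i) (pure_tensor x w) =
  pure_tensor (Vact (ik i) x) (Vtact (ik i) w).
Proof. by rewrite !Vtact_ik VtgenV VtgenK Vact_ik. Qed.
Lemma Vtact_ikinv_pure i x w : Vtact (ikinv i) (pure_tensor x w) =
  pure_tensor (Vact (ikinv i) x) (Vtact (ikinv i) w).
Proof. by rewrite !Vtact_ikinv VtgenK VtgenV Vact_ikinv. Qed.

(** In the coproduct of F K^-1 the term K K^-1 (x) F K^-1 has trivial first leg, so only 1 and t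
    occur as first legs. *)
Lemma Vtact_it_pure x w : Vtact (it r) (pure_tensor x w) =
  pure_tensor x (Vtgen (gE (i0 r)) w) +
  q *: pure_tensor x (Vtgen (gF (i0 r)) (Vtgen (gKinv (i0 r)) w)) +
  pure_tensor (Vact (it r) x) (Vtgen (gKinv (i0 r)) w).
Proof.
rewrite Vtact_it VtgenE !VtgenV VtgenF Vact_it (U_KV (Urep_Vgen r)).
rewrite !pure_tensorDl pure_tensorZl scalerDr.
exact: add_shuffle5.
Qed.

Lemma Hgen_head_Vtact (u : U r) (w : Vt r m.+1) :
  u = it r \/ (exists i, [\/ u = ie i, u = if_ i, u = ik i | u = ikinv i]) ->
  Hgen ord0 (Vtact u w) = Vtact u (Hgen ord0 w).
Proof.
have Hl := @Hgen_linear r m.+1 ord0; have Ul := Vtact_linear (m := m.+1) u.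
have HD := linear_add Hl; have HZ := linear_scale Hl.
move=> u_gen; move: w; apply: eq_on_pure; [exact: lin_comp|exact: lin_comp|].
move=> x w; case: u_gen Ul => [->|[i [] ->]] Ul; rewrite Hgen_head_flip.
- by rewrite !Vtact_it_pure !HD HZ !Hgen_head_flip theta_it.
- by rewrite !Vtact_ie_pure !HD !Hgen_head_flip theta_ie theta_ikinv.
- by rewrite !Vtact_if_pure !HD !Hgen_head_flip theta_if theta_ik.
- by rewrite !Vtact_ik_pure Hgen_head_flip theta_ik.
- by rewrite !Vtact_ikinv_pure Hgen_head_flip theta_ikinv.
Qed.

Lemma Hgen_Uiota (a : 'I_m.+1) (u : U r) (w : Vt r m.+1) : Uiota u ->
  Hgen a (Vtact u w) = Vtact u (Hgen a w).
Proof.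
have Hl := @Hgen_linear r m.+1 a.
have HD := linear_add Hl; have HZ := linear_scale Hl.
move=> Uu; elim: Uu w => {u} [u u_gen|c|u1 u2 _ IH1 _ IH2|u1 u2 _ IH1 _ IH2] w.
- have [a0|a0] := posnP a.
    have -> : a = ord0 by apply/val_inj.
    exact: Hgen_head_Vtact.
  have gen g (z : Vt r m.+1) := Hgen_Vtgen g z a0.
  case: u_gen => [->|[i [] ->]].
  + by rewrite !Vtact_it !HD HZ !gen.
  + by rewrite !Vtact_ie HD !gen.
  + by rewrite !Vtact_if HD !gen.
  + by rewrite !Vtact_ik !gen.
  + by rewrite !Vtact_ikinv !gen.
- by rewrite !Vtact_scale !Vtact_one HZ.
- by rewrite !Vtact_add HD IH1 IH2.
- by rewrite !Vtact_mul IH1 IH2.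
Qed.

Lemma Hact_Vtact (u : U r) (h : HeckeB m.+1) (w : Vt r m.+1) : Uiota u ->
  Hact (Vtact u w) h = Vtact u (Hact w h).
Proof.
move=> Uu; rewrite /Hact; elim: (rep h) w => [c|a|x IHx y IHy|x IHx y IHy] w /=.
- by rewrite (linear_scale (Vtact_linear u)).
- exact: Hgen_Uiota.
- by rewrite IHx IHy (linear_add (Vtact_linear u)).
- by rewrite IHx IHy.
Qed.
End Commutation.

(** * Specialization at q = 1 *)

Section Specialization.
Variables (K k : fieldType) (red : K -> k -> Prop) (lift : k -> K).
Hypothesis red_lift : forall c, red (lift c) c.
Hypothesis red_zero : forall c, red 0 c -> c = 0.
Hypothesis red0 : red 0 0.
Hypothesis red1 : red 1 1.
Hypothesis redD : forall x y c d, red x c -> red y d -> red (x + y) (c + d).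
Hypothesis redM : forall x y c d, red x c -> red y d -> red (x * y) (c * d).
Hypothesis redN : forall x c, red x c -> red (- x) (- c).

Definition red_mx m n (A : 'M[K]_(m, n)) (B : 'M[k]_(m, n)) :=
  forall i j, red (A i j) (B i j).

Lemma red_sum (I : Type) (s : seq I) (P : pred I) (F : I -> K) (G : I -> k) :
  (forall i, red (F i) (G i)) -> red (\sum_(i <- s | P i) F i) (\sum_(i <- s | P i) G i).
Proof. by move=> FG; elim/big_rec2: _ => // i y1 y2 _; apply: redD. Qed.

Lemma red_prod (I : Type) (s : seq I) (P : pred I) (F : I -> K) (G : I -> k) :
  (forall i, red (F i) (G i)) -> red (\prod_(i <- s | P i) F i) (\prod_(i <- s | P i) G i).
Proof. by move=> FG; elim/big_rec2: _ => // i y1 y2 _; apply: redM. Qed.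

Lemma red_mulmx m n p (A : 'M_(m, n)) (B : 'M_(n, p)) A' B' :
  red_mx A A' -> red_mx B B' -> red_mx (A *m B) (A' *m B').
Proof.
by move=> rA rB i j; rewrite !mxE; apply: red_sum => l; apply: redM.
Qed.

Lemma red_addmx m n (A B : 'M_(m, n)) A' B' :
  red_mx A A' -> red_mx B B' -> red_mx (A + B) (A' + B').
Proof. by move=> rA rB i j; rewrite !mxE; apply: redD. Qed.

Lemma red_det n (A : 'M_n) A' : red_mx A A' -> red (\det A) (\det A').
Proof.
move=> rA; apply: red_sum => s; apply: redM.
  by case: (odd_perm s); rewrite ?expr0 ?expr1 //; apply: redN.
exact: red_prod.
Qed.

(** If A' has rank r, then L A' R is the identity of size r for suitable L and R. Lifting L and R
    entrywise gives L' A R' whose determinant reduces to 1, hence is nonzero, so A has rank at least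
    r. *)
Lemma red_rank m n (A : 'M_(m, n)) A' : red_mx A A' -> (\rank A' <= \rank A)%N.
Proof.
move=> rA; set r := \rank A'.
have [rm rn] : (r <= m)%N /\ (r <= n)%N by rewrite rank_leq_row rank_leq_col.
pose L : 'M_(r, m) := pid_mx r *m invmx (col_ebase A').
pose R : 'M_(n, r) := invmx (row_ebase A') *m pid_mx r.
have LR : L *m A' *m R = 1%:M.
  rewrite -{1}(mulmx_ebase A') /L /R -!mulmxA (mulmxA (row_ebase A')).
  rewrite mulmxV ?row_ebase_unit // mul1mx (mulmxA (invmx _)).
  rewrite mulVmx ?col_ebase_unit // mul1mx !mul_pid_mx -/r !minnn.
  have minr p : (r <= p)%N -> minn p r = r /\ minn r p = r by lia.
  have [m1 m2] := minr _ rm; have [n1 n2] := minr _ rn.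
  by rewrite ?(m1, m2, n1, n2, minnn) pid_mx_1.
pose L' := map_mx lift L; pose R' := map_mx lift R.
have : red (\det (L' *m A *m R')) (\det (L *m A' *m R)).
  by apply: red_det; do 2?apply: red_mulmx => //; move=> i j; rewrite !mxE.
rewrite LR det1 => rd.
have dn0 : \det (L' *m A *m R') != 0.
  by apply/eqP => d0; move: rd; rewrite d0 => /red_zero/eqP; rewrite oner_eq0.
have /mxrank_unit <- : L' *m A *m R' \in unitmx by rewrite unitmxE unitfE.
exact: leq_trans (mxrankM_maxl _ _) (mxrankM_maxr _ _).
Qed.

(* Semicontinuity of the rank: specializing can only shrink the span of the   *)
(* rows of A and enlarge the kernel of B.                                     *)
Lemma kermx_deform n s (A : 'M[K]_n) (B : 'M[K]_(n, s)) (B' : 'M[k]_(n, s)) :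
  red_mx B B' -> red_mx A (kermx B') -> A *m B = 0 -> (kermx B <= A)%MS.
Proof.
move=> rB rA AB; have AK : (A <= kermx B)%MS by apply/sub_kermxP.
rewrite -(geq_leqif (mxrank_leqif_sup AK)) mxrank_ker.
apply: leq_trans (red_rank rA); rewrite mxrank_ker leq_sub2l //.
exact: red_rank.
Qed.

End Specialization.

Section AtOne.

(** The value at q = 1, as a relation because it exists only for fractions that have a denominator
    not vanishing there. *)
Definition red1q (x : Qq) (c : rat) := exists p d : {poly rat},
  [/\ d.[1] != 0, x = tofrac p / tofrac d & c = p.[1] / d.[1]].

Lemma tofrac_neq0 (d : {poly rat}) : d.[1] != 0 -> tofrac d != 0.
Proof. by rewrite tofrac_eq0; apply: contra_neq => ->; rewrite horner0. Qed.

Lemma red1q_poly p : red1q (tofrac p) p.[1].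
Proof.
by exists p, 1; rewrite tofrac1 hornerC oner_neq0; split=> //; rewrite [RHS]divr1.
Qed.

Lemma red1q_lift c : red1q (tofrac c%:P) c.
Proof. by have := red1q_poly c%:P; rewrite hornerC. Qed.

Lemma red1q_zero c : red1q 0 c -> c = 0.
Proof.
move=> [p [d [d1 /esym/eqP]]]; rewrite mulf_eq0 invr_eq0.
rewrite (negbTE (tofrac_neq0 d1)) orbF tofrac_eq0 => /eqP -> ->.
by rewrite horner0 mul0r.
Qed.

Lemma red1q_0 : red1q 0 0.
Proof. by rewrite -tofrac0; have := red1q_poly 0; rewrite horner0. Qed.
Lemma red1q_1 : red1q 1 1.
Proof. by rewrite -tofrac1; have := red1q_poly 1; rewrite hornerC. Qed.

Lemma frac_add (F : fieldType) (a b c d : F) : b != 0 -> d != 0 ->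
  a / b + c / d = (a * d + c * b) / (b * d).
Proof. exact: addf_div. Qed.

Lemma frac_mul (F : fieldType) (a b c d : F) :
  a / b * (c / d) = (a * c) / (b * d).
Proof. by rewrite mulf_div. Qed.

Lemma red1q_D x y c d : red1q x c -> red1q y d -> red1q (x + y) (c + d).
Proof.
move=> [p [e [e1 -> ->]]] [p' [e' [e1' -> ->]]].
exists (p * e' + p' * e), (e * e'); rewrite hornerM mulf_neq0 //; split=> //.
  rewrite tofracD !tofracM; apply: frac_add; exact: tofrac_neq0.
by rewrite hornerD !hornerM frac_add.
Qed.

Lemma red1q_M x y c d : red1q x c -> red1q y d -> red1q (x * y) (c * d).
Proof.
move=> [p [e [e1 -> ->]]] [p' [e' [e1' -> ->]]].
exists (p * p'), (e * e'); rewrite hornerM mulf_neq0 //; split=> //.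
  by rewrite !tofracM; apply: frac_mul.
by rewrite !hornerM frac_mul.
Qed.

Lemma red1q_N x c : red1q x c -> red1q (- x) (- c).
Proof.
move=> [p [e [e1 -> ->]]]; exists (- p), e; rewrite e1 tofracN hornerN.
by split=> //; rewrite mulNr.
Qed.

Lemma red1q_q : red1q q 1.
Proof. by have := red1q_poly 'X; rewrite hornerX. Qed.

Lemma red1q_V : red1q q^-1 1.
Proof.
exists 1, 'X; rewrite hornerX oner_neq0 tofrac1; split=> //; first by rewrite [RHS]mul1r.
by rewrite hornerC divr1.
Qed.

Lemma red1q_exp x n : red1q x 1 -> red1q (x ^+ n) 1.
Proof.
move=> rx; elim: n => [|n IHn]; first by rewrite expr0; apply: red1q_1.
by rewrite exprS -[X in red1q _ X]mulr1; apply: red1q_M.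
Qed.

Lemma red1q_expz (n : int) : red1q (q ^ n) 1.
Proof.
case: n => n; first exact: (red1q_exp _ red1q_q).
by rewrite NegzE -exprnN -exprVn; apply: (red1q_exp _ red1q_V).
Qed.

End AtOne.

(** * The duality at q = 1 *)

Section TensorMatrices.
Variables (k : fieldType) (m N : nat).
Notation T := {ffun 'I_m -> 'I_N}.
Implicit Types (x y z : 'I_m -> 'M[k]_N) (A B : 'M[k]_N) (i j l : 'I_m).

Definition op_mx (g : T -> T -> k) : 'M[k]_#|{: T}| :=
  \matrix_(i, j) g (enum_val i) (enum_val j).

Lemma op_mx_mul g g' :
  op_mx g *m op_mx g' = op_mx (fun f h => \sum_e g f e * g' e h).
Proof.
apply/matrixP => i j; rewrite !mxE [RHS](reindex _ (onW_bij _ (@enum_val_bij _))) /=.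
by apply: eq_bigr => e _; rewrite !mxE.
Qed.

Lemma eq_op_mx g g' : (forall f h, g f h = g' f h) -> op_mx g = op_mx g'.
Proof. by move=> gg; apply/matrixP => i j; rewrite !mxE. Qed.

Lemma op_mx1 : op_mx (fun f h => (f == h)%:R) = 1%:M.
Proof. by apply/matrixP => i j; rewrite !mxE (inj_eq enum_val_inj). Qed.

Definition tens_mx x := op_mx (fun f h => \prod_l x l (f l) (h l)).

Lemma eq_tens_mx x y : x =1 y -> tens_mx x = tens_mx y.
Proof.
by move=> xy; apply: eq_op_mx => f h; apply: eq_bigr => l _; rewrite xy.
Qed.

Lemma tens_mx_mul x y : tens_mx x *m tens_mx y = tens_mx (fun l => x l *m y l).
Proof.
rewrite op_mx_mul; apply: eq_op_mx => f h.
under [RHS]eq_bigr do rewrite mxE.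
rewrite bigA_distr_bigA; apply: eq_bigr => e _.
by rewrite big_split.
Qed.

Lemma tens_mx1 : tens_mx (fun=> 1%:M) = 1%:M.
Proof.
rewrite -op_mx1; apply: eq_op_mx => f h; under eq_bigr do rewrite mxE.
case: eqP => [->|fh]; first by apply: big1 => l _; rewrite eqxx.
have [l /negbTE fhl] : exists l, f l != h l.
  by apply/existsP; apply/contra_notT: fh => /existsPn fh; apply/ffunP => l;
     apply/eqP/negPn/fh.
by rewrite (bigD1 l) //= fhl mul0r.
Qed.

Definition upd x j A l := if l == j then A else x l.

Lemma tens_mx_upd_lin x j a A B : tens_mx (upd x j (a *: A + B)) =
  a *: tens_mx (upd x j A) + tens_mx (upd x j B).
Proof.
apply/matrixP => f h; rewrite !mxE.
have E (y : 'M[k]_N) : \prod_l upd x j y l (enum_val f l) (enum_val h l) =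
    y (enum_val f j) (enum_val h j) *
    \prod_(l | l != j) x l (enum_val f l) (enum_val h l).
  rewrite (bigD1 j) //= /upd eqxx; congr (_ * _).
  by apply: eq_bigr => l /negbTE ->.
by rewrite !E !mxE mulrDl mulrA.
Qed.

Definition derivation A := \sum_j tens_mx (upd (fun=> 1%:M) j A).

Lemma derivation_lin a A B :
  derivation (a *: A + B) = a *: derivation A + derivation B.
Proof.
rewrite /derivation scaler_sumr -big_split; apply: eq_bigr => j _.
exact: tens_mx_upd_lin.
Qed.

Lemma derivation1 : derivation 1%:M = m%:R%:M.
Proof.
rewrite /derivation (eq_bigr (fun=> 1%:M)) ?sumr_const ?card_ord => [|j _].
  by rewrite -scaler_nat scale_scalar_mx mulr1.
by rewrite -tens_mx1; apply: eq_tens_mx => l; rewrite /upd; case: eqP.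
Qed.

Lemma derivation_tens A x : derivation A *m tens_mx x =
  \sum_j tens_mx (upd x j (A *m x j)).
Proof.
rewrite mulmx_suml; apply: eq_bigr => j _; rewrite tens_mx_mul.
apply: eq_tens_mx => l; rewrite /upd; case: eqP => [->//|_].
by rewrite mul1mx.
Qed.

Lemma derivation_mul A B : derivation A *m derivation B =
  \sum_l \sum_j (if j == l then tens_mx (upd (fun=> 1%:M) l (A *m B))
                 else tens_mx (upd (upd (fun=> 1%:M) l B) j A)).
Proof.
rewrite {2}/derivation mulmx_sumr; apply: eq_bigr => l _.
rewrite derivation_tens; apply: eq_bigr => j _.
case: eqP => [->|/eqP/negbTE jl]; apply: eq_tens_mx => i; rewrite /upd.
  by case: eqP => // _; rewrite eqxx.
by rewrite jl mulmx1.
Qed.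

(** Terms acting at distinct positions commute and cancel; at equal positions the commutator of A
    and B remains. *)
Lemma derivation_comm A B : derivation A *m derivation B -
  derivation B *m derivation A = derivation (A *m B - B *m A).
Proof.
rewrite !derivation_mul [X in _ - X]exchange_big -sumrB.
apply: eq_bigr => l _; rewrite -sumrB (bigD1 l) //= eqxx big1 => [|j jl].
  rewrite addr0 -scaleN1r [in RHS]addrC -[in RHS]scaleN1r tens_mx_upd_lin.
  by rewrite addrC.
rewrite (negbTE jl) eq_sym (negbTE jl); apply/eqP; rewrite subr_eq0; apply/eqP.
apply: eq_tens_mx => i; rewrite /upd; case: (eqVneq i j) => [->|//].
by rewrite (negbTE jl).
Qed.

Definition symm_mx x := \sum_(s : 'S_m) tens_mx (fun l => x (s l)).

Lemma eq_symm_mx x y : x =1 y -> symm_mx x = symm_mx y.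
Proof. by move=> xy; apply: eq_bigr => s _; apply: eq_tens_mx. Qed.

Lemma symm_mx_perm x (t : 'S_m) : symm_mx (fun l => x (t l)) = symm_mx x.
Proof.
rewrite /symm_mx [RHS](reindex_inj (mulIg t)) /=.
by apply: eq_bigr => s _; apply: eq_tens_mx => l; rewrite permM.
Qed.

Lemma derivation_symm A x : derivation A *m symm_mx x =
  \sum_j symm_mx (upd x j (A *m x j)).
Proof.
rewrite mulmx_sumr exchange_big; apply: eq_bigr => s _.
rewrite derivation_tens [RHS](reindex_inj (@perm_inj _ s)).
apply: eq_bigr => j _; apply: eq_tens_mx => l.
by rewrite /upd (inj_eq perm_inj).
Qed.

Section Generation.
Variables (P : 'M[k]_#|{: T}| -> Prop) (Q : 'M[k]_N -> Prop).
Hypothesis P_lin : forall a X Y, P X -> P Y -> P (a *: X + Y).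
Hypothesis P_mul : forall X Y, P X -> P Y -> P (X *m Y).
Hypothesis P_1 : P 1%:M.
Hypothesis Q_mul : forall A B, Q A -> Q B -> Q (A *m B).
Hypothesis Q_1 : Q 1%:M.
Hypothesis P_Q : forall A, Q A -> P (derivation A).
Hypothesis char0 : forall n, n.+1%:R != 0 :> k.

Lemma P_closed0 : P 0.
Proof. by rewrite -(addNr 1%:M) -scaleN1r; apply: P_lin. Qed.
Lemma P_closedZ a X : P X -> P (a *: X).
Proof. by move=> PX; rewrite -[_ *: _]addr0; apply: P_lin => //; apply: P_closed0. Qed.
Lemma P_closedD X Y : P X -> P Y -> P (X + Y).
Proof. by move=> PX PY; rewrite -[X]scale1r; apply: P_lin. Qed.
Lemma P_closedB X Y : P X -> P Y -> P (X - Y).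
Proof. by move=> PX PY; rewrite addrC -scaleN1r; apply: P_lin. Qed.
Lemma P_closed_sum (I : Type) (s : seq I) (p : pred I)
    (F : I -> 'M[k]_#|{: T}|) :
  (forall e, p e -> P (F e)) -> P (\sum_(e <- s | p e) F e).
Proof.
by move=> PF; elim/big_ind: _ => //; [apply: P_closed0|apply: P_closedD].
Qed.

(** By induction on the number of factors other than the identity. Replace one such factor A by the
    identity and multiply by [derivation A]: terms putting A in a free slot all give the desired
    symmetrization, and terms multiplying A into an occupied slot have smaller support.
    Characteristic zero allows division by the number of free slots. *)
Lemma symm_mx_closed x : (forall j, Q (x j)) -> P (symm_mx x).
Proof.
pose supp (J : {set 'I_m}) x := forall j, j \notin J -> x j = 1%:M.
suff: forall n x (J : {set 'I_m}), (#|J| <= n)%N -> supp J x ->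
    (forall j, Q (x j)) -> P (symm_mx x).
  move=> /(_ m x [set: 'I_m]%SET); apply; first by rewrite cardsT card_ord.
  by move=> j; rewrite inE.
elim=> [|n IHn] {}x J Jn xJ Qx.
  rewrite leqn0 cards_eq0 in Jn; move: xJ; rewrite (eqP Jn) => xJ.
  apply: P_closed_sum => s _; rewrite (eq_tens_mx (y := fun=> 1%:M)) ?tens_mx1 //.
  by move=> l; rewrite xJ ?inE.
have [J0|[j0 j0J]] := set_0Vmem J.
  by apply: (IHn x J) => //; rewrite J0 cards0.
pose J' := J :\ j0; pose x' := upd x j0 1%:M; pose A := x j0.
have Jn' : (#|J'| <= n)%N by move: Jn; rewrite (cardsD1 j0) j0J.
have x'J : supp J' x'.
  by move=> j; rewrite !inE /x' /upd; case: eqP => //= _; apply: xJ.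
have Qx' j : Q (x' j) by rewrite /x' /upd; case: eqP.
have PA : P (derivation A *m symm_mx x') 
  by apply: P_mul; [exact: (P_Q (Qx j0))|exact: (IHn x' J')].
rewrite derivation_symm (bigID (mem J')) /= in PA.
(* Symmetrization forgets positions, so A may be moved from any free slot back to [j0]. *)
have swap j : j \notin J' -> symm_mx (upd x' j (A *m x' j)) = symm_mx x.
  move=> jJ; rewrite -(symm_mx_perm x (tperm j j0)); apply: eq_symm_mx => l.
  rewrite (x'J _ jJ) mulmx1 /upd; case: tpermP => [->|->|/eqP lj /eqP lj0].
  - by rewrite eqxx.
  - case: eqP => [<-//|/eqP j0j]; rewrite /x' /upd eqxx xJ //.
    by move: jJ; rewrite !inE eq_sym j0j.
  - by rewrite (negbTE lj) /x' /upd (negbTE lj0).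
rewrite [X in _ + X](eq_bigr (fun=> symm_mx x)) // sumr_const in PA.
have PS : P (\sum_(j in J') symm_mx (upd x' j (A *m x' j))).
  apply: P_closed_sum => j jJ; apply: (IHn _ J') => //.
    move=> l lJ; rewrite /upd; case: eqP => [lj|_]; last exact: x'J.
    by rewrite lj jJ in lJ.
  by move=> l; rewrite /upd; case: eqP => // _; apply: Q_mul => //; apply: Qx.
have {PA PS} := P_closedB PA PS; rewrite addrAC subrr add0r.
(* [c] counts the free slots; [j0] itself is one, since it was removed from the support. *)
set c := #|_|; have c0 : (0 < c)%N.
  by apply/card_gt0P; exists j0; rewrite unfold_in /= !inE eqxx.
move=> /(P_closedZ c%:R^-1); rewrite -scaler_nat scalerA mulVf ?scale1r //.
by rewrite -(prednK c0).
Qed.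
End Generation.
End TensorMatrices.

(** The transposition of x and y is that of x and y - 1 conjugated by the adjacent one of y - 1 and
    y, and transpositions generate. *)
Lemma perm_adjacent_ind m (R : 'S_m -> Prop) :
  R 1%g -> (forall s t, R s -> R t -> R (s * t)%g) ->
  (forall a : 'I_m, (0 < a)%N -> R (tperm (ord_pred a) a)) -> forall s, R s.
Proof.
move=> R1 RM Ra s; have [ts -> _] := prod_tpermP s.
have Rt d (x y : 'I_m) : (x + d = y)%N -> R (tperm x y).
  elim: d x y => [|d IHd] x y xy.
    have -> : x = y by apply/val_inj; rewrite -[RHS]xy addn0.
    by rewrite tperm1.
  have y0 : (0 < y)%N by lia.
  have pyE := ord_predE y0; have py := Ra y y0.
  case: d => [|d] in IHd xy *.
    have -> : x = ord_pred y by apply/val_inj; rewrite [RHS]pyE -xy addn1.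
    exact: py.
  have -> : tperm x y = (tperm x (ord_pred y) ^ tperm (ord_pred y) y)%g.
    rewrite tpermJ tpermL tpermD // 1?ord_pred_eq //; first by lia.
    by rewrite -(inj_eq val_inj) /=; lia.
  rewrite /conjg tpermV; apply: (RM) => //; apply: (RM) => //; apply: IHd.
  by rewrite pyE; lia.
elim/big_ind: _ => // [[x y]] _ /=.
have [xy|yx] := leqP x y; first by apply: (Rt (y - x)%N); lia.
by rewrite tpermC; apply: (Rt (x - y)%N); lia.
Qed.

(** * The Lie algebra of matrices commuting with the sign flip *)

Section SymmetricMatrices.
Variable r : nat.
Notation N := (r.*2.+2).
Implicit Types (a b c d : Ihalf r) (A B : 'M[rat]_N).

Definition symX a b : 'M[rat]_N :=
  delta_mx a b + delta_mx (rev_ord a) (rev_ord b).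

Definition rev_inv A := forall a b, A (rev_ord a) (rev_ord b) = A a b.

Lemma rev_inv1 : rev_inv 1%:M.
Proof. by move=> a b; rewrite !mxE (inj_eq rev_ord_inj). Qed.

Lemma rev_inv_mul A B : rev_inv A -> rev_inv B -> rev_inv (A *m B).
Proof.
move=> HA HB a b; rewrite !mxE (reindex_inj rev_ord_inj) /=.
by apply: eq_bigr => c _; rewrite HA HB.
Qed.

Lemma symX_rev a b : symX (rev_ord a) (rev_ord b) = symX a b.
Proof. by rewrite /symX !rev_ordK addrC. Qed.

Lemma rev_inv_symX a b : rev_inv (symX a b).
Proof.
move=> c d; rewrite !mxE !(inj_eq rev_ord_inj) addrC.
by rewrite -!(can2_eq (@rev_ordK N) (@rev_ordK N)) [LHS]addrC addrC.
Qed.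

Lemma symX_mul a b c d : symX a b *m symX c d =
  (b == c)%:R *: symX a d + (b == rev_ord c)%:R *: symX a (rev_ord d).
Proof.
rewrite /symX !mulmxDl !mulmxDr !mul_delta_mx_cond !(inj_eq rev_ord_inj).
rewrite (can2_eq (@rev_ordK N) (@rev_ordK N) b c) rev_ordK.
rewrite !scaler_nat !mulrnDl.
by rewrite (AC (2*2) ((1*4)*(2*3))).
Qed.

Lemma rev_ord_neq a : rev_ord a != a.
Proof.
apply/eqP => /(congr1 (@nat_of_ord _)); rewrite revE.
by have := ltn_ord a; lia.
Qed.

Section Lie.
Variable L : 'M[rat]_N -> Prop.
Hypothesis L_lin : forall x A B, L A -> L B -> L (x *: A + B).
Hypothesis L_comm : forall A B, L A -> L B -> L (A *m B - B *m A).
Hypothesis L_1 : L 1%:M.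
Hypothesis L_adj : forall i : Iint r, L (symX (dn i) (up i)).

Lemma L_0 : L 0.
Proof. by rewrite -(addNr 1%:M) -scaleN1r; apply: L_lin. Qed.
Lemma L_scale x A : L A -> L (x *: A).
Proof. by move=> LA; rewrite -[_ *: _]addr0; apply: L_lin => //; apply: L_0. Qed.
Lemma L_add A B : L A -> L B -> L (A + B).
Proof. by move=> LA LB; rewrite -[A]scale1r; apply: L_lin. Qed.
(** By induction on the distance of a and b: with c = b - 1, the commutator of X_ac and X_cb is
    X_ab, up to an extra term when b = -a. *)
Lemma L_symX_lt e a b : (a + e.+1 = b)%N -> L (symX a b).
Proof.
elim/ltn_ind: e a b => -[|e] IHe a b ab.
  have ar : (a < r.*2.+1)%N by have := ltn_ord b; lia.
  have := L_adj (Ordinal ar); congr (L (symX _ _)); apply/val_inj => //.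
  by rewrite [LHS]upE /=; lia.
have cN : (b.-1 < N)%N by have := ltn_ord b; lia.
pose c := Ordinal cN; have cE : c = b.-1 :> nat by [].
have ac : L (symX a c) by apply: (IHe e); lia.
have cb : L (symX c b) by apply: (IHe 0); rewrite ?cE; lia.
have ba : (b == a) = false by apply/negbTE; rewrite -(inj_eq val_inj) /=; lia.
have := L_comm ac cb; rewrite !symX_mul eqxx ba (eq_sym c) (negbTE (rev_ord_neq c)).
rewrite scale0r addr0 scale1r scale0r add0r.
(* For b = -a the commutator is X_ab - X_(c,-c). As X_(c,-c) = X_(-c,c) and -c = a + 1, the extra
   term joins indices closer by two and is covered by induction; distance two would force c = -c,
   which is impossible. *)
case: eqP => [bra|_]; last by rewrite scale0r subr0.
rewrite scale1r => H.
have {}H2 : L (symX c (rev_ord c)); last first.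
  by have := L_add H H2; rewrite subrK.
have bE : (b = r.*2.+1 - a :> nat)%N by rewrite bra revE.
have rcE : (rev_ord c = a.+1 :> nat)%N.
  by rewrite revE cE bE; have := ltn_ord a; lia.
rewrite -symX_rev rev_ordK; case: e IHe ab => [|e] IHe ab.
  have rc : rev_ord c = c by apply/val_inj; rewrite [LHS]rcE [RHS]cE; lia.
  by have := rev_ord_neq c; rewrite rc eqxx.
by apply: (IHe e) => //; rewrite rcE cE; lia.
Qed.

Lemma L_symX_neq a b : a != b -> L (symX a b).
Proof.
move=> neq; have [ab|ba|/val_inj E] := ltngtP a b; last by rewrite E eqxx in neq.
  by apply: (@L_symX_lt (b - a).-1); lia.
rewrite -symX_rev; apply: (@L_symX_lt (a - b).-1); rewrite !revE.
by have := ltn_ord a; lia.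
Qed.

(** Off the diagonal this is the previous lemma. Differences X_bb - X_cc are commutators, and the
    sum of all X_cc is twice the identity, so a nonzero multiple of X_bb is the sum of those
    differences plus a scalar matrix. *)
Lemma L_symX a b : L (symX a b).
Proof.
have [->|] := eqVneq a b; last exact: L_symX_neq.
have diff c d : L (symX c c - symX d d).
  have [->|cd] := eqVneq c d; first by rewrite subrr; apply: L_0.
  have dc : d != c by rewrite eq_sym.
  have := L_comm (L_symX_neq cd) (L_symX_neq dc); rewrite !symX_mul !eqxx.
  rewrite !scale1r (eq_sym d) (eq_sym c).
  by rewrite !(negbTE (rev_ord_neq _)) !scale0r !addr0.
have sum1 : \sum_c symX c c = 2 *: 1%:M.
  rewrite big_split /= [X in _ + X](reindex_inj rev_ord_inj) /=.
  under [X in _ + X]eq_bigr do rewrite rev_ordK.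
  suff -> : \sum_i delta_mx i i = 1%:M :> 'M[rat]_N by rewrite -mulr2n scaler_nat.
  apply/matrixP => c d; rewrite summxE (bigD1 c) //= big1 => [|e /negbTE ec].
    by rewrite !mxE eqxx eq_sym addr0.
  by rewrite !mxE (eq_sym c) ec.
have : L (\sum_c (symX b b - symX c c)).
  by elim/big_ind: _ => //; [apply: L_0|apply: L_add].
rewrite sumrB sum1 sumr_const card_ord => H.
have := L_scale (N%:R^-1) (L_add H (L_scale 2 L_1)).
by rewrite subrK -scaler_nat scalerA mulVf ?scale1r ?Num.Theory.pnatr_eq0.
Qed.

Lemma L_rev_inv A : rev_inv A -> L A.
Proof.
move=> HA.
have -> : A = 2^-1 *: \sum_a \sum_b A a b *: symX a b.
  apply/matrixP => c d; rewrite !mxE summxE.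
  have E1 (F : Ihalf r -> Ihalf r -> rat) c' d' :
      \sum_a \sum_b F a b * ((c' == a) && (d' == b))%:R = F c' d'.
    rewrite (bigD1 c') //= [X in _ + X]big1 ?addr0 => [|a /negbTE ac].
      rewrite (bigD1 d') //= !eqxx mulr1 big1 ?addr0 // => b /negbTE bd.
      by rewrite eq_sym bd andbF mulr0.
    by apply: big1 => b _; rewrite eq_sym ac mulr0.
  rewrite (eq_bigr (fun a => \sum_b (A a b * ((c == a) && (d == b))%:R
       + A a b * ((rev_ord c == a) && (rev_ord d == b))%:R))); last first.
    move=> a _; rewrite summxE; apply: eq_bigr => b _; rewrite !mxE mulrDr.
    by rewrite !(can2_eq (@rev_ordK N) (@rev_ordK N)).
  under eq_bigr do rewrite big_split /=.
  by rewrite big_split /= !E1 HA -mulr2n -(mulr_natl (A c d)) mulrA mulVf ?mul1r.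
apply: L_scale; elim/big_ind: _ => [||a _]; [exact: L_0|exact: L_add|].
elim/big_ind: _ => [||b _]; [exact: L_0|exact: L_add|].
exact: L_scale (L_symX a b).
Qed.

End Lie.
End SymmetricMatrices.

(** * Operators invariant under signed permutations *)

Section ClassicalDuality.
Variables r m : nat.
Notation N := (r.*2.+2).
Notation T := {ffun 'I_m -> 'I_N}.
Implicit Types (f h : T) (a : 'I_m) (E : {set 'I_m}).

Definition flip E f : T := [ffun l => if l \in E then rev_ord (f l) else f l].
Definition permute (s : 'S_m) f : T := [ffun l => f (s l)].

Lemma flip0 f : flip finset.set0 f = f.
Proof. by apply/ffunP => l; rewrite ffunE inE. Qed.
Lemma flipU1 a E f : a \notin E -> flip (a |: E)%SET f = flip [set a]%SET (flip E f).
Proof.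
move=> aE; apply/ffunP => l; rewrite !ffunE !inE.
by case: eqP => [->|//]; rewrite (negbTE aE).
Qed.

Lemma permute1 f : permute 1 f = f.
Proof. by apply/ffunP => l; rewrite ffunE perm1. Qed.
Lemma permuteM s t f : permute (s * t) f = permute s (permute t f).
Proof. by apply/ffunP => l; rewrite !ffunE permM. Qed.

Lemma act_s_permute a f : (0 < a)%N -> act_s f a = permute (tperm (ord_pred a) a) f.
Proof. by move=> a0; rewrite /act_s (gtn_eqF a0). Qed.

Lemma act_s_flip a f : a = 0 :> nat -> act_s f a = flip [set a]%SET f.
Proof.
move=> a0; rewrite /act_s a0 eqxx; apply/ffunP => l; rewrite !ffunE inE.
by case: eqP => [->|].
Qed.

Lemma act_sK a : involutive (fun f => act_s f a).
Proof.
move=> f; have [a0|a0] := posnP a.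
  rewrite !act_s_flip //; apply/ffunP => l; rewrite !ffunE inE.
  by case: (l == a); rewrite ?rev_ordK.
by rewrite !act_s_permute // -permuteM tperm2 permute1.
Qed.

Lemma flip1_permute a b f : flip [set a]%SET f =
  permute (tperm a b) (flip [set b]%SET (permute (tperm a b) f)).
Proof.
apply/ffunP => l; rewrite !ffunE !inE tpermK.
by rewrite -{2}(tpermL a b) (inj_eq perm_inj).
Qed.

Section Invariant.
Variable g : T -> T -> rat.
Definition invariant_under (t : T -> T) := forall f h, g (t f) (t h) = g f h.
Hypothesis g_act_s : forall a, invariant_under (fun f => act_s f a).

Lemma inv_permute s : invariant_under (permute s).
Proof.
elim/perm_adjacent_ind: s => [f h|s t IHs IHt f h|a a0 f h].
- by rewrite !permute1.
- by rewrite !permuteM IHs IHt.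
- by rewrite -!(act_s_permute _ a0) g_act_s.
Qed.

(** A flip at any position is the flip at position 0 conjugated by a transposition; several flips
    are composed one at a time. *)
Lemma inv_flip E : invariant_under (flip E).
Proof.
have [n] := ubnP #|E|; elim: n E => // n IHn E; rewrite ltnS => En f h.
have [->|[a aE]] := set_0Vmem E; first by rewrite !flip0.
have aE' : a \notin (E :\ a)%SET by rewrite !inE eqxx.
have {}IHn : invariant_under (flip (E :\ a)%SET).
  by apply: IHn; move: En; rewrite (cardsD1 a) aE.
rewrite -(finset.setD1K aE) !(flipU1 _ aE') -[RHS]IHn.
move: (flip _ f) (flip _ h) => {}f {}h.
have m0 : (0 < m)%N by exact: leq_ltn_trans (leq0n _) (ltn_ord a).
rewrite !(flip1_permute a (Ordinal m0)) inv_permute.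
by rewrite -!act_s_flip // g_act_s inv_permute.
Qed.

Lemma prod_nat_bool (b : pred 'I_m) :
  \prod_l ((b l)%:R : rat) = [forall l, b l]%:R.
Proof.
case: forallP => [H|H]; first by apply: big1 => l _; rewrite H.
have [l bl] : exists l, ~~ b l.
  by apply/existsP; apply/contra_notT: H => /existsPn H l; apply/negPn/H.
by rewrite (bigD1 l) //= (negbTE bl) mul0r.
Qed.

Lemma sum_pick (G : T -> T -> rat) f1 h1 :
  \sum_f \sum_h G f h * ((f == f1) && (h == h1))%:R = G f1 h1.
Proof.
rewrite (bigD1 f1) //= [X in _ + X]big1 ?addr0 => [|f /negbTE ff]; last first.
  by apply: big1 => h _; rewrite ff mulr0.
rewrite (bigD1 h1) //= !eqxx mulr1 big1 ?addr0 // => h /negbTE hh.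
by rewrite hh andbF mulr0.
Qed.

(** Averaging over the m! 2^m signed permutations changes nothing. Expanding the symmetrized
    products of the [symX] at a given entry produces one term for each permutation and sign pattern,
    which is this average. *)
Lemma invariant_symm : op_mx g = (m`!%:R * 2 ^+ m)^-1 *:
  \sum_f \sum_h g f h *: symm_mx (fun l => symX (f l) (h l)).
Proof.
apply/matrixP => i j; rewrite !mxE summxE.
set f0 := enum_val i; set h0 := enum_val j.
transitivity ((m`!%:R * 2 ^+ m)^-1 *
   (\sum_(s : 'S_m) \sum_(E : {set 'I_m}) g (flip E f0) (flip E h0)) : rat).
  under eq_bigr do under eq_bigr do rewrite inv_flip.
  rewrite !sumr_const card_Sn -(cardsT {set 'I_m}) -powersetT card_powerset.
  rewrite cardsT card_ord; move: (g f0 h0) => x.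
  rewrite -(mulr_natr (x *+ _)) -(mulr_natr x) natrX.
  have AB : (m`!%:R * 2 ^+ m : rat) != 0.
    by rewrite mulf_neq0 ?expf_neq0 ?Num.Theory.pnatr_eq0 // -lt0n fact_gt0.
  by rewrite -(mulrA x) (mulrC (2 ^+ m)) mulrCA mulVf // mulr1.
congr (_ * _).
rewrite [RHS](eq_bigr (fun f => \sum_h \sum_(s : 'S_m) \sum_(E : {set 'I_m})
   g f h * ((permute s f == flip E f0) && (permute s h == flip E h0))%:R)); last first.
  move=> f _; rewrite summxE; apply: eq_bigr => h _.
  rewrite !mxE summxE mulr_sumr; apply: eq_bigr => s _; rewrite mxE -mulr_sumr.
  congr (_ * _).
  (* Each factor is a sum of two matrix units; in the expanded product [E] collects the positions
     where the flipped unit is chosen. *)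
  under eq_bigr do rewrite !mxE addrC.
  rewrite bigA_distr; apply: eq_bigr => E _.
  rewrite (eq_bigr (fun l => ((permute s f l == flip E f0 l) &&
      (permute s h l == flip E h0 l))%:R)) => [|l _]; last first.
    rewrite !ffunE -/f0 -/h0; case: ifP => _; rewrite !(eq_sym (_ (s l))) //.
    by rewrite !(can2_eq (@rev_ordK N) (@rev_ordK N)).
  rewrite prod_nat_bool; congr ((nat_of_bool _)%:R).
  apply/forallP/andP => [H|[/eqP -> /eqP ->] l]; last by rewrite !eqxx.
  by split; apply/eqP/ffunP => l; have /andP[/eqP H1 /eqP H2] := H l.
under [RHS]eq_bigr do rewrite exchange_big.
rewrite [RHS]exchange_big /=; apply: eq_bigr => s _.
under [RHS]eq_bigr do rewrite exchange_big.
rewrite [RHS]exchange_big /=; apply: eq_bigr => E _.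
have sK : cancel (permute s^-1) (permute s).
  by move=> f; rewrite -permuteM mulgV permute1.
have pI := can_inj sK.
rewrite (reindex_inj pI) /=.
under [RHS]eq_bigr do rewrite (reindex_inj pI) /=.
under [RHS]eq_bigr do under eq_bigr do rewrite !sK inv_permute.
by rewrite sum_pick.
Qed.

End Invariant.

Definition act_mx a : 'M[rat]_#|{: T}| :=
  op_mx (fun f h => (h == act_s f a)%:R).

Lemma op_mx_enum (A : 'M[rat]_#|{: T}|) :
  A = op_mx (fun f h => A (enum_rank f) (enum_rank h)).
Proof. by apply/matrixP => i j; rewrite mxE !enum_valK. Qed.

Lemma act_mx_comm (A : 'M[rat]_#|{: T}|) a : A *m act_mx a = act_mx a *m A ->
  invariant_under (fun f h => A (enum_rank f) (enum_rank h)) (fun f => act_s f a).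
Proof.
set g := (X in invariant_under X); have AE : A = op_mx g by exact: op_mx_enum.
move=> comm f h; move: comm; rewrite AE /act_mx !op_mx_mul.
move=> /matrixP/(_ (enum_rank f) (enum_rank (act_s h a))).
rewrite !mxE !enum_rankK (bigD1 h) //= eqxx mulr1 big1 => [|e eh]; last first.
  rewrite (_ : (_ == _) = false) ?mulr0 //; apply/negbTE.
  by rewrite (inj_eq (inv_inj (@act_sK a))) eq_sym.
rewrite (bigD1 (act_s f a)) //= eqxx mul1r big1 => [|e /negbTE ->]; last first.
  by rewrite mul0r.
by rewrite !addr0 => ->.
Qed.

(** Derivations respect commutators, so by [L_rev_inv] P contains those of all matrices commuting
    with the flip. Their products yield the symmetrized tensors ([symm_mx_closed]), which span the
    invariant operators ([invariant_symm]). *)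
Theorem classical_generation (P : 'M[rat]_#|{: T}| -> Prop) :
  (forall x X Y, P X -> P Y -> P (x *: X + Y)) ->
  (forall X Y, P X -> P Y -> P (X *m Y)) -> P 1%:M ->
  (forall i : Iint r, P (derivation m (symX (dn i) (up i)))) ->
  forall A, (forall a, A *m act_mx a = act_mx a *m A) -> P A.
Proof.
move=> P_lin P_mul P_1 P_adj A HA.
have P_der B : rev_inv B -> P (derivation m B).
  apply: (L_rev_inv (L := fun B => P (derivation m B))) => [x B1 B2 P1 P2|B1 B2 P1 P2||//].
  - by rewrite derivation_lin; apply: P_lin.
  - rewrite -derivation_comm addrC -scaleN1r.
    by apply: P_lin; apply: P_mul.
  - rewrite derivation1 -scalemx1 -[_ *: _]addr0; apply: (P_lin) => //.
    exact: (P_closed0 P_lin P_1).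
rewrite (op_mx_enum A) invariant_symm; last first.
  by move=> a; apply: act_mx_comm.
have PZ := P_closedZ P_lin P_1; have PD := P_closed_sum P_lin P_1.
apply: (PZ); apply: (PD) => f _; apply: (PD) => h _; apply: (PZ).
apply: (symm_mx_closed P_lin P_mul P_1 (@rev_inv_mul r) (@rev_inv1 r) P_der).
  by move=> n; rewrite Num.Theory.pnatr_eq0.
by move=> l; apply: rev_inv_symX.
Qed.
End ClassicalDuality.

(** * Double commutant of a permutation group *)

Section DoubleCommutant.
Variables (n : nat) (G : {group 'S_n}).
Notation Mn := 'M[rat]_n.
Implicit Types (X Y : Mn) (g h : 'S_n).

Definition perm_span : 'M[rat]_(#|G|, n * n) :=
  \matrix_(i < #|G|) mxvec (perm_mx (enum_val i)).

Lemma perm_span_mem g : g \in G -> (mxvec (perm_mx g : Mn) <= perm_span)%MS.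
Proof.
move=> gG; rewrite -(enum_rankK_in gG gG) -(rowK (fun i => mxvec (perm_mx (enum_val i)))).
exact: row_sub.
Qed.

Lemma perm_span_mulr X g : g \in G -> (mxvec X <= perm_span)%MS ->
  (mxvec (X *m perm_mx g) <= perm_span)%MS.
Proof.
move=> gG /submxP[u XE].
have -> : X = \sum_i u 0 i *: perm_mx (enum_val i).
  apply: (can_inj mxvecK); rewrite XE mulmx_sum_row linear_sum.
  by apply: eq_bigr => i _; rewrite rowK linearZ.
rewrite mulmx_suml linear_sum; apply: summx_sub => i _.
rewrite -scalemxAl linearZ -perm_mxM scalemx_sub // perm_span_mem //.
by rewrite groupM // enum_valP.
Qed.

(** Maschke averaging: multiplication by [pinvmx perm_span *m perm_span] lands in the span of G and
    fixes it, and the average over G also commutes with right multiplication by G. *)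
Definition perm_proj X : Mn := #|G|%:R^-1 *: \sum_(g in G)
  vec_mx (mxvec (X *m perm_mx g) *m pinvmx perm_span *m perm_span) *m perm_mx g^-1.

Lemma perm_proj_linear : linear perm_proj.
Proof.
move=> a X Y; rewrite /perm_proj scalerA mulrC -scalerA -scalerDr; congr (_ *: _).
rewrite scaler_sumr -big_split; apply: eq_bigr => g _ /=.
rewrite mulmxDl -scalemxAl linearP /= !mulmxDl -!scalemxAl linearP /=.
by rewrite mulmxDl -scalemxAl.
Qed.
HB.instance Definition _ := GRing.isLinear.Build rat Mn Mn *:%R perm_proj
  perm_proj_linear.

Lemma perm_proj_mem X : (mxvec (perm_proj X) <= perm_span)%MS.
Proof.
rewrite linearZ scalemx_sub // linear_sum summx_sub // => g gG.
by rewrite perm_span_mulr ?groupV // vec_mxK submxMl.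
Qed.

Lemma cardG_neq0 : #|G|%:R != 0 :> rat.
Proof. by rewrite Num.Theory.pnatr_eq0 -lt0n cardG_gt0. Qed.

Lemma perm_proj_id X : (mxvec X <= perm_span)%MS -> perm_proj X = X.
Proof.
move=> XE; rewrite /perm_proj (eq_bigr (fun=> X)) => [|g gG].
  by rewrite sumr_const -scaler_nat scalerA mulVf ?scale1r ?cardG_neq0.
rewrite mulmxKpV ?perm_span_mulr // mxvecK -mulmxA -perm_mxM mulgV perm_mx1.
exact: mulmx1.
Qed.

Lemma perm_proj_mulr X h : h \in G ->
  perm_proj (X *m perm_mx h) = perm_proj X *m perm_mx h.
Proof.
move=> hG; rewrite /perm_proj -scalemxAl; congr (_ *: _).
rewrite mulmx_suml [RHS](reindex_inj (mulgI h)) /=.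
apply: eq_big => [g|g gG]; first by rewrite groupMl.
by rewrite -[LHS]mulmx1 -!mulmxA -!perm_mxM invMg -mulgA mulVg mulg1 mulmx1.
Qed.

(** Reading a matrix as the list of its rows, these are the blocks of the projection: [w] is put in
    row j and row i of the image is taken. *)
Definition coef_op (i j : 'I_n) (w : 'rV[rat]_n) : 'rV[rat]_n :=
  row i (perm_proj (delta_mx j 0 *m w)).

Lemma coef_op_linear i j : linear (coef_op i j).
Proof.
move=> a u w; rewrite /coef_op mulmxDr -scalemxAr perm_proj_linear.
by rewrite linearP.
Qed.
HB.instance Definition _ i j := GRing.isLinear.Build rat 'rV[rat]_n 'rV[rat]_n
  *:%R (coef_op i j) (coef_op_linear i j).

Lemma eq_mulmx_rV X Y : (forall w : 'rV_n, w *m X = w *m Y) -> X = Y.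
Proof. by move=> XY; apply/row_matrixP => i; rewrite !rowE XY. Qed.

(* The entries of a G-equivariant projection onto the span of G commute with  *)
(* G, hence with A, so that the projection fixes A.                           *)
Lemma double_commutant A :
  (forall X, (forall g, g \in G -> X *m perm_mx g = perm_mx g *m X) ->
     A *m X = X *m A) ->
  (mxvec A <= perm_span)%MS.
Proof.
move=> comm; suff <- : perm_proj A = A by apply: perm_proj_mem.
have coef_comm i j : A *m lin1_mx (coef_op i j) = lin1_mx (coef_op i j) *m A.
  apply: comm => g gG; apply: eq_mulmx_rV => w.
  rewrite !mulmxA !mul_rV_lin1 /= /coef_op mulmxA perm_proj_mulr //.
  by rewrite row_mul.
have rowsE X : X = \sum_j delta_mx j 0 *m row j X.
  apply/matrixP => a b; rewrite summxE (bigD1 a) //= big1 => [|c /negbTE ca].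
    by rewrite mxE big_ord1 !mxE !eqxx mul1r addr0.
  by rewrite mxE big_ord1 !mxE (eq_sym a) ca mul0r.
have proj_row X i : row i (perm_proj X) = \sum_j row j X *m lin1_mx (coef_op i j).
  rewrite {1}[X]rowsE !linear_sum; apply: eq_bigr => j _.
  by rewrite mul_rV_lin1.
apply/row_matrixP => i; rewrite proj_row.
(* Writing A as 1 A, the factor A moves through every block of the projection, so the projection of
   A is that of 1 times A; and 1 lies in the span of G. *)
under eq_bigr => j _ do rewrite -[A in row j A]mul1mx row_mul -mulmxA coef_comm mulmxA.
rewrite -mulmx_suml -proj_row perm_proj_id -?row_mul ?mul1mx //.
by rewrite -perm_mx1 perm_span_mem ?group1.
Qed.

End DoubleCommutant.

Lemma double_commutant_closed n (I : Type) (s : I -> 'S_n) (P : 'M[rat]_n -> Prop) :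
  (forall x X Y, P X -> P Y -> P (x *: X + Y)) ->
  (forall X Y, P X -> P Y -> P (X *m Y)) -> P 1%:M ->
  (forall i, P (perm_mx (s i))) ->
  forall A, (forall X, (forall i, X *m perm_mx (s i) = perm_mx (s i) *m X) ->
     A *m X = X *m A) -> P A.
Proof.
move=> P_lin P_mul P_1 P_s A HA.
(* The set of all permutations whose matrices lie in P contains the [s i] and is closed under
   products, which makes it a group because the symmetric group is finite. *)
pose G := [set g : 'S_n | `[< P (perm_mx g) >]]%SET.
have gG : group_set G.
  apply/group_setP; split.
    by rewrite finset.in_set perm_mx1; apply/asboolP.
  move=> g h; rewrite !finset.in_set => /asboolP Pg /asboolP Ph; apply/asboolP.
  by rewrite perm_mxM; apply: P_mul.
have /submxP[u AE] : (mxvec A <= perm_span (Group gG))%MS.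
  apply: double_commutant => X HX; apply: HA => i; apply: HX.
  by rewrite finset.in_set; apply/asboolP.
have -> : A = \sum_i u 0 i *: perm_mx (enum_val i).
  apply: (can_inj mxvecK); rewrite AE mulmx_sum_row linear_sum.
  by apply: eq_bigr => i _; rewrite rowK linearZ.
have P0 : P 0 by rewrite -(addNr 1%:M) -scaleN1r; apply: P_lin.
elim/big_rec: _ => // i X _ PX; apply: P_lin => //.
by have := enum_valP i; rewrite finset.in_set => /asboolP.
Qed.

(** * Double centralizers *)

Section CommutatorMatrix.
Variables (F : fieldType) (n : nat) (C : finType) (X : C -> 'M[F]_n).

Definition ad_mx (Z : 'M[F]_n) : 'M[F]_(n * n) := lin_mulmxr Z - lin_mulmx Z.

(** The matrices [ad_mx (X c)] side by side: the left kernel is the common centralizer of the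
    family. *)
Definition commutator_mx : 'M[F]_(n * n, #|{: C * 'I_(n * n)}|) :=
  \matrix_(i, j) ad_mx (X (enum_val j).1) i (enum_val j).2.

Lemma mul_vec_ad A Z : mxvec A *m ad_mx Z = mxvec (A *m Z - Z *m A).
Proof. by rewrite mulmxBr !mul_vec_lin linearB. Qed.

Lemma mul_commutator_mx p (u : 'M[F]_(p, n * n)) :
  u *m commutator_mx = 0 <-> forall c, u *m ad_mx (X c) = 0.
Proof.
have E i j : (u *m commutator_mx) i j =
    (u *m ad_mx (X (enum_val j).1)) i (enum_val j).2.
  by rewrite !mxE; apply: eq_bigr => l _; rewrite mxE.
split=> [H c|H]; apply/matrixP => i j; last by rewrite E H !mxE.
have /matrixP/(_ i (enum_rank (c, j))) := H.
by rewrite E enum_rankK /= !mxE.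
Qed.

Lemma commutator_mxP A : mxvec A *m commutator_mx = 0 <->
  forall c, A *m X c = X c *m A.
Proof.
rewrite mul_commutator_mx; split=> H c.
  apply/eqP; rewrite -subr_eq0 -(inj_eq (can_inj mxvecK)) -mul_vec_ad H.
  by rewrite linear0.
by rewrite mul_vec_ad H subrr linear0.
Qed.
End CommutatorMatrix.

Section CentralizerDeformation.
Variables (K k : fieldType) (red : K -> k -> Prop) (lift : k -> K).
Hypothesis red_lift : forall c, red (lift c) c.
Hypothesis red_zero : forall c, red 0 c -> c = 0.
Hypothesis red0 : red 0 0.
Hypothesis red1 : red 1 1.
Hypothesis redD : forall x y c d, red x c -> red y d -> red (x + y) (c + d).
Hypothesis redM : forall x y c d, red x c -> red y d -> red (x * y) (c * d).
Hypothesis redN : forall x c, red x c -> red (- x) (- c).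

Lemma red_ad_mx n (X : 'M[K]_n) Y : red_mx red X Y -> red_mx red (ad_mx X) (ad_mx Y).
Proof.
have red_delta i : red_mx red (vec_mx (delta_mx 0 i) : 'M[K]_n) (vec_mx (delta_mx 0 i)).
  by move=> a b; rewrite !mxE; case: (_ && _).
move=> rXY i j; case/mxvec_indexP: j => a b; rewrite !mxE !mxvecE /=.
apply: redD; last apply: redN.
  exact: (red_mulmx red0 redD redM (red_delta i) rXY).
exact: (red_mulmx red0 redD redM rXY (red_delta i)).
Qed.

Variables (n : nat) (C : finType) (X : C -> 'M[K]_n) (Y : C -> 'M[k]_n).
Variable S : 'M[K]_n -> Prop.
Hypothesis red_XY : forall c, red_mx red (X c) (Y c).
Hypothesis S0 : S 0.
Hypothesis S_lin : forall a A B, S A -> S B -> S (a *: A + B).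
Hypothesis S_comm : forall A c, S A -> A *m X c = X c *m A.
Hypothesis S_red : forall B, (forall c, B *m Y c = Y c *m B) ->
  exists2 A, S A & red_mx red A B.

(** A spanning family of the centralizer at the limit lifts to elements of S, which commute with
    every X. By semicontinuity of rank ([kermx_deform]) these lifts already span the centralizer of
    X. *)
Lemma centralizer_deform A : (forall c, A *m X c = X c *m A) -> S A.
Proof.
move=> AX; pose B' := kermx (commutator_mx Y).
have rowE i : exists A : 'M[K]_n, S A /\ red_mx red A (vec_mx (row i B')).
  have [c|Z SZ rZ] := S_red (B := vec_mx (row i B')); last by exists Z.
  move: c; apply/commutator_mxP; rewrite vec_mxK.
  by apply/sub_kermxP; exact: row_sub.
have [Z ZP] := choice rowE.
pose R : 'M[K]_(n * n) := \matrix_i mxvec (Z i).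
have : (kermx (commutator_mx X) <= R)%MS.
  apply: (kermx_deform red_lift red_zero red0 red1 redD redM redN (B' := commutator_mx Y)).
  - move=> i j; have := red_ad_mx (red_XY (enum_val j).1) i (enum_val j).2.
    by rewrite !mxE.
  - move=> i j; have [_ rZ] := ZP i; case/mxvec_indexP: j => a b.
    by rewrite mxE mxvecE; have := rZ a b; rewrite !mxE.
  apply/row_matrixP => i; rewrite row_mul rowK row0.
  by apply/commutator_mxP => c; apply: S_comm; have [] := ZP i.
move=> KR.
have /submxP[u AE] : (mxvec A <= R)%MS.
  by apply: submx_trans KR; apply/sub_kermxP/commutator_mxP.
have -> : A = \sum_i u 0 i *: Z i.
  apply: (can_inj mxvecK); rewrite AE mulmx_sum_row linear_sum.
  by apply: eq_bigr => i _; rewrite rowK linearZ.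
elim/big_rec: _ => // i W _ SW; apply: S_lin => //.
by have [] := ZP i.
Qed.
End CentralizerDeformation.

Section OperatorMatrices.
Variable T : finType.
Notation W := {ffun T -> Qq^o}.

(** Operators act on row vectors from the right, so composition is reversed: the right Hecke action
    becomes multiplicative. *)
Definition lin_mx_of (A : W -> W) : 'M[Qq]_#|T| :=
  \matrix_(i, j) coord_at (A (bvec (enum_val i))) (enum_val j).

Definition vec_of (w : W) : 'rV[Qq]_#|T| := \row_j coord_at w (enum_val j).

Lemma vec_of_inj : injective vec_of.
Proof.
move=> u w /matrixP uw; apply: coord_atP => y.
by have := uw 0 (enum_rank y); rewrite !mxE enum_rankK.
Qed.

Lemma lin_mx_ofP (A : W -> W) w : linear A -> vec_of (A w) = vec_of w *m lin_mx_of A.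
Proof.
move=> Al; apply/matrixP => i j; rewrite !mxE (linear_sum_bvec Al) /coord_at sum_ffunE.
rewrite (reindex _ (onW_bij _ (@enum_val_bij T))) /=.
by apply: eq_bigr => l _; rewrite !mxE ffunE.
Qed.

Lemma row_lin_mx_of (A : W -> W) i : row i (lin_mx_of A) = vec_of (A (bvec (enum_val i))).
Proof. by apply/matrixP => a b; rewrite !mxE. Qed.

Lemma lin_mx_of_comp (A B : W -> W) : linear A -> linear B ->
  lin_mx_of (fun w => A (B w)) = lin_mx_of B *m lin_mx_of A.
Proof.
by move=> Al Bl; apply/row_matrixP => i; rewrite row_mul !row_lin_mx_of lin_mx_ofP.
Qed.

Lemma lin_mx_of_inj (A B : W -> W) : linear A -> linear B ->
  lin_mx_of A = lin_mx_of B -> A =1 B.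
Proof. by move=> Al Bl AB w; apply: vec_of_inj; rewrite !lin_mx_ofP // AB. Qed.

Lemma eq_lin_mx_of (A B : W -> W) : A =1 B -> lin_mx_of A = lin_mx_of B.
Proof. by move=> AB; apply/matrixP => i j; rewrite !mxE AB. Qed.

Lemma lin_mx_of_lin a (A B : W -> W) :
  lin_mx_of (fun w => a *: A w + B w) = a *: lin_mx_of A + lin_mx_of B.
Proof. by apply/matrixP => i j; rewrite !mxE coord_atD coord_atZ. Qed.

Lemma lin_mx_of_id : lin_mx_of id = 1%:M.
Proof.
by apply/matrixP => i j; rewrite !mxE /coord_at ffunE (inj_eq enum_val_inj) eq_sym.
Qed.

End OperatorMatrices.

(** * Limits of the generators at q = 1 *)

Section Reduction.
Variable r : nat.
Notation red := (red_mx red1q).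

Lemma red1q_bool (b : bool) : red1q b%:R b%:R.
Proof. by case: b; [exact: red1q_1|exact: red1q_0]. Qed.

Lemma red1q_bvec (T : finType) (x y : T) :
  red1q (coord_at (bvec x : {ffun T -> Qq^o}) y) (y == x)%:R.
Proof. by rewrite /coord_at ffunE; exact: red1q_bool. Qed.

Lemma red1q_qVB : red1q (q^-1 - q) 0.
Proof. by rewrite -(subrr 1); apply: red1q_D red1q_V (red1q_N red1q_q). Qed.

(** The coefficient q^-1 - q vanishes and q^-1 becomes 1 in the limit; for equal neighbouring
    entries the permutation fixes f, in agreement with the diagonal rule. *)
Lemma red_Hgen m (a : 'I_m) : red (lin_mx_of (@Hgen m r a)) (@act_mx r m a).
Proof.
move=> i j; rewrite !mxE; set f := enum_val i; set h := enum_val j.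
rewrite [Hgen a _]lin_ext_bvec.
have b0 := @red1q_bvec (Im r m).
have Bcase : red1q (coord_at (M (act_s f a) + (q^-1 - q) *: M f) h) (h == act_s f a)%:R.
  rewrite coord_atD coord_atZ -[X in red1q _ X]addr0; apply: red1q_D (b0 _ _) _.
  by rewrite -[X in red1q _ X](mul0r (h == f)%:R); apply: red1q_M red1q_qVB (b0 _ _).
case: (posnP a) => [a0|a0].
  by case: ifP => _; [exact: b0|exact: Bcase].
case: eqP => [fa|_]; last first.
  by case: ifP => _; [exact: b0|exact: Bcase].
have -> : act_s f a = f.
  rewrite act_s_permute //; apply/ffunP => l; rewrite ffunE.
  by case: tpermP => [->|->|].
rewrite coord_atZ -[X in red1q _ X]mul1r; apply: red1q_M red1q_V (b0 _ _).
Qed.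

Definition der_kernel m (x : 'M[rat]_(r.*2.+2)) (f h : Im r m) : rat :=
  \sum_j \prod_l upd (fun=> 1%:M) j x l (f l) (h l).

Lemma derivation_kernel m x : derivation m x = op_mx (@der_kernel m x).
Proof. by apply/matrixP => i j; rewrite summxE !mxE; apply: eq_bigr => l _; rewrite mxE. Qed.

Lemma prod_eq_bool m (f h : Im r m) : \prod_l ((f l == h l)%:R : rat) = (f == h)%:R.
Proof.
rewrite prod_nat_bool; congr ((nat_of_bool _)%:R); apply/forallP/eqP => [H|-> //].
by apply/ffunP => l; apply/eqP/H.
Qed.

(** The Leibniz rule on the first factor and the tail. It is the limit of the coproducts of E and F,
    whose group-like legs tend to the identity. *)
Lemma der_kernel_rec m x (f h : Im r m.+1) : der_kernel x f h =
  x (f ord0) (h ord0) * (ftail f == ftail h)%:R +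
  (f ord0 == h ord0)%:R * der_kernel x (ftail f) (ftail h).
Proof.
rewrite /der_kernel big_ord_recl; congr (_ + _).
  rewrite big_ord_recl /upd eqxx -prod_eq_bool; congr (_ * _).
  by apply: eq_bigr => l _; rewrite !mxE !ffunE.
rewrite mulr_sumr; apply: eq_bigr => j _; rewrite big_ord_recl /upd.
rewrite (negbTE (neq_lift _ _)) mxE; congr (_ * _).
by apply: eq_bigr => l _; rewrite (inj_eq lift_inj) !ffunE.
Qed.

Lemma coord_at_pure m (x : V r) (w : Vt r m) h :
  coord_at (pure_tensor x w) h = coord_at x (h ord0) * coord_at w (ftail h).
Proof. by rewrite /coord_at ffunE. Qed.

Definition red_op m (A : Vt r m -> Vt r m) (g : Im r m -> Im r m -> rat) :=
  forall f h, red1q (coord_at (A (M f)) h) (g f h).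

Lemma red_op_mx m A g : @red_op m A g -> red (lin_mx_of A) (op_mx g).
Proof. by move=> H i j; rewrite !mxE; apply: H. Qed.

Lemma red_VgenK i (a b : Ihalf r) : red1q (coord_at (Vgen (gK i) (v a)) b) (a == b)%:R.
Proof.
rewrite VgenK coord_atZ -[X in red1q _ X]mul1r eq_sym.
exact: red1q_M (red1q_expz _) (red1q_bvec _ _).
Qed.
Lemma red_VgenV i (a b : Ihalf r) : red1q (coord_at (Vgen (gKinv i) (v a)) b) (a == b)%:R.
Proof.
rewrite VgenV coord_atZ -[X in red1q _ X]mul1r eq_sym.
exact: red1q_M (red1q_expz _) (red1q_bvec _ _).
Qed.
Lemma red_VgenE i (a b : Ihalf r) :
  red1q (coord_at (Vgen (gE i) (v a)) b) (delta_mx (up i) (dn i) a b).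
Proof.
rewrite VgenE mxE; case: eqP => _; first exact: red1q_bvec.
by rewrite coord_at0; exact: red1q_0.
Qed.
Lemma red_VgenF i (a b : Ihalf r) :
  red1q (coord_at (Vgen (gF i) (v a)) b) (delta_mx (dn i) (up i) a b).
Proof.
rewrite VgenF mxE; case: eqP => _; first exact: red1q_bvec.
by rewrite coord_at0; exact: red1q_0.
Qed.

Lemma eq_head_tail m (f h : Im r m.+1) : (f == h)%:R =
  (f ord0 == h ord0)%:R * (ftail f == ftail h)%:R :> rat.
Proof.
rewrite -natrM mulnb; congr ((nat_of_bool _)%:R).
apply/eqP/andP => [-> //|[/eqP E1 /eqP E2]].
by rewrite -(fcons_eta f) -(fcons_eta h) E1 E2.
Qed.

Lemma red_VtgenV m i : red_op (@Vtgen r m (gKinv i)) (fun f h => (f == h)%:R).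
Proof.
elim: m => [|m IHm] f h.
  by rewrite [Vtgen _ _]scale1r eq_sym; exact: red1q_bvec.
rewrite M_eta VtgenV coord_at_pure eq_head_tail.
exact: red1q_M (red_VgenV _ _ _) (IHm _ _).
Qed.

Lemma der_kernel0 x (f h : Im r 0) : der_kernel x f h = 0.
Proof. by rewrite /der_kernel big_ord0. Qed.

Lemma red_VtgenE m i :
  red_op (@Vtgen r m (gE i)) (der_kernel (delta_mx (up i) (dn i))).
Proof.
elim: m => [|m IHm] f h.
  by rewrite [Vtgen _ _]scale0r coord_at0 der_kernel0; exact: red1q_0.
rewrite M_eta VtgenE coord_atD !coord_at_pure der_kernel_rec [X in red1q _ X]addrC.
apply: red1q_D; apply: red1q_M.
- by rewrite eq_sym; exact: red1q_bvec.
- exact: IHm.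
- exact: red_VgenE.
- exact: red_VtgenV.
Qed.

Lemma red_VtgenF m i :
  red_op (@Vtgen r m (gF i)) (der_kernel (delta_mx (dn i) (up i))).
Proof.
elim: m => [|m IHm] f h.
  by rewrite [Vtgen _ _]scale0r coord_at0 der_kernel0; exact: red1q_0.
rewrite M_eta VtgenF coord_atD !coord_at_pure der_kernel_rec.
apply: red1q_D; apply: red1q_M.
- exact: red_VgenF.
- by rewrite eq_sym; exact: red1q_bvec.
- exact: red_VgenK.
- exact: IHm.
Qed.

Variable m : nat.
Notation mxV g := (lin_mx_of (@Vtgen r m g)).
Let Vl g : linear (@Vtgen r m g) := Vtgen_linear g.

Lemma redV i : red (mxV (gKinv i)) 1%:M.
Proof. by rewrite -op_mx1; apply: red_op_mx; exact: red_VtgenV. Qed.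
Lemma redE i : red (mxV (gE i)) (derivation m (delta_mx (up i) (dn i))).
Proof. by rewrite derivation_kernel; apply: red_op_mx; exact: red_VtgenE. Qed.
Lemma redF i : red (mxV (gF i)) (derivation m (delta_mx (dn i) (up i))).
Proof. by rewrite derivation_kernel; apply: red_op_mx; exact: red_VtgenF. Qed.

Lemma redM p (A B : 'M_p) A' B' : red A A' -> red B B' -> red (A *m B) (A' *m B').
Proof. exact: (red_mulmx red1q_0 red1q_D red1q_M). Qed.
Lemma redD p (A B : 'M_p) A' B' : red A A' -> red B B' -> red (A + B) (A' + B').
Proof. exact: (red_addmx red1q_D). Qed.
Lemma redZ p x c (A : 'M_p) A' : red1q x c -> red A A' -> red (x *: A) (c *: A').
Proof. by move=> rx rA i j; rewrite !mxE; apply: red1q_M. Qed.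

Lemma derivationD (A B : 'M[rat]_(r.*2.+2)) :
  derivation m (A + B) = derivation m A + derivation m B.
Proof. by have := derivation_lin m 1 A B; rewrite !scale1r. Qed.

Lemma lin_mx_of_add (A B : Vt r m -> Vt r m) :
  lin_mx_of (fun w => A w + B w) = lin_mx_of A + lin_mx_of B.
Proof. by apply/matrixP => i j; rewrite !mxE coord_atD. Qed.
Lemma lin_mx_of_scale a (A : Vt r m -> Vt r m) :
  lin_mx_of (fun w => a *: A w) = a *: lin_mx_of A.
Proof. by apply/matrixP => i j; rewrite !mxE coord_atZ. Qed.

Notation mxU u := (lin_mx_of (@Vtact r m u)).

Lemma red_ie (i : 'I_r) : red (mxU (ie i))
  (derivation m (symX (up (ipos i)) (dn (ipos i)))).
Proof.
rewrite (eq_lin_mx_of (@Vtact_ie r m i)) lin_mx_of_add.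
rewrite (lin_mx_of_comp (Vl (gKinv _)) (Vl (gF _))).
rewrite /symX derivationD; apply: redD; first exact: redE.
rewrite -dn_ineg -up_ineg -[X in red _ X]mulmx1; apply: redM; [exact: redF|exact: redV].
Qed.

Lemma red_if (i : 'I_r) : red (mxU (if_ i))
  (derivation m (symX (dn (ipos i)) (up (ipos i)))).
Proof.
rewrite (eq_lin_mx_of (@Vtact_if r m i)) lin_mx_of_add.
rewrite (lin_mx_of_comp (Vl (gF _)) (Vl (gKinv _))).
rewrite /symX derivationD; apply: redD; last by rewrite -dn_ineg -up_ineg; exact: redE.
rewrite -[X in red _ X]mul1mx; apply: redM; [exact: redV|exact: redF].
Qed.

(** The summand K_0^-1 of t tends to the identity, whence the scalar next to the derivation. *)
Lemma red_it : red (mxU (it r))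
  (derivation m (symX (dn (i0 r)) (up (i0 r))) + 1%:M).
Proof.
rewrite (eq_lin_mx_of (@Vtact_it r m)) lin_mx_of_add; apply: redD; last exact: redV.
rewrite lin_mx_of_add lin_mx_of_scale (lin_mx_of_comp (Vl (gF _)) (Vl (gKinv _))).
rewrite /symX rev_up_i0 rev_dn_i0 [delta_mx _ _ + _]addrC derivationD.
apply: redD; first exact: redE.
rewrite -[X in red _ X]scale1r -[derivation _ _]mul1mx.
apply: redZ; first exact: red1q_q.
by apply: redM; [exact: redV|exact: redF].
Qed.

End Reduction.

(** * The two images, their limits and their centralizers *)

Section Duality.
Variables r m : nat.
Notation red := (red_mx red1q).
Notation T := (Im r m.+1).
Notation mxU u := (lin_mx_of (@Vtact r m.+1 u)).
Notation actm a := (@act_mx r m.+1 a).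
Notation mxH h := (lin_mx_of (fun w : Vt r m.+1 => Hact w h)).

Definition S_U (A : 'M[Qq]_#|{: T}|) := exists2 u : U r, Uiota u & A = mxU u.
Definition S_H (A : 'M[Qq]_#|{: T}|) := exists h : HeckeB m.+1, A = mxH h.

Definition uiota_gen (c : option ('I_r * bool)) : U r :=
  if c is Some (i, b) then if b then ie i else if_ i else it r.

Lemma Uiota_gen c : Uiota (uiota_gen c).
Proof.
apply: subalg_in; case: c => [[i []]|] /=; [right; exists i|right; exists i|by left].
  by apply: Or41.
by apply: Or42.
Qed.

Definition lim_gen (c : option ('I_r * bool)) : 'M[rat]_#|{: T}| :=
  if c is Some (i, b) then
    derivation m.+1 (if b then symX (up (ipos i)) (dn (ipos i))
                     else symX (dn (ipos i)) (up (ipos i)))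
  else derivation m.+1 (symX (dn (i0 r)) (up (i0 r))) + 1%:M.

Lemma red_gen c : red (mxU (uiota_gen c)) (lim_gen c).
Proof.
case: c => [[i []]|]; [exact: red_ie|exact: red_if|exact: red_it].
Qed.

Lemma S_U_scalar c : S_U c%:M.
Proof.
exists c%:A; first exact: subalg_scalar.
rewrite -scalemx1 -lin_mx_of_id -lin_mx_of_scale; apply: eq_lin_mx_of => w.
by rewrite Vtact_scale Vtact_one.
Qed.
Lemma S_U_mul A B : S_U A -> S_U B -> S_U (A *m B).
Proof.
move=> [u Uu ->] [u' Uu' ->]; exists (u' * u); first exact: subalg_mul.
rewrite -(lin_mx_of_comp (Vtact_linear u') (Vtact_linear u)).
by apply: eq_lin_mx_of => w; rewrite Vtact_mul.
Qed.
Lemma S_U_add A B : S_U A -> S_U B -> S_U (A + B).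
Proof.
move=> [u Uu ->] [u' Uu' ->]; exists (u + u'); first exact: subalg_add.
by rewrite -lin_mx_of_add; apply: eq_lin_mx_of => w; rewrite Vtact_add.
Qed.
Lemma S_U_lin a A B : S_U A -> S_U B -> S_U (a *: A + B).
Proof.
move=> SA SB; apply: S_U_add => //; rewrite -mul_scalar_mx.
exact: S_U_mul (S_U_scalar a) SA.
Qed.
Lemma S_U_0 : S_U 0.
Proof. by rewrite -(scale0r 1%:M) scalemx1; exact: S_U_scalar. Qed.

Lemma S_H_1 : S_H 1%:M.
Proof.
exists 1; rewrite -lin_mx_of_id; apply: eq_lin_mx_of => w.
by rewrite Hact_one.
Qed.
Lemma S_H_mul A B : S_H A -> S_H B -> S_H (A *m B).
Proof.
move=> [h ->] [h' ->]; exists (h * h').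
rewrite -(lin_mx_of_comp (@Hact_linear r _ h') (@Hact_linear r _ h)).
by apply: eq_lin_mx_of => w; rewrite Hact_mul.
Qed.
Lemma S_H_lin a A B : S_H A -> S_H B -> S_H (a *: A + B).
Proof.
move=> [h ->] [h' ->]; exists (a *: h + h').
rewrite -lin_mx_of_lin; apply: eq_lin_mx_of => w.
by rewrite Hact_add Hact_scale.
Qed.
Lemma S_H_0 : S_H 0.
Proof.
have /(S_H_lin (-1) S_H_1) := S_H_1.
by rewrite scaleN1r addNr.
Qed.
Lemma S_H_gen a : S_H (lin_mx_of (@Hgen m.+1 r a)).
Proof.
exists (Defs.H a); apply: eq_lin_mx_of => w.
by rewrite Hact_gen.
Qed.

Lemma S_U_H_comm A B : S_U A -> S_H B -> A *m B = B *m A.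
Proof.
move=> [u Uu ->] [h ->].
rewrite -(lin_mx_of_comp (@Hact_linear r _ h) (Vtact_linear u)).
rewrite -(lin_mx_of_comp (Vtact_linear u) (@Hact_linear r _ h)).
by apply: eq_lin_mx_of => w; rewrite Hact_Vtact.
Qed.

Definition limit_of (S : 'M[Qq]_#|{: T}| -> Prop) (B : 'M[rat]_#|{: T}|) :=
  exists2 A, S A & red A B.

Lemma limit_lin S : (forall a A B, S A -> S B -> S (a *: A + B)) ->
  forall x X Y, limit_of S X -> limit_of S Y -> limit_of S (x *: X + Y).
Proof.
move=> Slin x X Y [A SA rA] [B SB rB]; exists (tofrac x%:P *: A + B).
  exact: Slin.
by apply: redD => //; apply: redZ => //; exact: red1q_lift.
Qed.
Lemma limit_mul S : (forall A B, S A -> S B -> S (A *m B)) ->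
  forall X Y, limit_of S X -> limit_of S Y -> limit_of S (X *m Y).
Proof.
move=> Smul X Y [A SA rA] [B SB rB]; exists (A *m B); first exact: Smul.
exact: redM.
Qed.
Lemma limit_1 (S : _ -> Prop) : S 1%:M -> limit_of S 1%:M.
Proof. by move=> S1; exists 1%:M => // i j; rewrite !mxE; exact: red1q_bool. Qed.

Lemma Iint_cases (R : Iint r -> Prop) : R (i0 r) ->
  (forall i : 'I_r, R (ipos i)) -> (forall i : 'I_r, R (ineg i)) -> forall i, R i.
Proof.
move=> R0 Rp Rn i; have ir := ltn_ord i.
have [ri|ri|ri] := ltngtP i r.
- have j : (r - i.+1 < r)%N by lia.
  have -> : i = ineg (Ordinal j) by apply/val_inj; rewrite [RHS]inegE /=; lia.
  exact: Rn.
- have j : (i - r.+1 < r)%N by lia.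
  have -> : i = ipos (Ordinal j) by apply/val_inj; rewrite [RHS]iposE /=; lia.
  exact: Rp.
by have -> : i = i0 r by apply/val_inj; rewrite [RHS]i0E.
Qed.

(* The limits of t, e_i and f_i are, up to the scalar in t, the derivations   *)
(* attached to the generators of the centralizer of the sign flip.            *)
Lemma lim_gen_generation (P : 'M[rat]_#|{: T}| -> Prop) :
  (forall x X Y, P X -> P Y -> P (x *: X + Y)) ->
  (forall X Y, P X -> P Y -> P (X *m Y)) -> P 1%:M ->
  (forall c, P (lim_gen c)) ->
  forall A, (forall a, A *m actm a = actm a *m A) -> P A.
Proof.
move=> P_lin P_mul P_1 P_gen; apply: classical_generation => //.
elim/Iint_cases => [|i|i].
- have := P_lin (-1) _ _ P_1 (P_gen None).
  by rewrite scaleN1r addrC addrK.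
- exact: (P_gen (Some (i, false))).
- rewrite dn_ineg up_ineg symX_rev; exact: (P_gen (Some (i, true))).
Qed.

Definition act_index (a : 'I_m.+1) (i : 'I_#|{: T}|) : 'I_#|{: T}| :=
  enum_rank (act_s (enum_val i : T) a).

Lemma act_indexK a : involutive (act_index a).
Proof. by move=> i; rewrite /act_index enum_rankK act_sK enum_valK. Qed.

Definition act_perm a : 'S_#|{: T}| := perm (inv_inj (act_indexK a)).

Lemma perm_mx_act a : perm_mx (act_perm a) = actm a.
Proof.
apply/matrixP => i j; rewrite !mxE permE; congr ((nat_of_bool _)%:R).
by rewrite /act_index -(inj_eq enum_val_inj) enum_rankK eq_sym.
Qed.

(** Limits of the image form an algebra containing the limits of t, e_i and f_i, so
    [lim_gen_generation] applies. *)
Lemma S_U_limit B : (forall a, B *m actm a = actm a *m B) -> limit_of S_U B.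
Proof.
apply: lim_gen_generation.
- exact: (limit_lin S_U_lin).
- exact: (limit_mul S_U_mul).
- exact: (limit_1 (S_U_scalar 1)).
move=> c; exists (mxU (uiota_gen c)); last exact: red_gen.
by exists (uiota_gen c) => //; exact: Uiota_gen.
Qed.

(** Limits of the Hecke image form an algebra containing the permutation operators of the
    [act_perm a]. It therefore suffices that B lies in the double commutant of these. *)
Lemma S_H_limit B : (forall c, B *m lim_gen c = lim_gen c *m B) -> limit_of S_H B.
Proof.
move=> HB; apply: (double_commutant_closed (s := act_perm)).
- exact: (limit_lin S_H_lin).
- exact: (limit_mul S_H_mul).
- exact: (limit_1 S_H_1).
- move=> a; rewrite perm_mx_act; exists (lin_mx_of (@Hgen m.+1 r a)).
    exact: S_H_gen.
  exact: red_Hgen.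
(* The generation result is applied to the property of commuting with B: it holds for the limit
   generators, hence for everything that commutes with the signed permutations. *)
move=> X HX; apply: (lim_gen_generation (P := fun X => B *m X = X *m B)) => //.
- by move=> x Y Z HY HZ; rewrite mulmxDr mulmxDl -scalemxAr -scalemxAl HY HZ.
- by move=> Y Z HY HZ; rewrite mulmxA HY -mulmxA HZ mulmxA.
- by rewrite mulmx1 mul1mx.
- by move=> a; have := HX a; rewrite perm_mx_act.
Qed.

Lemma S_U_centralizer A :
  (forall a, A *m lin_mx_of (@Hgen m.+1 r a) = lin_mx_of (@Hgen m.+1 r a) *m A) ->
  S_U A.
Proof.
apply: (centralizer_deform red1q_lift red1q_zero red1q_0 red1q_1 red1q_D red1q_M
  red1q_N (Y := fun a => actm a)).
- by move=> a; apply: red_Hgen.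
- exact: S_U_0.
- exact: S_U_lin.
- by move=> B a SB; apply: S_U_H_comm => //; exact: S_H_gen.
- exact: S_U_limit.
Qed.

Lemma S_H_centralizer A :
  (forall c, A *m mxU (uiota_gen c) = mxU (uiota_gen c) *m A) -> S_H A.
Proof.
apply: (centralizer_deform red1q_lift red1q_zero red1q_0 red1q_1 red1q_D red1q_M
  red1q_N (Y := lim_gen)).
- exact: red_gen.
- exact: S_H_0.
- exact: S_H_lin.
- move=> B c SB; rewrite (S_U_H_comm _ SB) //.
  by exists (uiota_gen c) => //; exact: Uiota_gen.
- exact: S_H_limit.
Qed.

Lemma Uiota_double_centralizer (phi : {linear Vt r m.+1 -> Vt r m.+1}) :
  (exists2 u : U r, Uiota u & forall w, phi w = Vtact u w) <->
  (forall (h : HeckeB m.+1) w, phi (Hact w h) = Hact (phi w) h).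
Proof.
have pl : linear phi by exact: linearP.
split=> [[u Uu phiE] h w|H].
  by rewrite !phiE Hact_Vtact.
have [|u Uu E] := @S_U_centralizer (lin_mx_of phi).
  move=> a; have Hl := @Hgen_linear r m.+1 a.
  rewrite -(lin_mx_of_comp pl Hl) -(lin_mx_of_comp Hl pl).
  by apply: eq_lin_mx_of => w; rewrite -!Hact_gen H.
by exists u => //; apply: lin_mx_of_inj => //; exact: Vtact_linear.
Qed.

Lemma Hecke_double_centralizer (phi : {linear Vt r m.+1 -> Vt r m.+1}) :
  (exists h : HeckeB m.+1, forall w, phi w = Hact w h) <->
  (forall (u : U r) w, Uiota u -> phi (Vtact u w) = Vtact u (phi w)).
Proof.
have pl : linear phi by exact: linearP.
split=> [[h phiE] u w Uu|H].
  by rewrite !phiE Hact_Vtact.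
have [|h E] := @S_H_centralizer (lin_mx_of phi).
  move=> c; have Vl := Vtact_linear (m := m.+1) (uiota_gen c).
  rewrite -(lin_mx_of_comp pl Vl) -(lin_mx_of_comp Vl pl).
  by apply: eq_lin_mx_of => w; rewrite H //; exact: Uiota_gen.
by exists h; apply: lin_mx_of_inj => //; exact: Hact_linear.
Qed.

End Duality.

(** * The operator T on V *)

Lemma ltn_sum2 (I : finType) (f g : I -> I -> nat) a b :
  (forall x y, f x y <= g x y)%N -> (f a b < g a b)%N ->
  (\sum_x \sum_y f x y < \sum_x \sum_y g x y)%N.
Proof.
move=> le lt; rewrite (bigD1 a) //= [X in (_ < X)%N](bigD1 a) //= -addSn leq_add //.
  rewrite (bigD1 b) //= [X in (_ < X)%N](bigD1 b) //= -addSn leq_add //.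
  exact: leq_sum.
by apply: leq_sum => x _; apply: leq_sum.
Qed.

(** * Reduced words of the longest element *)

Section ReducedWords.
Variable r : nat.
Notation I := (Ihalf r).
Implicit Types (i : Iint r) (k j : I) (s : seq (Iint r)) (w : {perm I}).

Definition adj i : {perm I} := tperm (dn i) (up i).

(** The inversions of [f] in which k is the smaller index; their sum over k is the length of a
    permutation. *)
Definition inv_at (f : I -> I) k : nat := \sum_(j : I) ((k < j) && (f j < f k))%N.

Lemma adjE i k : adj i k =
  (if k == i :> nat then i.+1 else if k == i.+1 :> nat then i : nat else k) :> nat.
Proof.
rewrite -upE -(dnE i) /adj; case: tpermP => [->|->|/eqP k1 /eqP k2].
- by rewrite eqxx.
- rewrite eqxx ifF //; apply/negbTE; rewrite upE dnE; lia.
- by rewrite ifF ?ifF //; apply/negbTE.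
Qed.

Lemma adj_lt i k j : ~~ ((k == dn i) && (j == up i)) ->
  (k < j)%N -> (adj i k < adj i j)%N.
Proof.
have dE (a : I) : (a == dn i) = (a == i :> nat) by [].
have uE (a : I) : (a == up i) = (a == i.+1 :> nat) by rewrite -upE.
by rewrite dE uE !adjE; do ![case: eqP => ? /=]; lia.
Qed.

Lemma adjK i : involutive (adj i).
Proof. exact: tpermK. Qed.

(** The number of times the strand starting at k moves up when the letters are applied from the
    right, the order in which [Tword] composes. These are the moves that cost a factor -q. *)
Fixpoint word_up s k : nat :=
  if s is i :: s' then
    (word_up s' k + ((word_perm s')^-1%g k == dn i))%N
  else 0%N.

Lemma word_perm_cons i s : word_perm (i :: s) = (adj i * word_perm s)%g.
Proof. by rewrite /word_perm big_cons. Qed.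

Lemma word_perm_inv_cons i s k :
  (word_perm (i :: s))^-1%g k = adj i ((word_perm s)^-1%g k).
Proof. by rewrite word_perm_cons invMg permM tpermV. Qed.

(* A strand that gets inverted with a higher one has to cross it upwards.     *)
Lemma inv_at_le_up s k : (inv_at ((word_perm s)^-1%g : {perm I}) k <= word_up s k)%N.
Proof.
elim: s => [|i s IHs] /=.
  rewrite /inv_at big1 // => j _; rewrite /word_perm big_nil invg1 !perm1.
  by case: ltngtP.
apply: leq_trans (leq_add IHs (leqnn _)); rewrite /inv_at.
set rho := ((word_perm s)^-1)%g.
have -> : ((rho k == dn i) : nat) = (\sum_(j : I) ((rho k == dn i) && (rho j == up i)))%N.
  rewrite (bigD1 (rho^-1 (up i))%g) //= permKV eqxx andbT big1 ?addn0 // => j /eqP jn.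
  case: eqP => // _; case: eqP => // rj; case: jn.
  by rewrite -rj permK.
rewrite -big_split leq_sum // => j _ /=; rewrite !word_perm_inv_cons -/rho.
case: (k < j)%N => //=.
have [_|ne] := boolP ((rho k == dn i) && (rho j == up i)).
  by rewrite addn1; case: (_ < _)%N.
rewrite addn0; case: (ltnP (rho j) (rho k)) => [_|]; first by case: (_ < _)%N.
rewrite leq_eqVlt => /orP[/eqP E|lt].
  by rewrite (_ : rho k = rho j) ?ltnn //; apply/val_inj.
by rewrite ltnNge (ltnW (adj_lt ne lt)).
Qed.

(** Every letter moves exactly one strand up. *)
Lemma sum_word_up s : (\sum_(k : I) word_up s k = size s)%N.
Proof.
elim: s => [|i s IHs] /=; first by rewrite big1.
rewrite big_split /= IHs; set rho := ((word_perm s)^-1)%g.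
rewrite (bigD1 (rho^-1 (dn i))%g) //= permKV eqxx big1 ?addn0 ?addn1 // => k /eqP kn.
by case: eqP => // rk; case: kn; rewrite -rk permK.
Qed.

(** An increasing map satisfies w k >= k, and the values of a permutation have the same sum as the
    indices, so equality holds everywhere. *)
Lemma increasing_perm w : (forall i, (w (dn i) < w (up i))%N) -> w = 1%g.
Proof.
move=> inc.
have ge k : (k <= w k)%N.
  have [n] := ubnP (k : nat); elim: n k => // n IHn k kn.
  have [k0|k0] := posnP k; first by rewrite k0.
  have kN : (k.-1 < r.*2.+1)%N by have := ltn_ord k; lia.
  have kE : k = up (Ordinal kN) by apply/val_inj; rewrite [RHS]upE /=; lia.
  have := IHn (dn (Ordinal kN)); rewrite dnE /= => /(_ _) H.
  have := inc (Ordinal kN); rewrite -kE; have := H _; lia.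
apply/permP => k; rewrite perm1; apply/val_inj/eqP; rewrite eqn_leq ge andbT.
have : (\sum_(k : I) w k = \sum_(k : I) k)%N by rewrite [RHS](reindex_inj (@perm_inj _ w)).
rewrite (bigD1 k) //= [RHS](bigD1 k) //= => E.
rewrite -(leq_add2r (\sum_(j | j != k) w j)) E leq_add2l.
by apply: leq_sum => j _; apply: ge.
Qed.

(** Bubble sort: at a descent, composing with the adjacent transposition maps the remaining
    inversions injectively into the old ones and loses the pair at the descent. *)
Lemma short_word w : exists2 s, word_perm s = w & (size s <= \sum_(k : I) inv_at w k)%N.
Proof.
have [n] := ubnP (\sum_(k : I) inv_at w k)%N; elim: n w => // n IHn w wn.
have [/existsP[i iw]|/existsPn inc] :=
  boolP [exists i, (w (up i) < w (dn i))%N]; last first.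
  exists [::] => //; rewrite /word_perm big_nil; apply/esym/increasing_perm => i.
  have := inc i; rewrite -leqNgt leq_eqVlt => /orP[/eqP E|//].
  have /perm_inj/eqP : w (dn i) = w (up i) by exact: val_inj.
  by rewrite dn_up.
set w' := (adj i * w)%g.
have lt : (\sum_(k : I) inv_at w' k < \sum_(k : I) inv_at w k)%N.
  rewrite /inv_at [X in (X < _)%N](reindex_inj (@perm_inj _ (adj i))) /=.
  under [X in (X < _)%N]eq_bigr do rewrite (reindex_inj (@perm_inj _ (adj i))) /=.
  have le (k j : I) :
      (nat_of_bool ((adj i k < adj i j) && (w' (adj i j) < w' (adj i k))) <=
       nat_of_bool ((k < j) && (w j < w k)))%N.
    rewrite !permM !adjK; have [kj|jk|/val_inj ->] := ltngtP k j.
    - by case: (_ < _)%N.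
    - have [/andP[/eqP -> /eqP ->]|ne] := boolP ((j == dn i) && (k == up i)).
        by rewrite [(w (dn i) < _)%N]ltnNge (ltnW iw) andbF.
      by rewrite [X in X && _]ltnNge (ltnW (adj_lt ne jk)).
    - by rewrite ltnn.
  apply: (ltn_sum2 (a := dn i) (b := up i)) => //.
  rewrite !permM !adjK iw upE dnE ltnSn /adj tpermL tpermR upE dnE.
  by have -> : (i.+1 < i)%N = false by lia.
have [|s sw sz] := IHn w'; first exact: leq_trans lt _.
exists (i :: s); last exact: leq_ltn_trans sz lt.
by rewrite word_perm_cons sw /w' mulgA tperm2 mul1g.
Qed.

Lemma sum_ltn_ord n (c : nat) : (\sum_(l < n.+1) (c < l) = n - c)%N.
Proof.
elim: n => [|n IHn]; first by rewrite big_ord1.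
by rewrite big_ord_recr /= IHn; case: ltnP => /=; lia.
Qed.

(** Each strand k crosses upwards at least as often as there are strands above it. A shortest word
    has no more letters than the sum of these bounds, so each bound is attained. *)
Lemma reduced_word_up s k : reduced_word (w0 r) s -> word_up s k = (r.*2.+1 - k)%N.
Proof.
move=> [sw smin].
have w0V : ((word_perm s)^-1 = w0 r)%g.
  rewrite sw; apply/eqP; rewrite eq_invg_mul; apply/eqP/permP => j.
  by rewrite permM perm1 !permE rev_ordK.
have invE j : inv_at (w0 r) j = (r.*2.+1 - j)%N.
  rewrite -(sum_ltn_ord _ j); apply: eq_bigr => l _.
  rewrite !permE !revE; have := ltn_ord l; have := ltn_ord j.
  by case: ltnP => //= jl lN jN; congr nat_of_bool; lia.
have lower j : (r.*2.+1 - j <= word_up s j)%N.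
  by have := inv_at_le_up s j; rewrite w0V invE.
have upper : (\sum_(j : I) word_up s j <= \sum_(j : I) (r.*2.+1 - j))%N.
  rewrite sum_word_up; have [s' s'w s's] := short_word (w0 r).
  apply: leq_trans (smin _ s'w) _; apply: leq_trans s's _.
  by apply: leq_sum => j _; rewrite invE.
apply/eqP; rewrite eqn_leq lower andbT.
move: upper; rewrite (bigD1 k) //= [X in (_ <= X)%N](bigD1 k) //= => upper.
rewrite -(leq_add2r (\sum_(j | j != k) word_up s j)); apply: leq_trans upper _.
by rewrite leq_add2l; apply: leq_sum => j _; apply: lower.
Qed.
End ReducedWords.

(** * The braid operators and zeta on V *)

Section BraidOperators.
Variable r : nat.
Implicit Types (i : Iint r) (k : Ihalf r).

Lemma Vact_UE i x : Vact (UE i) x = Vgen (gE i) x.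
Proof. exact: Vact_gen. Qed.
Lemma Vact_UF i x : Vact (UF i) x = Vgen (gF i) x.
Proof. exact: Vact_gen. Qed.

Lemma up_neq_dn i : (up i == dn i) = false.
Proof. by rewrite eq_sym dn_up. Qed.

Lemma VgenE_sq i x : Vgen (gE i) (Vgen (gE i) x) = 0.
Proof.
have El := @Vgen_linear r (gE i).
move: x; apply: eq_on_bvec; [exact: lin_comp| |move=> a].
  by move=> c x y; rewrite scaler0 addr0.
rewrite -/(v a) VgenE; case: eqP => _; last exact: lin0.
by rewrite VgenE dn_up.
Qed.
Lemma VgenF_sq i x : Vgen (gF i) (Vgen (gF i) x) = 0.
Proof.
have El := @Vgen_linear r (gF i).
move: x; apply: eq_on_bvec; [exact: lin_comp| |move=> a].
  by move=> c x y; rewrite scaler0 addr0.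
rewrite -/(v a) VgenF; case: eqP => _; last exact: lin0.
by rewrite VgenF up_neq_dn.
Qed.

Lemma qfact0 : qfact 0 = 1.
Proof. exact: big_geq. Qed.
Lemma qfact1 : qfact 1 = 1.
Proof. by rewrite /qfact big_nat1 /qint !expr1 divff ?q2_neq1. Qed.

Lemma Vact_divpow0 (u : U r) x : Vact (divpow u 0) x = x.
Proof. by rewrite Vact_scale qfact0 invr1 scale1r Vact_one. Qed.
Lemma Vact_divpow1 (u : U r) x : Vact (divpow u 1) x = Vact u x.
Proof. by rewrite Vact_scale qfact1 invr1 scale1r. Qed.
Lemma Vact_divpow2 (u : U r) n x : (forall y, Vact u (Vact u y) = 0) ->
  Vact (divpow u n.+2) x = 0.
Proof.
by move=> u2; rewrite Vact_scale !exprS !Vact_mul u2 scaler0.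
Qed.

Definition talpha_term i k (abc : nat * nat * nat) : V r :=
  ((-1) ^+ abc.1.2 * q ^ ((abc.1.2 : int) - (abc.1.1 : int) * (abc.2 : int)))
    *: Vact (divpow (UE i) abc.1.1 * divpow (UF i) abc.1.2
             * divpow (UE i) abc.2) (v k).

Lemma talpha_term0 i k a b c : (1 < a)%N || (1 < b)%N || (1 < c)%N ->
  talpha_term i k (a, b, c) = 0.
Proof.
have E2 x : Vact (UE i) (Vact (UE i) x) = 0 by rewrite !Vact_UE VgenE_sq.
have F2 x : Vact (UF i) (Vact (UF i) x) = 0 by rewrite !Vact_UF VgenF_sq.
have z u : Vact (u : U r) 0 = 0 by exact: (lin0 (Vact_linear u)).
rewrite /talpha_term !Vact_mul /=.
case: a => [|[|a]] /=; [| |by move=> _; rewrite (Vact_divpow2 _ _ E2) scaler0].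
all: case: b => [|[|b]] /=;
  [| |by move=> _; rewrite (Vact_divpow2 _ _ F2) z scaler0].
all: by case: c => [|[|c]] //= _; rewrite (Vact_divpow2 _ _ E2) !z scaler0.
Qed.

(** As E and F square to zero on V, the infinite sum reduces to triples with entries at most 1,
    listed in [s]. *)
Lemma TalphaE i k (s : seq (nat * nat * nat)) : uniq s ->
  (forall a b c, (a <= 1)%N -> (b <= 1)%N -> (c <= 1)%N ->
     ((a, b, c) \in s) = (- (a : int) + (b : int) - (c : int)
      == form (eps k) (alpha i))) ->
  all (fun abc => [&& abc.1.1 <= 1, abc.1.2 <= 1 & abc.2 <= 1]%N) s ->
  Talpha i (v k) = \sum_(abc <- s) talpha_term i k abc.
Proof.
move=> us sP s1; rewrite [LHS]lin_ext_bvec.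
set P := (X in \sum_(_ \in X) _); rewrite -[LHS]/(\sum_(abc \in P) talpha_term i k abc).
rewrite (fsbig_seq _ _ us); symmetry; apply: fsbig_widen => [[[a b] c]|[[a b] c]] /=.
  move=> abcs; have /andP[a1 /andP[b1 c1]] := allP s1 _ abcs.
  by apply/eqP; rewrite -sP.
move=> [/eqP Pabc abcs]; apply: talpha_term0.
apply/negPn/negP; rewrite !negb_or -!leqNgt => /andP[/andP[a1 b1] c1].
by apply: abcs => /=; rewrite sP.
Qed.

Lemma Talpha_dn i : Talpha i (v (dn i)) = - q *: v (up i).
Proof.
rewrite (@TalphaE _ _ [:: (0, 1, 0)%N]) //; last first.
  move=> a b c a1 b1 c1; rewrite form_sym form_alpha_dn.
  by case: a a1 => [|[|]] // _; case: b b1 => [|[|]] // _; case: c c1 => [|[|]].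
rewrite big_seq1 /talpha_term !Vact_mul Vact_divpow0 Vact_divpow1 Vact_divpow0.
rewrite Vact_UF VgenF_dn /=.
have -> : (1%:Z - 0%:Z * 0%:Z)%R = 1 by [].
by rewrite expr1 expr1z mulN1r.
Qed.

Lemma Talpha_up i : Talpha i (v (up i)) = v (dn i).
Proof.
(* The three contributions are E, E and -EFE; on this vector EFE equals E, so a single E
   survives. *)
rewrite (@TalphaE _ _ [:: (1, 0, 0); (0, 0, 1); (1, 1, 1)]%N) //; last first.
  move=> a b c a1 b1 c1; rewrite form_sym form_alpha_up.
  by case: a a1 => [|[|]] // _; case: b b1 => [|[|]] // _; case: c c1 => [|[|]].
rewrite !big_cons big_nil /talpha_term !Vact_mul !Vact_divpow0 !Vact_divpow1.
rewrite !Vact_UE Vact_UF VgenE_up VgenF_dn VgenE_up /=.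
have -> : (0%:Z - 1%:Z * 0%:Z)%R = 0 by [].
have -> : (1%:Z - 1%:Z * 1%:Z)%R = 0 by [].
rewrite !expr0 expr1 expr0z !mulr1 !scale1r.
by rewrite scaleN1r addr0 subrr addr0.
Qed.

Lemma Talpha_other i k : k != dn i -> k != up i -> Talpha i (v k) = v k.
Proof.
move=> kd ku.
rewrite (@TalphaE _ _ [:: (0, 0, 0); (1, 1, 0); (0, 1, 1)]%N) //; last first.
  move=> a b c a1 b1 c1; rewrite form_sym form_alpha_other //.
  by case: a a1 => [|[|]] // _; case: b b1 => [|[|]] // _; case: c c1 => [|[|]].
have z u : Vact (u : U r) 0 = 0 by exact: (lin0 (Vact_linear u)).
rewrite !big_cons big_nil /talpha_term !Vact_mul !Vact_divpow0 !Vact_divpow1.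
rewrite !Vact_UE !Vact_UF VgenE_other // VgenF_other // /= !(lin0 (Vgen_linear _)).
by rewrite !scaler0 !addr0 expr0 expr0z mulr1 scale1r.
Qed.

Lemma Talpha_linear i : linear (Talpha i).
Proof. exact: lin_ext_linear. Qed.

(** A step up contributes -q, a step down contributes 1, and all other basis vectors are fixed. *)
Lemma Tword_v s k : Tword s (v k) =
  (- q) ^+ word_up s k *: v ((word_perm s)^-1%g k).
Proof.
elim: s => [|i s IHs].
  by rewrite /word_perm big_nil invg1 perm1 [Tword _ _]/= expr0 scale1r.
rewrite [Tword _ _]/= IHs (linear_scale (Talpha_linear i)) word_perm_inv_cons /=.
move: (((word_perm s)^-1)%g k) => l; rewrite /adj.
case: tpermP => [->|->|/eqP ld /eqP lu].
- by rewrite eqxx addn1 Talpha_dn scalerA exprSr.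
- by rewrite up_neq_dn addn0 Talpha_up.
- by rewrite (negbTE ld) addn0 Talpha_other.
Qed.

Lemma Tword_linear s : linear (Tword s : V r -> V r).
Proof.
elim: s => [|i s IHs] a x y; first by [].
by rewrite [LHS]/= IHs (Talpha_linear i).
Qed.

Lemma w0V : ((w0 r)^-1 = w0 r)%g.
Proof.
apply/eqP; rewrite eq_invg_mul; apply/eqP/permP => j.
by rewrite permM perm1 !permE rev_ordK.
Qed.

Lemma Tw0_v s k : reduced_word (w0 r) s ->
  Tword s (v k) = (- q) ^+ (r.*2.+1 - k) *: v (rev_ord k).
Proof.
move=> red_s; rewrite Tword_v (reduced_word_up k red_s).
by case: red_s => -> _; rewrite w0V permE.
Qed.

(** On the weights of V every alpha_i, including alpha_0, changes zeta by the same factor -q, so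
    zeta is geometric in the index. *)
Lemma zeta_eps zeta k : is_zeta zeta -> (- q) ^+ k * zeta (eps k) = 1.
Proof.
move=> [z0 zi zn]; have [n kn] : exists n, n = k :> nat by exists k.
elim: n k kn => [|n IHn] k kn.
  rewrite -kn expr0 mul1r; have -> : k = ord0 by apply/val_inj.
  exact: zn.
have nN : (n < r.*2.+1)%N by have := ltn_ord k; rewrite -kn.
have [i ni] : exists i : Iint r, n = i :> nat by exists (Ordinal nN).
have ku : k = up i by apply/val_inj; rewrite [RHS]upE -[LHS]kn ni.
have step : zeta (eps (dn i)) = - q * zeta (eps (up i)).
  have mu : eps (dn i) = eps (up i) + alpha i by rewrite /alpha addrC subrK.
  have [ii|ii] := eqVneq i (i0 r).
    by rewrite mu -z0 ii.
  have iN : i != r :> nat.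
    by apply: contraNneq ii => ir; apply/eqP/val_inj; rewrite [RHS]i0E.
  have iR := ltn_ord i.
  (* The exponent is 1 because the upper index of i is not involved in alpha_(-i): it could be the
     lower index of -i only against parity, and the upper one only for i = 0. *)
  rewrite mu (zi _ _ ii) -mu form_alpha_dn form_alpha_other ?subr0 ?expr1z.
  - by [].
  - by apply/eqP => /(congr1 val); rewrite [LHS]upE [RHS]dnE /=; lia.
  - by apply/eqP => /(congr1 val); rewrite [LHS]upE [RHS]upE /=; lia.
have := IHn (dn i) ni; by rewrite step mulrA -exprSr ku upE.
Qed.
End BraidOperators.

(** * The bar involution of the scalars *)

Section FractionLift.
Variables (R : idomainType) (L : fieldType) (phi : {rmorphism R -> L}).
Hypothesis phi0 : forall x, phi x = 0 -> x = 0.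

Lemma tofrac_numden (x : {fraction R}) :
  FracField.tofrac \d_(repr x) * x = FracField.tofrac \n_(repr x).
Proof.
suff piE (y : {ratio R}) : FracField.tofrac \d_y * \pi_({fraction R})%qT y
    = FracField.tofrac \n_y by have := piE (repr x); rewrite reprK.
unlock FracField.tofrac; rewrite -[LHS]FracField.pi_mul; apply/eqmodP.
rewrite /= FracField.equivfE /FracField.mulf !numden_Ratio
  ?mulf_neq0 ?denom_ratioP ?oner_eq0 //.
by rewrite mulr1 !mul1r mulrC.
Qed.

Definition frac_lift (x : {fraction R}) : L :=
  phi \n_(repr x) / phi \d_(repr x).

Lemma frac_lift_numden x n d : d != 0 ->
  FracField.tofrac d * x = FracField.tofrac n -> phi d * frac_lift x = phi n.
Proof.
move=> d0 xE; have := tofrac_numden x; have := denom_ratioP (repr x).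
rewrite /frac_lift; move: (\n_(repr x)) (\d_(repr x)) => n' d' d0' xE'.
have : n * d' = n' * d.
  by apply/eqP; rewrite -tofrac_eq !tofracM -xE -xE'; apply/eqP; ring.
move=> /(congr1 phi); rewrite !rmorphM => e.
have nz : phi d' != 0 by apply: contraNneq d0' => /phi0 ->.
by rewrite mulrA [phi d * _]mulrC -e mulfK.
Qed.

Lemma phi_neq0 d : d != 0 -> phi d != 0.
Proof. by apply: contraNneq => /phi0 ->. Qed.

Lemma frac_lift_tofrac n : frac_lift (FracField.tofrac n) = phi n.
Proof.
have := @frac_lift_numden (FracField.tofrac n) n 1 (oner_neq0 _).
by rewrite !rmorph1 !mul1r; apply.
Qed.

Lemma frac_liftD : {morph frac_lift : x y / x + y}.
Proof.
move=> x y; have xE := tofrac_numden x; have yE := tofrac_numden y.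
have dx := denom_ratioP (repr x); have dy := denom_ratioP (repr y).
move: (\d_(repr x)) (\d_(repr y)) (\n_(repr x)) (\n_(repr y)) dx dy xE yE
  => d d' n n' d0 d0' xE yE.
have dd0 : d * d' != 0 by rewrite mulf_neq0.
apply: (mulfI (phi_neq0 dd0)).
rewrite (@frac_lift_numden _ (n * d' + n' * d) _ dd0); last first.
  by rewrite tofracD !tofracM -xE -yE; ring.
rewrite rmorphD !rmorphM -(frac_lift_numden d0 xE) -(frac_lift_numden d0' yE).
by ring.
Qed.

Lemma frac_liftM : {morph frac_lift : x y / x * y}.
Proof.
move=> x y; have xE := tofrac_numden x; have yE := tofrac_numden y.
have dx := denom_ratioP (repr x); have dy := denom_ratioP (repr y).
move: (\d_(repr x)) (\d_(repr y)) (\n_(repr x)) (\n_(repr y)) dx dy xE yE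
  => d d' n n' d0 d0' xE yE.
have dd0 : d * d' != 0 by rewrite mulf_neq0.
apply: (mulfI (phi_neq0 dd0)).
rewrite (@frac_lift_numden _ (n * n') _ dd0); last first.
  by rewrite !tofracM -xE -yE; ring.
rewrite !rmorphM -(frac_lift_numden d0 xE) -(frac_lift_numden d0' yE).
by ring.
Qed.
End FractionLift.

Definition poly_qinv : {poly rat} -> Qq :=
  horner_eval q^-1 \o map_poly (@FracField.tofrac _ \o polyC).
HB.instance Definition _ := GRing.RMorphism.on poly_qinv.

Lemma poly_qinvE p :
  poly_qinv p = \sum_(i < size p) FracField.tofrac (p`_i)%:P * q^-1 ^+ i.
Proof.
rewrite /poly_qinv /= /horner_eval horner_coef.
rewrite size_map_poly; apply: eq_bigr => i _; by rewrite coef_map.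
Qed.

(** Multiplying p(q^-1) by q to the degree of p gives the reversed polynomial in q, whose constant
    term is the leading coefficient of p. *)
Lemma poly_qinv_inj p : poly_qinv p = 0 -> p = 0.
Proof.
move=> p0; apply/eqP/negPn/negP => pN0.
pose n := (size p).-1; have sz : size p = n.+1 by rewrite prednK ?size_poly_gt0.
pose p' := \sum_(i < n.+1) p`_i *: 'X^(n - i) : {poly rat}.
have : FracField.tofrac p' = q ^+ n * poly_qinv p.
  rewrite poly_qinvE sz mulr_sumr rmorph_sum; apply: eq_bigr => i _.
  rewrite -mul_polyC rmorphM mulrCA rmorphXn; congr (_ * _); rewrite [LHS]/(q ^+ (n - i)).
  rewrite exprVn; apply: (canRL (mulfK _)); first by rewrite expf_neq0 ?q_neq0.
  by rewrite -exprD subnK // -ltnS.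
rewrite p0 mulr0 => /eqP; rewrite tofrac_eq0 => /eqP /(congr1 (fun p : {poly rat} => p`_0)).
rewrite coef0 coef_sum big_ord_recr /= big1 ?add0r => [|i _].
  rewrite coefZ coefXn subnn mulr1 => /eqP.
  by rewrite -lead_coefE lead_coef_eq0 (negbTE pN0).
by rewrite coefZ coefXn eq_sym subn_eq0 leqNgt ltn_ord mulr0.
Qed.

Lemma barqE x : barq x = frac_lift poly_qinv x.
Proof. by []. Qed.
Lemma barqD : {morph barq : x y / x + y}.
Proof. exact: (frac_liftD poly_qinv_inj). Qed.
Lemma barqM : {morph barq : x y / x * y}.
Proof. exact: (frac_liftM poly_qinv_inj). Qed.
Lemma barq0 : barq 0 = 0.
Proof. by have := frac_lift_tofrac poly_qinv_inj 0; rewrite !rmorph0. Qed.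
Lemma barq1 : barq 1 = 1.
Proof. by have := frac_lift_tofrac poly_qinv_inj 1; rewrite !rmorph1. Qed.
Lemma barq_q : barq q = q^-1.
Proof.
rewrite barqE /q (frac_lift_tofrac poly_qinv_inj).
have /(congr1 (horner_eval (q^-1 : Qq))) := map_polyX (@FracField.tofrac _ \o @polyC rat).
by rewrite /horner_eval hornerX.
Qed.
Lemma barqV x : barq x^-1 = (barq x)^-1.
Proof.
have [->|x0] := eqVneq x 0; first by rewrite invr0 barq0 invr0.
have xV : barq x * barq x^-1 = 1 by rewrite -barqM divff // barq1.
exact: (esym (mulr1_eq xV)).
Qed.
Lemma barqX x n : barq (x ^+ n) = barq x ^+ n.
Proof. by elim: n => [|n IHn]; rewrite ?expr0 ?barq1 // !exprS barqM IHn. Qed.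
Lemma barq_expz (z : int) : barq (q ^ z) = q ^ (- z).
Proof.
case: z => n; first by rewrite -exprnP -exprnN barqX barq_q exprVn.
rewrite NegzE -exprnN opprK barqV barqX barq_q exprVn invrK; exact: exprnP.
Qed.

(** * Bar involution and height filtration on V *)

Section BarOnV.
Variable r : nat.

Definition barV (w : V r) : V r := [ffun a => barq (w a)].

Lemma barVD x y : barV (x + y) = barV x + barV y.
Proof. by apply/ffunP => a; rewrite !ffunE; exact: barqD. Qed.
Lemma barVZ c x : barV (c *: x) = barq c *: barV x.
Proof. by apply/ffunP => a; rewrite !ffunE; exact: barqM. Qed.
Lemma barV0 : barV 0 = 0.
Proof. by apply/ffunP => a; rewrite !ffunE; exact: barq0. Qed.
Lemma barV_v a : barV (v a) = v a.
Proof.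
apply/ffunP => b; rewrite !ffunE; case: eqP => _; [exact: barq1|exact: barq0].
Qed.
Lemma barV_sum (I : Type) (s : seq I) (F : I -> V r) :
  barV (\sum_(i <- s) F i) = \sum_(i <- s) barV (F i).
Proof. exact: (big_morph _ barVD barV0). Qed.

Lemma Vgen_barV g g' : (forall a, Vgen g' (v a) = barV (Vgen g (v a))) ->
  forall w, Vgen g' (barV w) = barV (Vgen g w).
Proof.
move=> gg w; rewrite (linear_sum_bvec (@Vgen_linear r g')).
rewrite (linear_sum_bvec (@Vgen_linear r g)) barV_sum.
by apply: eq_bigr => a _; rewrite barVZ ffunE -gg.
Qed.

(** Conjugation by the coefficientwise bar of V realizes psi: it inverts the powers of q by which K
    acts and leaves E and F unchanged. *)
Lemma lact_psi_expr x w :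
  lact (@Vgen r) (psi_expr x) (barV w) = barV (lact (@Vgen r) x w).
Proof.
elim: x w => [c|g|x IHx y IHy|x IHx y IHy] w.
- by rewrite /= barVZ.
- case: g => i; apply: Vgen_barV => a.
  + by rewrite !VgenE; case: eqP; rewrite ?barV_v ?barV0.
  + by rewrite !VgenF; case: eqP; rewrite ?barV_v ?barV0.
  + by rewrite VgenK VgenV barVZ barV_v barq_expz.
  + by rewrite VgenK VgenV barVZ barV_v barq_expz opprK.
- by rewrite /= barVD IHx IHy.
- by rewrite /= -IHx -IHy.
Qed.

Lemma Vact_psi (u : U r) a : Vact (psi u) (v a) = barV (Vact u (v a)).
Proof. by rewrite /psi Vact_cls -[in LHS](barV_v a) lact_psi_expr. Qed.

Lemma Vact_sum (I : Type) (s : seq I) (F : I -> U r) w :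
  Vact (\sum_(i <- s) F i) w = \sum_(i <- s) Vact (F i) w.
Proof.
by apply: (big_morph (fun u => Vact u w)) => [x y|]; rewrite ?Vact_add ?Vact_zero.
Qed.

Lemma Vact_F_word (s : seq (Iint r)) a :
  Vact (\prod_(i <- s) UF i) (v a) = 0 \/
  exists2 b : Ihalf r, b = (a + size s)%N :> nat &
    Vact (\prod_(i <- s) UF i) (v a) = v b.
Proof.
elim: s => [|i s [IHs|[b ba IHs]]].
- by right; exists a; rewrite ?addn0 // big_nil Vact_one.
- by left; rewrite big_cons Vact_mul IHs (lin0 (Vact_linear _)).
rewrite big_cons Vact_mul IHs Vact_UF VgenF; case: eqP => [bi|_]; last by left.
by right; exists (up i); rewrite // upE addnS -ba bi.
Qed.

Lemma ht_count (s : seq (Iint r)) (mu : {ffun Iint r -> nat}) :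
  (forall i, count_mem i s = mu i) -> ht mu = size s.
Proof.
move=> smu; rewrite /ht -(eq_bigr _ (fun i _ => smu i)) {smu mu}.
elim: s => [|j s IHs]; first exact: big1.
rewrite /= big_split /= IHs (bigD1 j) //= eqxx big1 ?addn0 //.
by move=> i /negbTE; rewrite eq_sym => ->.
Qed.

(** Each F raises the index of a basis vector by one or kills it, so weight -mu raises it by the
    height of mu. *)
Lemma Uminus_shift mu (x : U r) (a b : Ihalf r) : Uminus mu x ->
  b != (a + ht mu)%N :> nat -> Vact x (v a) b = 0.
Proof.
move=> xm ba; elim: xm => [|c y z [s smu ->] _ IHz].
  by rewrite Vact_zero ffunE.
rewrite Vact_add Vact_scale !ffunE [X in _ + X]IHz addr0.
case: (Vact_F_word s a) => [->|[d da ->]]; first by rewrite ffunE; exact: mulr0.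
rewrite !ffunE; case: eqP => [bd|_]; last exact: mulr0.
by rewrite bd da (ht_count smu) eqxx in ba.
Qed.

Lemma Uminus_nilp mu (x : U r) w : Uminus mu x -> (r.*2.+2 <= ht mu)%N -> Vact x w = 0.
Proof.
move=> xm mur; move: w; apply: eq_on_bvec (Vact_linear x) _ _ => [c y z|a].
  by rewrite scaler0 addr0.
apply/ffunP => b; rewrite [RHS]ffunE; apply: (Uminus_shift xm).
by have := ltn_ord b; apply: contraTneq => ->; rewrite -leqNgt (leq_trans mur) ?leq_addl.
Qed.

(** Deep terms of the filtration vanish on V, so an identity in the completion becomes an identity
    of operators. *)
Lemma Ufil_nilp N (x : U r) w : (r.*2.+2 <= N)%N -> Ufil N x -> Vact x w = 0.
Proof.
move=> rN; elim=> [|c y z [a [b [d [mu [_ _ dm Nmu ->]]]]] _ IHz].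
  exact: Vact_zero.
rewrite Vact_add Vact_scale IHz addr0 !Vact_mul.
rewrite (Uminus_nilp _ dm (leq_trans rN Nmu)).
by rewrite !(lin0 (Vact_linear _)) scaler0.
Qed.

Lemma finite_ht M : cardinality.finite_set
  [set mu : {ffun Iint r -> nat} | (ht mu < M)%N]%classic.
Proof.
pose f (g : {ffun Iint r -> 'I_M}) := [ffun i => val (g i)] : {ffun Iint r -> nat}.
apply: (cardinality.sub_finite_set _
  (cardinality.finite_image f (@cardinality.finite_finset _ setT))) => mu /= muM.
have muiM i : (mu i < M)%N.
  by apply: leq_ltn_trans muM; rewrite /ht (bigD1 i) //= leq_addr.
by exists [ffun i => Ordinal (muiM i)] => //; apply/ffunP => i; rewrite !ffunE.
Qed.
End BarOnV.

Lemma Vact_it_coef r (y : V r) c : Vact (it r) y c =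
  if c == dn (i0 r) then y (up (i0 r)) + q^-1 * y (dn (i0 r))
  else if c == up (i0 r) then y (dn (i0 r)) + q * y (up (i0 r)) else y c.
Proof.
move: y; apply: (@eq_on_bvec _ Qq^o) => [k x y|k x y|a].
- by rewrite Vact_linear !ffunE.
- rewrite !ffunE; case: eqP => _; last case: eqP => _; last exact: erefl.
    by rewrite /GRing.scale /=; ring.
  by rewrite /GRing.scale /=; ring.
rewrite -/(v a); have [->|ad] := eqVneq a (dn (i0 r)).
  rewrite Vact_it_dn !ffunE !eqxx up_neq_dn /GRing.scale /=.
  have [->|cd] := eqVneq c (dn (i0 r)); first by rewrite dn_up add0r.
  rewrite mulr0 addr0; case: eqVneq => _; last exact: erefl.
  by rewrite mulr0 addr0.
have [->|au] := eqVneq a (up (i0 r)).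
  rewrite Vact_it_up !ffunE !eqxx dn_up /GRing.scale /=.
  have [->|cd] := eqVneq c (dn (i0 r)); first by rewrite dn_up !mulr0.
  have [_|cu] := eqVneq c (up (i0 r)); first exact: erefl.
  by rewrite mulr0 addr0.
rewrite Vact_it_other // !ffunE.
have -> : (dn (i0 r) == a) = false by rewrite eq_sym (negbTE ad).
have -> : (up (i0 r) == a) = false by rewrite eq_sym (negbTE au).
rewrite !mulr0 !addr0.
have [->|_] := eqVneq c (dn (i0 r)); first by rewrite eq_sym (negbTE ad).
by have [->|//] := eqVneq c (up (i0 r)); rewrite eq_sym (negbTE au).
Qed.

Lemma scale0_add (K : fieldType) (c : K) :
  true%:R + c *: (false%:R : K^o) = 1.
Proof. by rewrite scaler0 addr0. Qed.
Lemma coef_up_eq (K : fieldType) (c p p' : K) :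
  c + p' * 1 = false%:R + p *: (1 : K^o) ->
  c = false%:R + (p - p') *: (true%:R : K^o).
Proof.
rewrite /GRing.scale /= !mulr1 !add0r => cp.
by rewrite -cp addrK.
Qed.
Lemma coef_other_eq (K : fieldType) (c p p' : K) : 1 - p != 0 ->
  c = false%:R + p *: (c : K^o) -> c = false%:R + p' *: (false%:R : K^o).
Proof.
rewrite /GRing.scale /= mulr0 !add0r => p1 cp; apply: (mulfI p1).
by rewrite mulrBl mul1r -cp subrr mulr0.
Qed.

(** * Upsilon on V *)

Section UpsilonOnV.
Variable r : nat.
Variables (psi_i : U r -> U r) (Ups : {ffun Iint r -> nat} -> U r).
Hypotheses (psi_iP : is_psi_iota psi_i) (UpsP : is_Upsilon psi_i Ups).
Local Notation Y := (Upsilon_act Ups).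

Lemma Upsilon_act_partial N x : (r.*2.+2 <= N)%N -> Y x = Vact (partial_sum Ups N) x.
Proof.
move=> rN; rewrite /partial_sum /Upsilon_act.
rewrite (fsbig_finite _ _ (finite_ht r N)) Vact_sum -(fsbig_finite _ _ (finite_ht r N)).
symmetry; apply: fsbig_widen => // mu [_ /negP muN] /=.
apply: (Uminus_nilp _ (Upsilon_minus UpsP mu)).
by rewrite (leq_trans rN) // leqNgt.
Qed.

Lemma Upsilon_linear : linear Y.
Proof. by move=> c x y; rewrite !(Upsilon_act_partial _ (leqnn _)) Vact_linear. Qed.

(** Take the intertwining condition at filtration level 2r + 2, where the error term acts by zero,
    with a partial sum long enough to act as Upsilon. *)
Lemma Upsilon_comm u x : Uiota u -> Y (Vact (psi u) x) = Vact (psi_i u) (Y x).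
Proof.
move=> uP; have [N0 NP] := Upsilon_intertwines UpsP uP r.*2.+2.
pose N := maxn N0 r.*2.+2.
have rN : (r.*2.+2 <= N)%N by rewrite leq_maxr.
have := Ufil_nilp x (leqnn _) (NP N (leq_maxl _ _)).
rewrite Vact_add Vact_opp !Vact_mul -!(Upsilon_act_partial _ rN).
by move/eqP; rewrite subr_eq0 => /eqP ->.
Qed.

(** Terms of positive height strictly raise the index, so Upsilon is unitriangular. *)
Lemma Upsilon_coef (a b : Ihalf r) : (b <= a)%N -> Y (v a) b = (b == a)%:R.
Proof.
move=> ba; rewrite (Upsilon_act_partial _ (leqnn _)) /partial_sum.
set N := r.*2.+2; rewrite (fsbig_finite _ _ (finite_ht r N)) Vact_sum sum_ffunE.
rewrite -(fsbig_finite _ (fun mu => Vact (Ups mu) (v a) b) (finite_ht r N)).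
pose z : {ffun Iint r -> nat} := [ffun=> 0%N].
have hz : ht z = 0%N by apply: big1 => i _; rewrite ffunE.
rewrite -(@fsbig_widen _ _ _ _ [set z]%classic) ?fsbig_set1.
- by rewrite (Upsilon_0 UpsP) Vact_one ffunE.
- by move=> mu ->; rewrite /= hz.
move=> mu [_ muz] /=; apply: (Uminus_shift (Upsilon_minus UpsP mu)).
apply: contraTneq ba => ->; rewrite -ltnNge -[X in (X < _)%N]addn0 ltn_add2l lt0n.
apply: contra_not_neq muz => /eqP; rewrite sum_nat_eq0 => /forallP mu0.
by apply/ffunP => i; rewrite ffunE; apply/eqP/(implyP (mu0 i)).
Qed.

Lemma Upsilon_top : Y (v ord_max) = v ord_max.
Proof.
apply/ffunP => b; rewrite Upsilon_coef; last by rewrite -ltnS.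
by rewrite ffunE.
Qed.

(** If [u] is fixed by [psi_i] and sends the basis vector to a bar-invariant vector, then psi(u) and
    u agree on it, and the intertwining relation becomes commutation. *)
Lemma Upsilon_bar01 u a (w : V r) : Uiota u -> psi_i u = u ->
  Vact u (v a) = w -> barV w = w -> Vact u (Y (v a)) = Y w.
Proof.
by move=> uP pu uw bw; rewrite -[u in LHS]pu -Upsilon_comm // Vact_psi uw bw.
Qed.

(** Descending induction from the top vector, which Upsilon fixes by triangularity: e_i sends
    v_(a+1) to v_a and commutes with Upsilon there. *)
Lemma Upsilon_pos (a : Ihalf r) : (r < a)%N -> Y (v a) = v a.
Proof.
have [n] := ubnP (r.*2.+1 - a); elim: n a => [|n IHn] a //.
rewrite ltnS => an ra.
have [am|aN] := eqVneq a ord_max; first by rewrite am Upsilon_top.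
have aR : (a < r.*2.+1)%N by have := ltn_ord a; move: aN; rewrite -val_eqE /=; lia.
have iR : (a - r.+1 < r)%N by rewrite ltn_subLR; lia.
pose i := Ordinal iR.
have ai : a = dn (ipos i) by apply/val_inj; rewrite [RHS]iposE /=; lia.
have ui : up (ipos i) = a.+1 :> nat by rewrite upE ai.
have Ei : Vact (ie i) (v (up (ipos i))) = v a by rewrite Vact_ie_v eqxx -ai.
rewrite -(Upsilon_bar01 _ _ Ei) ?barV_v //.
- by rewrite IHn ?ui; [exact: Ei| lia | lia].
- by apply: subalg_in; right; exists i; apply: Or41.
- exact: (psi_iota_e psi_iP).
Qed.

(** With y the image of the lower middle vector d and u the upper one, bar invariance of t gives t y
    = v_u + q y. The coordinate at d yields y_u = q - q^-1, and every coordinate other than d and u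
    satisfies y_c = q y_c, hence vanishes. *)
Lemma Upsilon_dn_i0 :
  Y (v (dn (i0 r))) = v (dn (i0 r)) + (q - q^-1) *: v (up (i0 r)).
Proof.
set d := dn _; set u := up _.
have uP : (r < u)%N by rewrite upE i0E.
have yd : Y (v d) d = 1 by rewrite Upsilon_coef // eqxx.
have ty : Vact (it r) (Y (v d)) = v u + q *: Y (v d).
  rewrite -[it r in LHS](psi_iota_t psi_iP) -Upsilon_comm; last first.
    by apply: subalg_in; left.
  rewrite Vact_psi Vact_it_dn barVD barVZ !barV_v barqV barq_q invrK.
  rewrite (linear_add Upsilon_linear) (linear_scale Upsilon_linear).
  by rewrite Upsilon_pos.
have q1 : 1 - q != 0.
  by rewrite subr_eq0; apply: contra_neq q2_neq1 => <-; rewrite invr1 subrr.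
move: yd (fun c => congr1 (fun y : V r => y c : Qq) ty); move: (Y (v d)) => y yd yc.
apply/ffunP => c; have := yc c; have := yc d; rewrite !Vact_it_coef !ffunE.
rewrite -/d -/u !eqxx dn_up yd => ydE ycE.
have [->|cd] := eqVneq c d; first by rewrite yd dn_up; symmetry; apply: scale0_add.
have [cu|cu] := eqVneq c u; first by rewrite cu; apply: (coef_up_eq ydE).
rewrite (negbTE cd) (negbTE cu) in ycE.
exact: (coef_other_eq _ q1 ycE).
Qed.

(** Induction upwards from the middle: f_i raises the positive index in v_a and lowers the negative
    one in v_(-a) simultaneously, so it transports the whole formula. *)
Lemma Upsilon_neg (a : Ihalf r) : (r < a)%N ->
  Y (v (rev_ord a)) = v (rev_ord a) + (q - q^-1) *: v a.
Proof.
have [n] := ubnP a; elim: n a => [|n IHn] a //; rewrite ltnS => an ra.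
have ar := ltn_ord a; have [ar1|aN] := eqVneq (a : nat) r.+1.
  have -> : a = up (i0 r) by apply/val_inj; rewrite [RHS]upE i0E.
  by rewrite rev_up_i0 Upsilon_dn_i0.
have iR : (a - r.+2 < r)%N by rewrite ltn_subLR; lia.
pose i := Ordinal iR.
have ai : a = up (ipos i) by apply/val_inj; rewrite [RHS]upE iposE /=; lia.
have di : a = (dn (ipos i)).+1 :> nat by rewrite ai upE.
have rd := dn_ipos_gt i.
have Fi : Vact (if_ i) (v (rev_ord (dn (ipos i)))) = v (rev_ord a).
  by rewrite Vact_if_v (negbTE (rev_gt rd rd)) eqxx -ai.
rewrite -(Upsilon_bar01 _ _ Fi) ?barV_v //.
- rewrite IHn; [|by rewrite -di|exact: rd].
  rewrite (linear_add (Vact_linear _)) (linear_scale (Vact_linear _)) Fi.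
  by rewrite Vact_if_v eqxx -ai.
- by apply: subalg_in; right; exists i; apply: Or42.
- exact: (psi_iota_f psi_iP).
Qed.
End UpsilonOnV.

Lemma addr_scaleBK (K : pzRingType) (W : lmodType K) (x y : K) (u w : W) :
  u + (x - y) *: w + (y - x) *: w = u.
Proof. by rewrite -[x - y]opprB scaleNr subrK. Qed.

Section OperatorTOnV.
Variables (r : nat) (psi_i : U r -> U r) (Ups : {ffun Iint r -> nat} -> U r).
Variables (zeta : Lambda r -> Qq) (s : seq (Iint r)).
Hypotheses (psi_iP : is_psi_iota psi_i) (UpsP : is_Upsilon psi_i Ups).
Hypotheses (zetaP : is_zeta zeta) (red_s : reduced_word (w0 r) s).
Local Notation T := (calT Ups zeta s).

Lemma calT_linear : linear T.
Proof.
have Yl := Upsilon_linear UpsP; have zl : linear (zeta_act zeta).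
  exact: lin_ext_linear.
exact: (lin_comp Yl (lin_comp zl (Tword_linear s))).
Qed.

(** The power of -q produced by T_(w_0) is the one that zeta cancels on the weight of the reversed
    vector, leaving Upsilon alone. *)
Lemma calT_v k : T (v k) = Upsilon_act Ups (v (rev_ord k)).
Proof.
have zl : linear (zeta_act zeta) by exact: lin_ext_linear.
rewrite /calT /= (Tw0_v k red_s) (linear_scale zl) [zeta_act _ _]lin_ext_bvec.
rewrite scalerA -[in X in _ ^+ X](revE k) (zeta_eps _ zetaP).
by congr (Upsilon_act _ _); exact: scale1r.
Qed.

Lemma calT_pos (a : Ihalf r) : (r < a)%N ->
  T (v a) = v (rev_ord a) + (q - q^-1) *: v a.
Proof. by move=> ra; rewrite calT_v (Upsilon_neg psi_iP UpsP ra). Qed.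
Lemma calT_neg (a : Ihalf r) : (r < a)%N -> T (v (rev_ord a)) = v a.
Proof. by move=> ra; rewrite calT_v rev_ordK (Upsilon_pos psi_iP UpsP ra). Qed.

Lemma calTK : cancel T (@theta r).
Proof.
have tl := @theta_linear r.
apply: v_ext => [||a ra|a ra]; [exact: (lin_comp tl calT_linear)|exact: lin_id| |].
  rewrite (calT_pos ra) (linear_add tl) (linear_scale tl) (theta_gt ra) (theta_rev ra).
  exact: addr_scaleBK.
by rewrite (calT_neg ra) (theta_gt ra).
Qed.

Lemma thetaK : cancel (@theta r) T.
Proof.
have tl := @theta_linear r; have Tl := calT_linear.
apply: v_ext => [||a ra|a ra]; [exact: (lin_comp Tl tl)|exact: lin_id| |].
  by rewrite (theta_gt ra) (calT_neg ra).
rewrite (theta_rev ra) (linear_add Tl) (linear_scale Tl) (calT_pos ra) (calT_neg ra).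
exact: addr_scaleBK.
Qed.
End OperatorTOnV.

Lemma tensor_theta_H0 r m (w : Vt r m.+1) :
  tensor_map (@theta r) id w = Hact w (H ord0).
Proof.
rewrite [RHS]Hact_gen; move: w.
apply: eq_on_pure => [||x w].
- exact: tensor_map_linear.
- exact: Hgen_linear.
rewrite tensor_map_pure ?Hgen_head_flip //.
exact: theta_linear.
Qed.

Theorem theorem5p4 (r m : nat) :
  (forall (psi_i : U r -> U r) (Ups : {ffun Iint r -> nat} -> U r)
      (zeta : Lambda r -> Qq) (s : seq (Iint r)),
    is_psi_iota psi_i -> is_Upsilon psi_i Ups -> is_zeta zeta ->
    reduced_word (w0 r) s ->
    exists Tinv : V r -> V r,
      [/\ cancel (calT Ups zeta s) Tinv, cancel Tinv (calT Ups zeta s) &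
        forall w : Vt r m.+1, tensor_map Tinv id w = Hact w (H ord0)])
  /\
  [/\ forall (u : U r) (h : HeckeB m.+1) (w : Vt r m.+1), Uiota u ->
        Hact (Vtact u w) h = Vtact u (Hact w h),
      forall phi : {linear Vt r m.+1 -> Vt r m.+1},
        (exists2 u : U r, Uiota u & forall w, phi w = Vtact u w) <->
        (forall (h : HeckeB m.+1) w, phi (Hact w h) = Hact (phi w) h) &
      forall phi : {linear Vt r m.+1 -> Vt r m.+1},
        (exists h : HeckeB m.+1, forall w, phi w = Hact w h) <->
        (forall (u : U r) w, Uiota u -> phi (Vtact u w) = Vtact u (phi w))].
Proof.
split=> [psi_i Ups zeta s psi_iP UpsP zetaP red_s|].
  exists (@theta r); split; [exact: (calTK psi_iP UpsP zetaP red_s)| |].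
    exact: (thetaK psi_iP UpsP zetaP red_s).
  exact: tensor_theta_H0.
split=> [u h w uP|phi|phi].
- exact: Hact_Vtact.
- exact: Uiota_double_centralizer.
- exact: Hecke_double_centralizer.
Qed.
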